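(* Let $k$ be a field complete with respect to a non-Archimedean absolute value, and assume that $k$ is algebraically closed, or trivially-valued, or spherically complete of residue characteristic zero. Let $X$ be the Berkovich closed unit disc over $k$, and let $\varphi$ be a quasisubharmonic function on $X$ with $\varphi\le 0$. For $m\ge 1$ let $\varphi_m$ be the non-Archimedean Demailly approximation associated to $\mathcal{H}_{m\varphi}$. Then for every integer $m\ge 1$ and every $x\in X$, $$\varphi(x)\le\varphi_m(x)\le\varphi(x)+\frac{1}{m}A_X(x).$$ In particular, the sequence $(\varphi_m)_{m=1}^\infty$ converges pointwise to $\varphi$ on $\{A_X<+\infty\}\subseteq X$.
   Context: Disc. Let $k$ be complete with respect to a (possibly trivial) non-Archimedean absolute value $|\cdot|$, $K$ the completion of an algebraic closure $k^a$, $K^\circ=\{|\cdot|\le 1\}\subset K$. $k\{T\}$ is the Tate algebra of power series $\sum a_iT^i$ over $k$ with $|a_i|\to 0$, with Gauss norm $\max_i|a_i|$. $X=\mathscr{M}(k\{T\})$ is the set of multiplicative seminorms $x$, $f\mapsto |f(x)|$, on $k\{T\}$ extending $|\cdot|$ on $k$ and bounded by the Gauss norm, with the topology of pointwise convergence; the Gauss norm is the Gauss point $x_G\in X$. Order: $x\le y$ iff $|f(x)|\le|f(y)|$ for all $f\in k\{T\}$; this makes $X$ a rooted tree with root (maximum) $x_G$; $x\vee y$ is the least upper bound and $[x,y]$ the unique segment joining $x,y$. $\pi\colon X_K=\mathscr{M}(K\{T\})\to X$ is the restriction map. For $w\in K^\circ$, $s\in[0,1]$, $x_{w,s}$ is the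 seminorm $f\mapsto\sup_{\overline D(w,s)}|f|$ on $K\{T\}$ (or its image in $X$). Rigid points are the images of $x_{w,0}$ with $w\in k^a$, $|w|\le 1$; they form the set $X^{\mathrm{rig}}$. The multiplicity is $m(x)=\#\pi^{-1}(x)\in\mathbf{Z}_{>0}\cup\{\infty\}$. Radius and metric. The radius function $r\colon X\to[0,1]$ is induced by the Galois-invariant function on $X_K$ with $r(x_{w,s})=s$ and $r(\lim x_{w_i,s_i})=\lim s_i$ for a point given by a decreasing sequence of discs $\overline D(w_i,s_i)$ with empty intersection. $A_X=-\log r\colon X\to[0,+\infty]$. The function $\alpha\colon X\to[0,+\infty]$ is determined by $\alpha(x_G)=0$ and $\alpha(x)-\alpha(y)=-\int_y^x\frac{1}{m(u)}\,d(\log r(u))$ along the segment from $y$ to $x$. The generalized metric is $d(x,y)=|\alpha(x)-\alpha(x\vee y)|+|\alpha(y)-\alpha(x\vee y)|$. Directional derivatives and convexity on segments are taken with respect to $d$. Quasisubharmonic functions. A finite subtree is the convex hull of finitely many points. Let $\rho_0$ be a positive real multiple of the Dirac mass $\delta_{x_G}$. A function $\varphi\colon X\to[-\infty,\infty)$ is $\rho_0$-subharmonic if: (i) for every finite subtree $Y\subset X\setminus X^{\mathrm{rig}}$ containing $x_G$, $\varphi|_Y$ is continuous, is convex on every segment of $Y$ not containing $x_G$, and satisfies $\rho_0\{y\}+\sum_{\vec v\in T_yY}d_{\vec v}(\varphi|_Y)\ge 0$ for all $y\in Y$ ($T_yY$ the set of tangent directions at $y$ in $Y$, $d_{\vec v}$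 the directional derivative); (ii) $\varphi=\lim_Y \varphi\circ\mathfrak r_Y$ pointwise over the net of such $Y$, $\mathfrak r_Y\colon X\to Y$ the retraction. Such $\varphi$ takes the value $-\infty$ only at points with $\alpha=+\infty$. $\varphi$ is quasisubharmonic if it is $\rho_0$-subharmonic for some such $\rho_0$. Norms and approximation. For $\varphi\le 0$ quasisubharmonic and $f\in k\{T\}$, with $Z(\varphi)=\{\varphi=-\infty\}$ and $e^{-\infty}=0$, put $\|f\|_\varphi=\sup_{x\in X\setminus Z(\varphi)}|f(x)|e^{-\varphi(x)-A_X(x)}$, $\|f\|^+_\varphi=\lim_{\epsilon\to0^+}\|f\|_{(1+\epsilon)\varphi}\in[0,+\infty]$, and $\mathcal{H}_\varphi=\{f\in k\{T\}:\|f\|_\varphi^+<+\infty\}$, an ideal of $k\{T\}$. For an integer $m\ge1$, the non-Archimedean Demailly approximation is $$\varphi_m=\frac1m\Big(\sup_{f\in\mathcal{H}_{m\varphi}\setminus\{0\}}\log\frac{|f|}{\|f\|^+_{m\varphi}}\Big)^*,$$ where $(-)^*$ denotes the upper-semicontinuous regularization (the smallest upper-semicontinuous function bounding the given function from above).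
   Formalization: In the trivially-valued case k is also assumed perfect: with m(x) = #π⁻¹(x) and the given radius, the lower bound φ ≤ φ_m fails for every imperfect trivially-valued k (φ = -cA_X, 1<c<p, on the branch of T^p - a, and 0 elsewhere). *)

(* Defs.v *)
From HB Require Import structures.
From mathcomp Require Import all_boot all_order all_algebra.
From mathcomp Require Import all_classical all_reals all_analysis.
From mathcomp Require Import finmap.

Set Implicit Arguments.
Unset Strict Implicit.
Unset Printing Implicit Defensive.

Import Order.TTheory GRing.Theory Num.Theory.
Import numFieldNormedType.Exports.

Local Open Scope classical_set_scope.
Local Open Scope ring_scope.

(* A field with a non-Archimedean absolute value, the trivial one included. *)
Record valuedField (R : realType) := ValuedField {
  vf_sort :> fieldType;
  vabs : vf_sort -> R;
  vabs_ge0 : forall a, 0 <= vabs a;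
  vabs_eq0 : forall a, vabs a = 0 <-> a = 0;
  vabsM : forall a b, vabs (a * b) = vabs a * vabs b;
  vabsD_max : forall a b, vabs (a + b) <= Num.max (vabs a) (vabs b)
}.

Section ValuedField.
Variables (R : realType) (k : valuedField R).
Implicit Types a b : k.

Definition vf_complete := forall u : nat -> k,
  (forall e : R, 0 < e -> exists N, forall m n, (N <= m)%N -> (N <= n)%N ->
     vabs (u m - u n) < e) ->
  exists l : k, vabs (u n - l) @[n --> \oo] --> (0 : R).

Definition trivially_valued := forall a, a != 0 -> vabs a = 1.

Definition spherically_complete := forall (c : nat -> k) (s : nat -> R),
  (forall i, 0 <= s i) ->
  (forall i, s i.+1 <= s i) -> (forall i, vabs (c i.+1 - c i) <= s i) ->
  exists z, forall i, vabs (z - c i) <= s i.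

(* n is nonzero in the residue field {|.| <= 1} / {|.| < 1} for all n > 0. *)
Definition residue_char0 := forall n, (0 < n)%N -> ~ vabs (n%:R : k) < 1.

(* If k is trivially valued and imperfect, |P| = r^p on the branch of an
   inseparable P = T^p - a, while that branch has multiplicity 1; the function
   equal to - c A_X there and to 0 elsewhere, p = 2 and c = 3/2, is then
   subharmonic and strictly larger than its first approximation, which is at
   most - 2 A_X on the branch. *)
Definition perfect_field := forall p, p \in [pchar k] ->
  forall a, exists b, b ^+ p = a.

Lemma vabs0 : vabs (0 : k) = 0. Proof. exact/vabs_eq0. Qed.

Lemma vabs1 : vabs (1 : k) = 1.
Proof.
have n0 : vabs (1 : k) != 0.
  by apply/eqP => /vabs_eq0 /eqP; rewrite oner_eq0.
by apply: (mulfI n0); rewrite -vabsM !mulr1.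
Qed.

Lemma vabsN a : vabs (- a) = vabs a.
Proof.
have e1 : vabs (-1 : k) = 1.
  have : vabs (-1 : k) ^+ 2 = 1 by rewrite expr2 -vabsM mulrNN mulr1 vabs1.
  by move/eqP; rewrite sqrp_eq1 ?vabs_ge0// => /eqP.
by rewrite -mulN1r vabsM e1 mul1r.
Qed.

Lemma vabs_sum_le (I : Type) (r : seq I) (P : pred I) (F : I -> k) (M : R) :
  0 <= M -> (forall i, P i -> vabs (F i) <= M) ->
  vabs (\sum_(i <- r | P i) F i) <= M.
Proof.
move=> M0 FM; elim/big_ind : _ => //; first by rewrite vabs0.
by move=> a b aM bM; rewrite (le_trans (vabsD_max _ _))// ge_max aM.
Qed.

Lemma vabs_sum_lt (I : Type) (r : seq I) (P : pred I) (F : I -> k) (M : R) :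
  0 < M -> (forall i, P i -> vabs (F i) < M) ->
  vabs (\sum_(i <- r | P i) F i) < M.
Proof.
move=> M0 FM; elim/big_ind : _ => //; first by rewrite vabs0.
by move=> a b aM bM; rewrite (le_lt_trans (vabsD_max _ _))// gt_max aM.
Qed.

Lemma vabsD_lt a b : vabs b < vabs a -> vabs (a + b) = vabs a.
Proof.
move=> ba; apply/eqP; rewrite eq_le; apply/andP; split.
  by rewrite (le_trans (vabsD_max _ _))// ge_max lexx ltW.
rewrite leNgt; apply/negP => ab_a.
have : vabs a < vabs a.
  rewrite -{1}(addrK b a) (le_lt_trans (vabsD_max _ _))// vabsN gt_max.
  by rewrite ab_a.
by rewrite ltxx.
Qed.

(* The Tate algebra k{T}: coefficient sequences tending to zero. *)
Definition tate_pred : {pred nat -> k} :=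
  [pred a | `[< vabs (a i) @[i --> \oo] --> (0 : R) >]].

Lemma tate_predP (a : nat -> k) :
  reflect (forall e : R, 0 < e -> exists N, forall i, (N <= i)%N -> vabs (a i) < e)
          (a \in tate_pred).
Proof.
apply: (iffP (asboolP _)).
- move=> /cvgrPdist_lt a0 e e0; have [N _ aN] := a0 e e0.
  exists N => i Ni; have := aN i Ni.
  by rewrite /= sub0r normrN ger0_norm// vabs_ge0.
- move=> a0; apply/cvgrPdist_lt => e e0; have [N aN] := a0 e e0.
  by exists N => // i /aN; rewrite /= sub0r normrN ger0_norm// vabs_ge0.
Qed.

Fact tate_zmod_closed : zmod_closed tate_pred.
Proof.
split=> [|a b /tate_predP a0 /tate_predP b0]; apply/tate_predP => e e0.
  by exists 0%N => i _; rewrite vabs0.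
have [[N aN] [M bM]] := (a0 e e0, b0 e e0).
exists (maxn N M) => i; rewrite geq_max => /andP[/aN ai /bM bi].
by rewrite (le_lt_trans (vabsD_max _ _))// vabsN gt_max ai.
Qed.

HB.instance Definition _ :=
  GRing.isZmodClosed.Build (nat -> k) tate_pred tate_zmod_closed.

Record tate := Tate { tate_coef :> nat -> k; tateP : tate_coef \in tate_pred }.

HB.instance Definition _ := [isSub for tate_coef].
HB.instance Definition _ := [Choice of tate by <:].
HB.instance Definition _ := [SubChoice_isSubZmodule of tate by <:].

Implicit Types f g h : tate.

Lemma tate_ext f g : f =1 g -> f = g.
Proof. by move=> fg; apply/val_inj/funext. Qed.

Lemma tate_coefD f g n : (f + g) n = f n + g n.
Proof. by []. Qed.

Lemma tate_coef0 n : (0 : tate) n = 0.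
Proof. by []. Qed.

Lemma tate_coefN f n : (- f) n = - f n.
Proof. by []. Qed.

Lemma tate_cvg f (e : R) : 0 < e ->
  exists N, forall i, (N <= i)%N -> vabs (f i) < e.
Proof. exact: (tate_predP _ (tateP f)). Qed.

Lemma tate_bounded f : exists M : R, 0 < M /\ forall i, vabs (f i) <= M.
Proof.
have [N fN] := tate_cvg f ltr01.
exists (1 + \sum_(i < N) vabs (f i)); split=> [|i].
  by rewrite ltr_wpDr// sumr_ge0// => i _; exact: vabs_ge0.
have [/fN /ltW f1|iN] := leqP N i.
  by rewrite (le_trans f1)// lerDl sumr_ge0// => j _; exact: vabs_ge0.
rewrite (bigD1 (Ordinal iN))//= addrCA lerDl addr_ge0// sumr_ge0// => j _.
exact: vabs_ge0.
Qed.

(* Cauchy product of power series. *)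
Definition tate_mul_coef f g (n : nat) : k := \sum_(i < n.+1) f i * g (n - i)%N.

Fact tate_mul_subproof f g : tate_mul_coef f g \in tate_pred.
Proof.
apply/tate_predP => e e0.
have [[M [M0 fM]] [M' [M'0 gM']]] := (tate_bounded f, tate_bounded g).
have [N fN] := tate_cvg f (divr_gt0 e0 M'0).
have [N' gN'] := tate_cvg g (divr_gt0 e0 M0).
exists (N + N')%N => n Nn; apply: vabs_sum_lt => // -[i /= _] _.
rewrite vabsM; have [Ni|iN] := leqP N i.
  rewrite (le_lt_trans (ler_wpM2l (vabs_ge0 _) (gM' _)))//.
  by rewrite -ltr_pdivlMr// fN.
rewrite (le_lt_trans (ler_wpM2r (vabs_ge0 _) (fM _)))//.
by rewrite mulrC -ltr_pdivlMr// gN'// leq_subRL ?(leq_trans (ltnW iN))//;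
  rewrite (leq_trans _ Nn)// ?leq_addr// leq_add2r ltnW.
Qed.

Definition tate_mul f g : tate := Tate (tate_mul_subproof f g).

Fact tateC_subproof a : (fun n => if n == 0%N then a else 0) \in tate_pred.
Proof.
by apply/tate_predP => e e0; exists 1%N => -[//|n _] /=; rewrite vabs0.
Qed.

(* Constant power series. *)
Definition tateC a : tate := Tate (tateC_subproof a).

Fact tateX_subproof : (fun n => (n == 1%N)%:R : k) \in tate_pred.
Proof.
by apply/tate_predP => e e0; exists 2%N => -[|[|n]]//= _; rewrite vabs0.
Qed.

(* The coordinate T. *)
Definition tateX : tate := Tate tateX_subproof.

Let trunc n f : {poly k} := \poly_(i < n.+1) f i.

Let coef_trunc n f i : (i <= n)%N -> (trunc n f)`_i = f i.
Proof. by move=> i_n; rewrite coef_poly ltnS i_n. Qed.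

Let coef_truncM n f g i : (i <= n)%N ->
  (trunc n f * trunc n g)`_i = tate_mul f g i.
Proof.
move=> i_n; rewrite coefM; apply: eq_bigr => -[j /= ji] _.
by rewrite !coef_trunc// (leq_trans _ i_n)// leq_subr.
Qed.

Fact tate_mulC : commutative tate_mul.
Proof.
by move=> f g; apply: tate_ext => n; rewrite -!(@coef_truncM n)// mulrC.
Qed.

Fact tate_mulA : associative tate_mul.
Proof.
move=> f g h; apply: tate_ext => n.
transitivity ((trunc n f * (trunc n g * trunc n h))`_n).
  rewrite coefM; apply: eq_bigr => -[j /= jn] _.
  by rewrite coef_trunc// coef_truncM// leq_subr.
rewrite mulrA coefM; apply: eq_bigr => -[j /= jn] _.
by rewrite coef_truncM// coef_trunc// leq_subr.
Qed.

Fact tate_mul1 : left_id (tateC 1) tate_mul.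
Proof.
move=> f; apply: tate_ext => n.
by rewrite /= /tate_mul_coef big_ord_recl /= mul1r subn0 big1 ?addr0// => i _;
  rewrite mul0r.
Qed.

Fact tate_mulDl : left_distributive tate_mul +%R.
Proof.
move=> f g h; apply: tate_ext => n; rewrite tate_coefD /= /tate_mul_coef.
by rewrite -big_split; apply: eq_bigr => i _; rewrite tate_coefD mulrDl.
Qed.

Fact tate_oner_neq0 : tateC 1 != 0.
Proof.
apply/eqP => /(congr1 (fun f : tate => f 0%N)) /= /eqP.
by rewrite oner_eq0.
Qed.

HB.instance Definition _ := GRing.Zmodule_isComNzRing.Build tate
  tate_mulA tate_mulC tate_mul1 tate_mulDl tate_oner_neq0.

Lemma tate_coefM f g n : (f * g) n = \sum_(i < n.+1) f i * g (n - i)%N.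
Proof. by []. Qed.

Definition gauss_norm f : R := sup (range (fun i => vabs (f i))).

Lemma gauss_norm_has_sup f : has_sup (range (fun i => vabs (f i))).
Proof.
split; first by exists (vabs (f 0%N)), 0%N.
by have [M [_ fM]] := tate_bounded f; exists M => _ [i _ <-].
Qed.

Lemma gauss_norm_ub f i : vabs (f i) <= gauss_norm f.
Proof. by apply: sup_upper_bound; [exact: gauss_norm_has_sup|exists i]. Qed.

Lemma gauss_norm_le f M : (forall i, vabs (f i) <= M) -> gauss_norm f <= M.
Proof.
move=> fM; apply: ge_sup; first by exists (vabs (f 0%N)), 0%N.
by move=> _ [i _ <-].
Qed.

Lemma gauss_norm_ge0 f : 0 <= gauss_norm f.
Proof. exact: le_trans (vabs_ge0 (f 0%N)) (gauss_norm_ub f 0). Qed.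

Lemma gauss_norm_max f : exists i, vabs (f i) = gauss_norm f.
Proof.
have [f0|f0] := eqVneq (gauss_norm f) 0.
  exists 0%N; apply/eqP; rewrite f0 eq_le vabs_ge0 andbT -f0.
  exact: gauss_norm_ub.
have fgt0 : 0 < gauss_norm f by rewrite lt_def f0 gauss_norm_ge0.
have [N fN] := tate_cvg f (divr_gt0 fgt0 (@ltr0Sn R 1)).
apply: contrapT => /forallNP fne.
have flt i : vabs (f i) < gauss_norm f.
  by rewrite lt_neqAle gauss_norm_ub andbT; exact/eqP/fne.
pose M := \big[Num.max/gauss_norm f / 2]_(i < N) vabs (f i).
have : gauss_norm f <= M.
  apply: gauss_norm_le => i; have [/fN /ltW fi|iN] := leqP N i.
    by rewrite (le_trans fi)//; exact: bigmax_ge_id.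
  exact: (le_bigmax _ (fun i : 'I_N => vabs (f i)) (Ordinal iN)).
rewrite leNgt => /negP; apply; apply/bigmax_ltP; split => //.
by rewrite ltr_pdivrMr// ltr_pMr// ltr1n.
Qed.

Lemma gauss_normC a : gauss_norm (tateC a) = vabs a.
Proof.
apply/eqP; rewrite eq_le; apply/andP; split.
  by apply: gauss_norm_le => -[|i]//=; rewrite vabs0 vabs_ge0.
exact: (gauss_norm_ub (tateC a) 0).
Qed.

Lemma gauss_normD f g : gauss_norm (f + g) <= gauss_norm f + gauss_norm g.
Proof.
apply: gauss_norm_le => i; rewrite tate_coefD (le_trans (vabsD_max _ _))//.
rewrite ge_max; apply/andP; split.
  by rewrite (le_trans (gauss_norm_ub f i))// lerDl gauss_norm_ge0.
by rewrite (le_trans (gauss_norm_ub g i))// lerDr gauss_norm_ge0.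
Qed.

(* Gauss's lemma *)
Lemma gauss_normM f g : gauss_norm (f * g) = gauss_norm f * gauss_norm g.
Proof.
apply/eqP; rewrite eq_le; apply/andP; split.
  apply: gauss_norm_le => n; rewrite tate_coefM; apply: vabs_sum_le.
    by rewrite mulr_ge0 ?gauss_norm_ge0.
  by move=> i _; rewrite vabsM ler_pM ?vabs_ge0 ?gauss_norm_ub.
have [f0|f0] := eqVneq (gauss_norm f) 0; first by rewrite f0 mul0r gauss_norm_ge0.
have [g0|g0] := eqVneq (gauss_norm g) 0; first by rewrite g0 mulr0 gauss_norm_ge0.
have fgt0 : 0 < gauss_norm f by rewrite lt_def f0 gauss_norm_ge0.
have ggt0 : 0 < gauss_norm g by rewrite lt_def g0 gauss_norm_ge0.
have fex : exists i, vabs (f i) == gauss_norm f.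
  by have [i /eqP] := gauss_norm_max f; exists i.
have gex : exists i, vabs (g i) == gauss_norm g.
  by have [i /eqP] := gauss_norm_max g; exists i.
case: (ex_minnP fex) => i /eqP fi fmin; case: (ex_minnP gex) => j /eqP gj gmin.
have flt i' : (i' < i)%N -> vabs (f i') < gauss_norm f.
  move=> i'i; rewrite lt_neqAle gauss_norm_ub andbT; apply: contraTN i'i.
  by move=> /fmin; rewrite leqNgt.
have glt j' : (j' < j)%N -> vabs (g j') < gauss_norm g.
  move=> j'j; rewrite lt_neqAle gauss_norm_ub andbT; apply: contraTN j'j.
  by move=> /gmin; rewrite leqNgt.
have iij : (i < (i + j).+1)%N by rewrite ltnS leq_addr.
suff <- : vabs ((f * g) (i + j)%N) = gauss_norm f * gauss_norm g.
  exact: gauss_norm_ub.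
rewrite tate_coefM (bigD1 (Ordinal iij))//= addKn.
have fgij : vabs (f i * g j) = gauss_norm f * gauss_norm g by rewrite vabsM fi gj.
rewrite vabsD_lt// fgij; apply: vabs_sum_lt; first exact: mulr_gt0.
move=> [l /= lij]; rewrite -val_eqE /= => li; rewrite vabsM.
have [lti|ltli|eqli] := ltngtP l i; last by rewrite eqli eqxx in li.
  rewrite (le_lt_trans (ler_wpM2l (vabs_ge0 _) (gauss_norm_ub _ _)))//.
  by rewrite ltr_pM2r// flt.
rewrite (le_lt_trans (ler_wpM2r (vabs_ge0 _) (gauss_norm_ub _ _)))//.
by rewrite ltr_pM2l// glt// ltn_subLR// ltn_add2r.
Qed.

(* Points of the Berkovich spectrum M(k{T}). *)
Record berk := Berk {
  seminorm :> tate -> R;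
  seminormD : forall f g, seminorm (f + g) <= seminorm f + seminorm g;
  seminormM : forall f g, seminorm (f * g) = seminorm f * seminorm g;
  seminormC : forall a, seminorm (tateC a) = vabs a;
  seminorm_le_gauss : forall f, seminorm f <= gauss_norm f
}.

Lemma berk_ext (x y : berk) : seminorm x = seminorm y -> x = y.
Proof.
case: x => x xD xM xC xG; case: y => y yD yM yC yG /= xy; case: y / xy in yD yM yC yG *.
by congr Berk; exact: Prop_irrelevance.
Qed.

Definition gauss_pt : berk :=
  Berk gauss_normD gauss_normM gauss_normC (fun f => lexx _).

HB.instance Definition _ := gen_eqMixin berk.
HB.instance Definition _ := gen_choiceMixin berk.
HB.instance Definition _ := isPointed.Build berk gauss_pt.
HB.instance Definition _ := Topological.copy berk
  (initial_topology (fun x : berk => (seminorm x : {ptws tate -> R}))).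

Definition berk_le (x y : berk) := forall f, x f <= y f.

End ValuedField.

(* A completed algebraic closure K of k, through an algebraic closure k^a of k
   which is dense in K; it is unique up to isometric isomorphism over k. *)
Record completedAlgClosure (R : realType) (k : valuedField R) :=
  CompletedAlgClosure {
  ka : closedFieldType;
  to_ka : {rmorphism k -> ka};
  ka_algebraic : forall z, algebraicOver to_ka z;
  Kf : valuedField R;
  to_K : {rmorphism ka -> Kf};
  to_K_isometry : forall a, vabs (to_K (to_ka a)) = vabs a;
  to_K_dense : forall (z : Kf) (e : R), 0 < e ->
    exists w, vabs (z - to_K w) < e;
  K_complete : vf_complete Kf
}.

Section Disc.
Variables (R : realType) (k : valuedField R) (C : completedAlgClosure k).
Local Notation K := (Kf C).
Local Notation X := (berk k).
Local Notation X_K := (berk K).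
Local Notation x_G := (gauss_pt k).

Fact base_change_subproof (f : tate k) :
  (fun n => to_K C (to_ka C (f n))) \in tate_pred (k := K).
Proof.
apply/tate_predP => e e0; have [N fN] := tate_cvg f e0.
by exists N => i /fN; rewrite to_K_isometry.
Qed.

Definition base_change (f : tate k) : tate K := Tate (base_change_subproof f).

Lemma base_changeD f g : base_change (f + g) = base_change f + base_change g.
Proof. by apply: tate_ext => n; rewrite tate_coefD /= !rmorphD. Qed.

Lemma base_changeM f g : base_change (f * g) = base_change f * base_change g.
Proof.
apply: tate_ext => n; rewrite tate_coefM /= /tate_mul_coef !rmorph_sum.
by apply: eq_bigr => i _; rewrite !rmorphM.
Qed.

Lemma base_changeC a : base_change (tateC a) = tateC (to_K C (to_ka C a)).
Proof. by apply: tate_ext => -[|n] //=; rewrite !rmorph0. Qed.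

Lemma gauss_norm_base_change f : gauss_norm (base_change f) = gauss_norm f.
Proof.
have E : (fun i => vabs (base_change f i)) = (fun i => vabs (f i)).
  by apply/funext => i; rewrite /= to_K_isometry.
by rewrite /gauss_norm E.
Qed.

Section Restriction.
Variable y : X_K.

Fact restr_subproofD f g : y (base_change (f + g)) <=
  y (base_change f) + y (base_change g).
Proof. by rewrite base_changeD seminormD. Qed.

Fact restr_subproofM f g : y (base_change (f * g)) =
  y (base_change f) * y (base_change g).
Proof. by rewrite base_changeM seminormM. Qed.

Fact restr_subproofC a : y (base_change (tateC a)) = vabs a.
Proof. by rewrite base_changeC seminormC to_K_isometry. Qed.

Fact restr_subproof_le f : y (base_change f) <= gauss_norm f.
Proof. by rewrite -gauss_norm_base_change seminorm_le_gauss. Qed.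

Definition restr : X := Berk restr_subproofD restr_subproofM
  restr_subproofC restr_subproof_le.
End Restriction.

(* y = x_{w,s}. The supremum is over the Berkovich disc
   {z in X_K : |T - w|_z <= s}, not over its K-points only: when the value
   group of K is not dense (trivial absolute value), the latter would not see
   s. Otherwise the two suprema agree. *)
Definition is_disc_pt (w : K) (s : R) (y : X_K) := forall f : tate K,
  y f = sup [set z f | z in [set z : X_K | z (tateX K - tateC w) <= s]].

Definition rigid : set X := [set x | exists (w : ka C) (y : X_K),
  [/\ vabs (to_K C w) <= 1, is_disc_pt (to_K C w) 0 y & restr y = x]].

Definition multiplicity (x : X) : \bar R :=
  let fiber := restr @^-1` [set x] in
  if `[< finite_set fiber >] then (#|` fset_set fiber|%:R)%:E else +oo%E.

(* The values of the radius function on X_K: the first clause is for the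
   points x_{w,s}, the second one for the limits of decreasing sequences of
   discs with empty intersection. *)
Definition is_radius_K (y : X_K) (rho : R) :=
  (exists w : K, [/\ vabs w <= 1, 0 <= rho <= 1 & is_disc_pt w rho y]) \/
  (exists (w : nat -> K) (s : nat -> R) (u : nat -> X_K),
    [/\ forall i, [/\ vabs (w i) <= 1, 0 <= s i <= 1 &
                      is_disc_pt (w i) (s i) (u i)],
        forall i, vabs (w i.+1 - w i) <= s i /\ s i.+1 <= s i,
        ~ (exists z : K, forall i, vabs (z - w i) <= s i),
        u @ \oo --> y & s @ \oo --> rho]).

Definition radius (x : X) : R :=
  get [set rho | exists y, restr y = x /\ is_radius_K y rho].

(* A_X = - log r *)
Definition A_X (x : X) : \bar R := (- lne (radius x)%:E)%E.

Definition berk_join (x y : X) : X := get [set z | [/\ berk_le x z, berk_le y z &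
  forall t, berk_le x t -> berk_le y t -> berk_le z t]].

Definition segment (x y : X) : set X :=
  [set z | berk_le z (berk_join x y) /\ (berk_le x z \/ berk_le y z)].

(* The point u of [x, x_G] with A_X(u) = t. *)
Definition segment_pt (x : X) (t : R) : X :=
  get [set u | segment x x_G u /\ A_X u = t%:E].

(* alpha(x) is the integral over [x, x_G] of (1/m(u)) d(- log r(u)), written
   in the coordinate t = - log r(u), which identifies [x, x_G] with
   [0, A_X(x)]. *)
Definition alpha (x : X) : \bar R :=
  \int[lebesgue_measure]_(t in [set t : R | 0 <= t /\ (t%:E <= A_X x)%E])
    ((multiplicity (segment_pt x t))^-1)%E.

(* |a - b|, with |oo - oo| = 0 *)
Definition absdiff (a b : \bar R) : \bar R :=
  if a == b then 0%E else `|a - b|%E.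

Definition dist (x y : X) : \bar R :=
  (absdiff (alpha x) (alpha (berk_join x y)) +
   absdiff (alpha y) (alpha (berk_join x y)))%E.

Definition seg_convex (Y : set X) :=
  forall x y, Y x -> Y y -> segment x y `<=` Y.

Definition finite_subtree (Y : set X) :=
  exists S, [/\ finite_set S, S !=set0 & Y = smallest seg_convex S].

Definition admissible_subtree (Y : set X) :=
  [/\ finite_subtree Y, Y `<=` ~` rigid & Y x_G].

Definition retraction (Y : set X) (x : X) : X :=
  get [set y | segment x y `&` Y = [set y]].

(* The filter of the net of admissible subtrees, directed by inclusion. *)
Definition subtree_net : set_system (set X) :=
  filter_from admissible_subtree
    (fun Y0 => [set Y | admissible_subtree Y /\ Y0 `<=` Y]).

(* T_y Y: the classes of the points z <> y of Y, two of them being equivalent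
   when their segments from y have a common initial part. *)
Definition tangent_dirs (Y : set X) (y : X) : set (set X) :=
  [set v | exists z, [/\ Y z, z <> y &
    v = [set z' | [/\ Y z', z' <> y & segment y z `&` segment y z' <> [set y]]]]].

(* When alpha y = +oo the difference quotients are zero (_ / +oo = 0). *)
Definition dir_derivative (phi : X -> \bar R) (y : X) (v : set X) : \bar R :=
  lim ((((phi z - phi y) / dist y z)%E) @[z --> within v (nbhs y)]).

(* Convexity with respect to the arc length given by dist, tested on the
   subsegments of finite length. *)
Definition convex_on_segment (phi : X -> \bar R) (p q : X) :=
  forall a b z, segment p q a -> segment p q b -> segment a b z ->
    (dist a b < +oo)%E ->
    (dist a b * phi z <= dist z b * phi a + dist a z * phi b)%E.

(* rho_0-subharmonic functions for rho_0 = c delta_{x_G}.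
   - The second clause (phi is finite where alpha is) is needed for the
     differences phi z - phi y to make sense; it discards the constant
     function -oo.
   - Convexity is required on the segments [p, q] not containing x_G that are
     monotone (p <= q). A segment that changes direction at a branch point
     p \/ q must be excluded: log|T (T - a)|, 0 < |a| < 1, is subharmonic but
     is concave at x_{0,|a|} along the segment between 0 and a. *)
Definition subharmonic (c : R) (phi : X -> \bar R) :=
  [/\ forall x, (phi x < +oo)%E,
      forall x, (alpha x < +oo)%E -> (-oo < phi x)%E,
      forall Y, admissible_subtree Y ->
        [/\ {within Y, continuous phi},
            forall p q, Y p -> Y q -> berk_le p q -> ~ segment p q x_G ->
              convex_on_segment phi p q &
            forall y, Y y ->
              (0 <= (c * (y == x_G)%:R)%:E +
                    \sum_(v \in tangent_dirs Y y) dir_derivative phi y v)%E] &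
      forall x, phi (retraction Y x) @[Y --> subtree_net] --> phi x].

Definition quasisubharmonic (phi : X -> \bar R) :=
  exists c : R, 0 < c /\ subharmonic c phi.

Definition phi_norm (phi : X -> \bar R) (f : tate k) : \bar R :=
  ereal_sup [set ((x f)%:E * expeR (- phi x - A_X x))%E
            | x in [set x | phi x <> -oo%E]].

Definition phi_norm_plus (phi : X -> \bar R) (f : tate k) : \bar R :=
  lim (phi_norm (fun x => ((1 + e)%:E * phi x)%E) f @[e --> 0^'+]).

Definition multiplier_ideal (phi : X -> \bar R) : set (tate k) :=
  [set f | (phi_norm_plus phi f < +oo)%E].

Definition upper_semicontinuous (g : X -> \bar R) :=
  lower_semicontinuous (fun x => - g x)%E.

Definition usc_reg (g : X -> \bar R) (x : X) : \bar R :=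
  ereal_inf [set h x | h in
    [set h | upper_semicontinuous h /\ forall y, (g y <= h y)%E]].

Definition demailly (phi : X -> \bar R) (m : nat) (x : X) : \bar R :=
  let mphi := (fun y => m%:R%:E * phi y)%E in
  ((m%:R^-1)%:E * usc_reg (fun y =>
     ereal_sup [set lne ((y f)%:E / phi_norm_plus mphi f)
               | f in [set f | multiplier_ideal mphi f /\ f <> 0%R]]) x)%E.

End Disc.

(* Main.v *)
Require Import Defs.
From mathcomp Require Import all_boot all_order all_algebra.
From mathcomp Require Import all_classical all_reals all_analysis.
From mathcomp Require Import finmap ring lra zify measurable_realfun.

Set Implicit Arguments.
Unset Strict Implicit.
Unset Printing Implicit Defensive.

Import Order.TTheory GRing.Theory Num.Theory.
Import numFieldNormedType.Exports.

Local Open Scope classical_set_scope.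
Local Open Scope ring_scope.

(* A point x of X is determined by the distances dst x w to the Galois orbits of
   the algebraic w in the unit disc, and every point strictly above x is some
   x_{w,s} with w algebraic. For subharmonic phi, let M(z) be the Laplacian mass
   of kappa phi below z; the star inequality makes M superadditive on
   antichains. Fix x and kappa > m. Going up from small discs, one greedily
   chooses a polynomial F whose number of zeros below a point z off the path
   [x, x_G] exceeds M(z) - mult(z), while on the path it is at most M(z). The
   minimal polynomial of an algebraic point in a disc contributes a multiple of
   the multiplicity of the disc; the assumption on k provides algebraic points
   whose degree is exactly that multiplicity. Hence
   log |F| - kappa phi - A_X does not increase away from x, up to an error eta,
   so that || F ||_{kappa phi} is at most |F(x)| e^{- kappa phi(x) + eta}. This is
   the lower bound.
   For the upper bound, the definition of the norm at a type II or III point z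
   just above x gives log |f| - log ||f|| <= m phi(z) + A_X(z), and this persists
   on the points below z, which include a neighbourhood of x; phi and A_X are
   continuous along the path from x up. *)

(** Measured in [alpha], log |F| has slope the number of zeros of F below z, because the integral
    defining [alpha] is - log |P| / deg P for the minimal polynomial P of a centre, while A_X
    changes with slope mult(z). The term A_X in the norm therefore pays exactly for rounding the
    mass down to a multiple of mult(z), the rounding that zeros defined over k impose. The remaining
    obstacle is that the discs carrying a given amount of mass form a chain whose infimum need not
    be a disc. If the radii tend to 0, completeness of k provides an algebraic centre; otherwise the
    zeros are placed in a disc whose radius is within a factor q of the infimum. On the window of
    radii that is missed, only the total mass bounds the slope of phi; finitely many windows occur,
    and q is chosen to make their total cost at most eta. Since || f ||^+ is an infimum over the
    factors 1 + e with e > 0, kappa = (1 + e) m is admissible, and the losses in e and eta vanish in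
    the limit. *)

Arguments vabs : simpl never.

(** * Removing constants by taking powers *)

Section PowerTrick.
Variable R : realType.
Implicit Types a b c : R.

(** Exponential growth of (a / b)^n beats any linear factor. The factor [n.+1] is the number of
    terms of the binomial formula in [berk_max]. *)
Lemma le_of_exp_lin a b c : 0 <= a -> 0 <= b ->
  (forall n, a ^+ n <= n.+1%:R * c * b ^+ n) -> a <= b.
Proof.
move=> a0 b0 h; rewrite leNgt; apply/negP => ba.
have agt0 : 0 < a by exact: le_lt_trans ba.
have [b00|b00] := eqVneq b 0.
  by have := h 1%N; rewrite b00 expr1 mulr0 leNgt agt0.
have bgt0 : 0 < b by rewrite lt_def b00.
have c0 : 0 < c.
  by have := h 0%N; rewrite !expr0 mul1r mulr1 => /(lt_le_trans ltr01).
(* With the square root, Bernoulli's inequality gives quadratic growth of (a / b)^n, enough against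
   the linear factor. *)
pose q := Num.sqrt (a / b).
have ab1 : 1 < a / b by rewrite ltr_pdivlMr// mul1r.
have q1 : 1 < q by rewrite -[ltLHS]sqrtr1 ltr_sqrt// (lt_trans ltr01).
pose g := q - 1; have g0 : 0 < g by rewrite subr_gt0.
have bern n : 1 + n%:R * g <= q ^+ n.
  elim: n => [|n ih]; first by rewrite mul0r addr0 expr0.
  rewrite exprS; have -> : q = 1 + g by rewrite /g; ring.
  have : (1 + g) * (1 + n%:R * g) <= (1 + g) * (1 + g) ^+ n.
    rewrite ler_pM2l; last by lra.
    by move: ih; have -> : q = 1 + g by rewrite /g; ring.
  apply: le_trans; rewrite -natr1.
  have : 0 <= n%:R * g ^+ 2 by rewrite mulr_ge0 ?ler0n ?exprn_ge0 ?ltW.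
  nra.
have h2 n : (1 + n%:R * g) ^+ 2 <= n.+1%:R * c.
  have : q ^+ n ^+ 2 <= n.+1%:R * c.
    rewrite -exprM mulnC exprM sqr_sqrtr; last by rewrite divr_ge0.
    by rewrite expr_div_n ler_pdivrMr ?exprn_gt0.
  apply: le_trans; rewrite lerXn2r ?nnegrE ?bern ?exprn_ge0 ?sqrtr_ge0//.
  by rewrite addr_ge0// mulr_ge0// ltW.
have [n hn] : exists n : nat, 2 * c / g ^+ 2 < n%:R.
  exists (Num.bound (2 * c / g ^+ 2)); apply: archi_boundP.
  by rewrite divr_ge0 ?exprn_ge0 ?mulr_ge0 ?ltW.
rewrite ltr_pdivrMr ?exprn_gt0// in hn.
have n1 : 1 <= n%:R :> R.
  case: n hn => [|n _]; last by rewrite ler1n.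
  by rewrite mul0r ltNge mulr_ge0// ltW.
have := h2 n; rewrite -natr1; nra.
Qed.

Lemma le_of_exp a b c : 0 <= a -> 0 <= b ->
  (forall n, a ^+ n <= c * b ^+ n) -> a <= b.
Proof.
move=> a0 b0 h; apply: (@le_of_exp_lin a b `|c|) => // n.
rewrite (le_trans (h n))// ler_wpM2r ?exprn_ge0//.
rewrite (le_trans (ler_norm _))// ler_peMl//; last by rewrite ler1n.
Qed.

End PowerTrick.

(** * Seminorms on polynomials *)

Section ValuedPoly.
Variables (R : realType) (k : valuedField R).
Implicit Types (F G : {poly k}) (y : {poly k} -> R) (a w : k) (s : R).

Lemma vabs_gt0 a : a != 0 -> 0 < vabs a.
Proof.
by move=> a0; rewrite lt_def vabs_ge0 andbT; apply: contra_neq a0 => /vabs_eq0.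
Qed.

Lemma vabsX a n : vabs (a ^+ n) = vabs a ^+ n.
Proof. by elim: n => [|n ih]; rewrite ?expr0 ?vabs1// !exprS vabsM ih. Qed.

Lemma vabsV a : vabs a^-1 = (vabs a)^-1.
Proof.
have [->|a0] := eqVneq a 0; first by rewrite invr0 vabs0 invr0.
have va0 : vabs a != 0 by rewrite gt_eqF// vabs_gt0.
by apply: (mulfI va0); rewrite -vabsM !divff// vabs1.
Qed.

Lemma vabs_nat n : vabs (n%:R : k) <= 1.
Proof.
elim: n => [|n ih]; first by rewrite vabs0.
by rewrite -natr1 (le_trans (vabsD_max _ _))// ge_max ih vabs1 lexx.
Qed.

Lemma vabsB_max a b : vabs (a - b) <= Num.max (vabs a) (vabs b).
Proof. by rewrite (le_trans (vabsD_max _ _))// vabsN. Qed.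

Lemma vabs_distC a b : vabs (a - b) = vabs (b - a).
Proof. by rewrite -vabsN opprB. Qed.

Lemma vabs_dist_max b a c :
  vabs (a - c) <= Num.max (vabs (a - b)) (vabs (b - c)).
Proof.
have -> : a - c = (a - b) + (b - c) by ring.
exact: vabsD_max.
Qed.

(* The points of the analytification of the affine line. *)
Record seminorm_pt y : Prop := SeminormPt {
  spt_ge0 : forall F, 0 <= y F;
  sptD : forall F G, y (F + G) <= Num.max (y F) (y G);
  sptM : forall F G, y (F * G) = y F * y G;
  sptC : forall a, y a%:P = vabs a }.

(** The Gauss norm of radius [s] centred at 0, including [s = 0]. *)
Definition wnorm s F : R := \big[Num.max/0]_(i < size F) (vabs F`_i * s ^+ i).

Lemma wnorm_ge0 s F : 0 <= wnorm s F.
Proof. exact: bigmax_ge_id. Qed.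

Lemma wnorm_ub s F i : 0 <= s -> vabs F`_i * s ^+ i <= wnorm s F.
Proof.
move=> s0; have [iF|iF] := ltnP i (size F).
  exact: (le_bigmax _ (fun i : 'I_(size F) => vabs F`_i * s ^+ i) (Ordinal iF)).
by rewrite nth_default// vabs0 mul0r wnorm_ge0.
Qed.

Lemma wnorm_le s F M : 0 <= M ->
  (forall i, vabs F`_i * s ^+ i <= M) -> wnorm s F <= M.
Proof. by move=> M0 h; apply: bigmax_le. Qed.

Lemma wnorm_attained s F : 0 <= s -> exists i, wnorm s F = vabs F`_i * s ^+ i.
Proof.
move=> s0; have [F0|F0] := eqVneq (wnorm s F) 0.
  exists 0%N; apply/eqP; rewrite F0 eq_le mulr_ge0 ?vabs_ge0 ?exprn_ge0//.
  by rewrite -F0 wnorm_ub.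
apply: contrapT => /forallNP h; move/eqP: F0; apply; apply/eqP; rewrite eq_le.
rewrite wnorm_ge0 andbT leNgt; apply/negP => N0.
have : wnorm s F < wnorm s F.
  rewrite {1}/wnorm; apply/bigmax_ltP; split => // i _.
  by rewrite lt_neqAle wnorm_ub// andbT eq_sym; apply/eqP/h.
by rewrite ltxx.
Qed.

Lemma wnormD s F G : 0 <= s -> wnorm s (F + G) <= Num.max (wnorm s F) (wnorm s G).
Proof.
move=> s0; apply: wnorm_le => [|i]; first by rewrite le_max wnorm_ge0.
rewrite coefD (le_trans (ler_wpM2r (exprn_ge0 _ s0) (vabsD_max _ _)))//.
rewrite maxr_pMl ?exprn_ge0// ge_max !le_max.
by rewrite wnorm_ub//= (wnorm_ub _ _ s0) orbT.
Qed.

Lemma wnormC s a : wnorm s a%:P = vabs a.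
Proof.
apply/eqP; rewrite eq_le; apply/andP; split.
  apply: wnorm_le => [|[|i]]; rewrite ?vabs_ge0// coefC/= ?mulr1//.
  by rewrite vabs0 mul0r vabs_ge0.
rewrite /wnorm size_polyC; have [->|a0] /= := eqVneq a 0.
  by rewrite vabs0 bigmax_ge_id.
by rewrite big_ord_recl coefC /= expr0 mulr1 le_max lexx.
Qed.

Lemma wnormM s F G : 0 <= s -> wnorm s (F * G) = wnorm s F * wnorm s G.
Proof.
move=> s0; apply/eqP; rewrite eq_le; apply/andP; split.
  apply: wnorm_le => [|n]; first by rewrite mulr_ge0 ?wnorm_ge0.
  have [sn0|sn0] := eqVneq (s ^+ n) 0.
    by rewrite sn0 mulr0 mulr_ge0 ?wnorm_ge0.
  have sngt0 : 0 < s ^+ n by rewrite lt_def sn0 exprn_ge0.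
  rewrite -ler_pdivlMr// coefM; apply: vabs_sum_le.
    by rewrite divr_ge0 ?mulr_ge0 ?wnorm_ge0// ltW.
  move=> [i /= ni] _; rewrite vabsM ler_pdivlMr//.
  have -> : s ^+ n = s ^+ i * s ^+ (n - i) by rewrite -exprD subnKC.
  rewrite mulrACA.
  by rewrite ler_pM ?wnorm_ub ?mulr_ge0 ?vabs_ge0 ?exprn_ge0.
have [f0|f0] := eqVneq (wnorm s F) 0; first by rewrite f0 mul0r wnorm_ge0.
have [g0|g0] := eqVneq (wnorm s G) 0; first by rewrite g0 mulr0 wnorm_ge0.
have fgt0 : 0 < wnorm s F by rewrite lt_def f0 wnorm_ge0.
have ggt0 : 0 < wnorm s G by rewrite lt_def g0 wnorm_ge0.
have fex : exists i, vabs F`_i * s ^+ i == wnorm s F.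
  by have [i /eqP] := wnorm_attained F s0; rewrite eq_sym; exists i.
have gex : exists i, vabs G`_i * s ^+ i == wnorm s G.
  by have [i /eqP] := wnorm_attained G s0; rewrite eq_sym; exists i.
(* With [i] and [j] the least indices attaining the maxima, the product of these two coefficients
   strictly dominates every other term of the coefficient of index [i + j]. *)
case: (ex_minnP fex) => i /eqP fi fmin; case: (ex_minnP gex) => j /eqP gj gmin.
have flt i' : (i' < i)%N -> vabs F`_i' * s ^+ i' < wnorm s F.
  move=> i'i; rewrite lt_neqAle wnorm_ub// andbT; apply: contraTN i'i.
  by move=> /fmin; rewrite leqNgt.
have glt j' : (j' < j)%N -> vabs G`_j' * s ^+ j' < wnorm s G.
  move=> j'j; rewrite lt_neqAle wnorm_ub// andbT; apply: contraTN j'j.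
  by move=> /gmin; rewrite leqNgt.
have sgt0 n m : vabs (F`_n) * s ^+ n = wnorm s F ->
    vabs (G`_m) * s ^+ m = wnorm s G -> 0 < s ^+ (n + m).
  move=> hn hm; rewrite exprD mulr_gt0// lt_def exprn_ge0// andbT.
    by apply: contra_neq f0 => sn0; rewrite -hn sn0 mulr0.
  by apply: contra_neq g0 => sn0; rewrite -hm sn0 mulr0.
have sij := sgt0 _ _ fi gj.
have iij : (i < (i + j).+1)%N by rewrite ltnS leq_addr.
apply: (@le_trans _ _ (vabs (F * G)`_(i + j) * s ^+ (i + j))); last exact: wnorm_ub.
rewrite coefM (bigD1 (Ordinal iij))//= addKn.
rewrite vabsD_lt; first by rewrite vabsM exprD mulrACA fi gj.
apply: vabs_sum_lt.
  rewrite vabsM mulr_gt0// lt_def vabs_ge0 andbT.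
    by apply: contra_neq f0 => h; rewrite -fi h mul0r.
  by apply: contra_neq g0 => h; rewrite -gj h mul0r.
move=> [l /= lij]; rewrite -val_eqE /= => li.
rewrite -(ltr_pM2r sij) !vabsM.
have lE : s ^+ (i + j) = s ^+ l * s ^+ (i + j - l).
  by rewrite -exprD subnKC.
rewrite {1}lE exprD [ltLHS]mulrACA [ltRHS]mulrACA fi gj.
have [lti|ltli|eqli] := ltngtP l i; last by rewrite eqli eqxx in li.
  apply: le_lt_trans (ler_wpM2l _ (wnorm_ub _ _ s0)) _.
    by rewrite mulr_ge0 ?vabs_ge0 ?exprn_ge0.
  by rewrite ltr_pM2r// flt.
apply: le_lt_trans (ler_wpM2r _ (wnorm_ub _ _ s0)) _.
  by rewrite mulr_ge0 ?vabs_ge0 ?exprn_ge0.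
by rewrite ltr_pM2l// glt// ltn_subLR// ltn_add2r.
Qed.

Lemma wnormX_sub s a : 0 <= s -> wnorm s ('X - a%:P) = Num.max s (vabs a).
Proof.
move=> s0; apply/eqP; rewrite eq_le; apply/andP; split.
  apply: wnorm_le => [|[|[|i]]]; rewrite ?coefB ?coefX ?coefC /=.
  - by rewrite le_max s0.
  - by rewrite sub0r vabsN expr0 mulr1 le_max lexx orbT.
  - by rewrite subr0 vabs1 mul1r expr1 le_max lexx.
  - by rewrite subr0 vabs0 mul0r le_max s0.
rewrite ge_max; apply/andP; split.
  have := wnorm_ub ('X - a%:P) 1 s0.
  by rewrite coefB coefX coefC /= subr0 vabs1 mul1r.
have := wnorm_ub ('X - a%:P) 0 s0.
by rewrite coefB coefX coefC /= sub0r vabsN mulr1.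
Qed.

Lemma wnorm_pt s : 0 <= s -> seminorm_pt (wnorm s).
Proof.
move=> s0; split=> *; [exact: wnorm_ge0|exact: wnormD|exact: wnormM|exact: wnormC].
Qed.

(** The value of [F] at x_{w,s}, read off the Taylor expansion at [w]. *)
Definition disc_norm w s F : R := wnorm s (F \Po ('X + w%:P)).

Lemma disc_norm_pt w s : 0 <= s -> seminorm_pt (disc_norm w s).
Proof.
move=> s0; split=> *; rewrite /disc_norm.
- exact: wnorm_ge0.
- by rewrite comp_polyD wnormD.
- by rewrite comp_polyM wnormM.
- by rewrite comp_polyC wnormC.
Qed.

Lemma disc_normX_sub w s a : 0 <= s ->
  disc_norm w s ('X - a%:P) = Num.max s (vabs (w - a)).
Proof.
move=> s0; rewrite /disc_norm comp_polyB comp_polyX comp_polyC.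
have -> : 'X + w%:P - a%:P = 'X - (a - w)%:P :> {poly k} by rewrite polyCB; ring.
by rewrite wnormX_sub// vabs_distC.
Qed.

Lemma horner_comp_XaddC F w a : (F \Po ('X + w%:P)).[a] = F.[a + w].
Proof. by rewrite horner_comp hornerD hornerX hornerC. Qed.

Lemma disc_norm0 w F : disc_norm w 0 F = vabs F.[w].
Proof.
rewrite /disc_norm -[in RHS](add0r w) -horner_comp_XaddC horner_coef0.
set G := _ \Po _; apply/eqP; rewrite eq_le; apply/andP; split.
  apply: wnorm_le => [|[|i]]; rewrite ?vabs_ge0 ?mulr1//.
  by rewrite expr0n /= mulr0 vabs_ge0.
by have := wnorm_ub G 0 (lexx 0); rewrite expr0 mulr1.
Qed.

Section Pt.
Variable y : {poly k} -> R.
Hypothesis hy : seminorm_pt y.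

Lemma spt1 : y 1 = 1. Proof. by rewrite -[1]/(1%:P) (sptC hy) vabs1. Qed.

Lemma sptX F n : y (F ^+ n) = y F ^+ n.
Proof. by elim: n => [|n ih]; rewrite ?expr0 ?spt1// !exprS (sptM hy) ih. Qed.

Lemma spt0 : y 0 = 0. Proof. by rewrite -[0]/(0%:P) (sptC hy) vabs0. Qed.

Lemma sptN F : y (- F) = y F.
Proof.
by rewrite -mulN1r (sptM hy) -[-1]/(- 1%:P) -polyCN (sptC hy) vabsN vabs1 mul1r.
Qed.

Lemma sptB F G : y (F - G) <= Num.max (y F) (y G).
Proof. by rewrite (le_trans (sptD hy _ _))// sptN. Qed.

Lemma spt_prod (I : Type) (r : seq I) (E : I -> {poly k}) :
  y (\prod_(i <- r) E i) = \prod_(i <- r) y (E i).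
Proof. by apply: (big_morph y (sptM hy) spt1). Qed.

Lemma spt_sum_le (I : Type) (r : seq I) (P : pred I) (E : I -> {poly k}) (M : R) :
  0 <= M -> (forall i, P i -> y (E i) <= M) -> y (\sum_(i <- r | P i) E i) <= M.
Proof.
move=> M0 h; elim/big_ind : _ => //; first by rewrite spt0.
by move=> F G FM GM; rewrite (le_trans (sptD hy _ _))// ge_max FM.
Qed.

Lemma spt_le_wnorm F s : y 'X <= s -> y F <= wnorm s F.
Proof.
move=> y1; have s0 : 0 <= s by exact: le_trans (spt_ge0 hy _) y1.
rewrite -[F]coefK poly_def; apply: spt_sum_le; first exact: wnorm_ge0.
move=> i _; rewrite -mul_polyC (sptM hy) (sptC hy) sptX -poly_def coefK.
apply: le_trans (wnorm_ub F i s0).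
by rewrite ler_wpM2l ?vabs_ge0// lerXn2r// nnegrE// (spt_ge0 hy).
Qed.

Lemma spt_dist_max v w :
  y ('X - w%:P) <= Num.max (y ('X - v%:P)) (vabs (v - w)).
Proof.
have -> : 'X - w%:P = 'X - v%:P + (v - w)%:P :> {poly k} by rewrite polyCB; ring.
by rewrite (le_trans (sptD hy _ _))// (sptC hy).
Qed.

Lemma vabs_spt_max v w :
  vabs (v - w) <= Num.max (y ('X - v%:P)) (y ('X - w%:P)).
Proof.
rewrite -(sptC hy) maxC.
have -> : (v - w)%:P = 'X - w%:P - ('X - v%:P) :> {poly k} by rewrite polyCB; ring.
exact: sptB.
Qed.

(** Expanding [F] in powers of T - w shows that x_{w,s} is the largest point with |T - w| <= s;
    independence of the centre follows from this maximality. *)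
Lemma spt_le_disc F w s : y ('X - w%:P) <= s -> y F <= disc_norm w s F.
Proof.
move=> yw; have s0 : 0 <= s by exact: le_trans (spt_ge0 hy _) yw.
rewrite /disc_norm -{1}(comp_polyXaddC_K F w); set G := F \Po _.
rewrite -[G \Po _]/(_) comp_polyE; apply: spt_sum_le; first exact: wnorm_ge0.
move=> i _; rewrite -mul_polyC (sptM hy) (sptC hy) sptX.
apply: le_trans (wnorm_ub G i s0).
by rewrite ler_wpM2l ?vabs_ge0// lerXn2r// nnegrE// (spt_ge0 hy).
Qed.

End Pt.

Lemma disc_norm_recenter v w s F : vabs (v - w) <= s ->
  disc_norm v s F = disc_norm w s F.
Proof.
move=> vw; have s0 : 0 <= s by exact: le_trans (vabs_ge0 _) vw.
apply/eqP; rewrite eq_le; apply/andP; split;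
  apply: spt_le_disc; rewrite ?disc_normX_sub//; try exact: disc_norm_pt.
  by rewrite ge_max lexx.
by rewrite ge_max lexx vabs_distC.
Qed.

End ValuedPoly.

Lemma complete_lim (R : realType) (k : valuedField R) (u : nat -> k) :
  vf_complete k ->
  (forall e : R, 0 < e -> exists N, forall m n, (N <= m)%N -> (N <= n)%N ->
     vabs (u m - u n) < e) ->
  exists l : k, forall e : R, 0 < e -> exists N, forall n, (N <= n)%N ->
     vabs (u n - l) < e.
Proof.
move=> hk hu; have [l hl] := hk u hu; exists l => e e0.
move/cvgrPdist_lt : hl => /(_ e e0)[N _ hN]; exists N => n Nn.
by have := hN n Nn; rewrite /= sub0r normrN ger0_norm ?vabs_ge0.
Qed.

(** * Extension of seminorms to the algebraic closure *)

Section AlgClosure.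
Variables (R : realType) (k : valuedField R) (C : completedAlgClosure k).
Hypothesis k_complete : vf_complete k.

Let ka_abs (a : ka C) : R := vabs (to_K C a).

Fact ka_abs_ge0 a : 0 <= ka_abs a. Proof. exact: vabs_ge0. Qed.

Fact ka_abs_eq0 a : ka_abs a = 0 <-> a = 0.
Proof.
split=> [/vabs_eq0 /eqP|->]; last by rewrite /ka_abs rmorph0 vabs0.
by rewrite fmorph_eq0 => /eqP.
Qed.

Fact ka_absM a b : ka_abs (a * b) = ka_abs a * ka_abs b.
Proof. by rewrite /ka_abs rmorphM vabsM. Qed.

Fact ka_absD a b : ka_abs (a + b) <= Num.max (ka_abs a) (ka_abs b).
Proof. by rewrite /ka_abs rmorphD vabsD_max. Qed.

(** The algebraic closure with the absolute value induced by [K]. Centres are taken here rather than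
    in [K], so that minimal polynomials over [k] are available. *)
Definition kav : valuedField R :=
  ValuedField ka_abs_ge0 ka_abs_eq0 ka_absM ka_absD.

Definition emb : {rmorphism k -> kav} := to_ka C.

Lemma vabs_emb (a : k) : vabs (emb a) = vabs a.
Proof. exact: to_K_isometry. Qed.

Lemma embE (a : k) : emb a = to_ka C a. Proof. by []. Qed.

Opaque emb.

Implicit Types (a b : seq kav) (e : R) (v : kav) (c : nat -> k).

Definition lincomb b c : kav := \sum_(i < size b) emb (c i) * b`_i.

Definition in_span b v := exists c, v = lincomb b c.

(** Orthogonality up to the factor [e]. A nearest vector of a subspace need not exist, only almost
    nearest ones, hence the constants [e > 1] below. *)
Definition orth e b := forall c j, (j < size b)%N ->
  vabs (c j) * vabs b`_j <= e * vabs (lincomb b c).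

Lemma lincombB b c c' : lincomb b c - lincomb b c' = lincomb b (fun i => c i - c' i).
Proof.
by rewrite -sumrB; apply: eq_bigr => i _; rewrite rmorphB mulrBl.
Qed.

Lemma lincomb_le b c M : 0 <= M ->
  (forall j, (j < size b)%N -> vabs (c j) * vabs b`_j <= M) ->
  vabs (lincomb b c) <= M.
Proof.
by move=> M0 h; apply: vabs_sum_le => // i _; rewrite vabsM vabs_emb h.
Qed.

(** Near-orthogonality makes the coordinates of a sequence of combinations converging to [v] Cauchy,
    so completeness of [k] puts the limit in the span. *)
Lemma orth_closed e b v : 0 < e -> orth e b -> ~ in_span b v ->
  exists d : R, 0 < d /\ forall c, d <= vabs (v - lincomb b c).
Proof.
move=> e0 ob nv; apply: contrapT => /forallNP h; apply: nv.
have h' (n : nat) : exists c, vabs (v - lincomb b c) < n.+1%:R^-1.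
  apply: contrapT => /forallNP hn; apply: (h n.+1%:R^-1); split.
    by rewrite invr_gt0 ltr0n.
  by move=> c; rewrite leNgt; apply/negP/hn.
have [u hu] := choice h'.
have inv_small (d : R) : 0 < d -> exists N, forall n, (N <= n)%N -> n.+1%:R^-1 < d.
  move=> d0; exists (Num.bound d^-1) => n Nn.
  rewrite invf_plt ?posrE ?ltr0n//.
  apply: lt_le_trans (archi_boundP _) _; first by rewrite invr_ge0 ltW.
  by rewrite ler_nat (leq_trans Nn).
have hl j : exists l : k, (j < size b)%N -> forall d : R, 0 < d ->
    exists N, forall n, (N <= n)%N -> vabs (u n j - l) * vabs b`_j < d.
  have [jb|jb] := boolP (j < size b)%N; last by exists 0.
  have [bj0|bj0] := eqVneq b`_j 0.
    by exists 0 => _ d d0; exists 0%N => n _; rewrite bj0 vabs0 mulr0.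
  have bjgt0 := vabs_gt0 bj0.
  have [l hl] : exists l : k, forall d : R, 0 < d -> exists N, forall n, (N <= n)%N ->
     vabs (u n j - l) < d.
    apply: complete_lim => // d d0.
    have [|N hN] := inv_small (d * vabs b`_j / e); first by rewrite divr_gt0// mulr_gt0.
    exists N => m n Nm Nn; rewrite -(ltr_pM2r bjgt0).
    apply: le_lt_trans (ob (fun i => u m i - u n i) j jb) _.
    rewrite -lincombB mulrC -ltr_pdivlMr//.
    have -> : lincomb b (u m) - lincomb b (u n) =
        (v - lincomb b (u n)) - (v - lincomb b (u m)) by ring.
    apply: le_lt_trans (vabsB_max _ _) _; rewrite gt_max.
    by rewrite (lt_trans (hu _) (hN _ _))// (lt_trans (hu _) (hN _ _)).
  exists l => _ d d0; have [|N hN] := hl (d / vabs b`_j); first by rewrite divr_gt0.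
  by exists N => n Nn; rewrite -ltr_pdivlMr// hN.
have [l {}hl] := choice hl.
exists l; apply/eqP; rewrite -subr_eq0; apply/eqP/vabs_eq0/eqP.
rewrite eq_le vabs_ge0 andbT; apply/ler_addgt0Pr => d d0; rewrite add0r.
have hNj j : exists N, (j < size b)%N -> forall n, (N <= n)%N ->
    vabs (u n j - l j) * vabs b`_j < d.
  have [jb|jb] := boolP (j < size b)%N; last by exists 0%N.
  by have [N hN] := hl j jb d d0; exists N.
have [N1 hN1] := choice hNj; have [N2 hN2] := inv_small d d0.
pose N := maxn N2 (\max_(j < size b) N1 j).
have -> : v - lincomb b l = (v - lincomb b (u N)) + (lincomb b (u N) - lincomb b l).
  by ring.
apply: le_trans (vabsD_max _ _) _; rewrite ge_max; apply/andP; split.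
  by apply/ltW/(lt_trans (hu _))/hN2; rewrite leq_maxl.
rewrite lincombB; apply: lincomb_le; first exact: ltW.
move=> j jb; apply/ltW/hN1 => //; rewrite leq_max; apply/orP; right.
exact: (@leq_bigmax _ (fun j : 'I_(size b) => N1 j) (Ordinal jb)).
Qed.

Lemma lincomb_rcons b v c :
  lincomb (rcons b v) c = lincomb b c + emb (c (size b)) * v.
Proof.
rewrite /lincomb size_rcons big_ord_recr /= nth_rcons ltnn eqxx; congr (_ + _).
by apply: eq_bigr => i _; rewrite nth_rcons ltn_ord.
Qed.

(** Approximate Gram-Schmidt starting from 1. The predicate [S] keeps the basis inside a given
    [k]-subspace, such as k[w] in [conj_abs]. *)
Lemma orth_basis (S : kav -> Prop) a e : 1 < e ->
  S 1 -> (forall v, v \in a -> S v) ->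
  (forall t u v, S u -> S v -> S (u + emb t * v)) ->
  exists b, [/\ (0 < size b)%N, b`_0 = 1, (forall v, v \in a -> in_span b v),
    orth e b & (forall v, v \in b -> S v)].
Proof.
move=> e1 S1 Sa SD; elim: a e e1 Sa => [|a0 a ih] e e1 Sa.
  exists [:: 1]; split => // [c j|v]; last by rewrite inE => /eqP ->.
  rewrite ltnS leqn0 => /eqP ->.
  rewrite /lincomb big_ord_recl big_ord0 /= addr0 mulr1. rewrite vabs_emb vabs1 mulr1.
  by rewrite ler_peMl ?vabs_ge0 ?ltW.
(* Adding a vector costs two factors [e']: one from the induction hypothesis, one from replacing the
   new vector by an almost shortest one modulo the span. *)
pose e' := Num.sqrt e.
have e'1 : 1 < e' by rewrite -[ltLHS]sqrtr1 ltr_sqrt// (lt_trans ltr01).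
have e'0 : 0 < e' := lt_trans ltr01 e'1.
have ee : e' * e' = e by rewrite -expr2 sqr_sqrtr// ltW// (lt_trans ltr01).
have e'e : e' <= e by rewrite -ee ler_peMl ?ltW.
have [|b [sb b0 ab ob bS]] := ih e' e'1; first by move=> v va; apply: Sa; rewrite inE va orbT.
have S00 : S 0.
  by have := SD (-1) 1 1 S1 S1; rewrite rmorphN1 mulN1r subrr.
have Slin c : S (lincomb b c).
  apply: (big_ind S) => // [u v Su Sv|i _].
    by have := SD 1 u v Su Sv; rewrite rmorph1 mul1r.
  by rewrite -[_ * _]add0r; apply: SD => //; apply: bS; rewrite mem_nth.
have [a0b|a0b] := pselect (in_span b a0).
  exists b; split => // [v|c j jb].
    by rewrite inE => /predU1P[->//|/ab].
  by rewrite (le_trans (ob c j jb))// ler_wpM2r ?vabs_ge0.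
have [d [d0 hd]] := orth_closed e'0 ob a0b.
pose D := [set vabs (a0 - lincomb b c) | c in [set: nat -> k]].
have D0 : D !=set0 by exists (vabs (a0 - lincomb b (fun=> 0))), (fun=> 0).
have Dlb : has_lbound D by exists d => _ [c _ <-].
have Dinf : 0 < inf D.
  by apply: lt_le_trans d0 _; apply: lb_le_inf => // _ [c _ <-].
have [c0 hc0] : exists c0, vabs (a0 - lincomb b c0) <= e' * inf D.
  have e2 : 0 < e' * inf D - inf D by rewrite subr_gt0 ltr_pMl.
  have [_ [c _ <-] hc] := inf_adherent e2 (conj D0 Dlb).
  by exists c; apply/ltW/(lt_le_trans hc); rewrite addrC subrK.
pose w := a0 - lincomb b c0.
have hw c t : vabs t * vabs w <= e' * vabs (lincomb b c + emb t * w).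
  have [->|t0] := eqVneq t 0; first by rewrite vabs0 mul0r mulr_ge0 ?vabs_ge0 ?ltW.
  have -> : lincomb b c + emb t * w =
      emb t * (a0 - lincomb b (fun i => c0 i - t^-1 * c i)).
    have -> : lincomb b (fun i => c0 i - t^-1 * c i) =
        lincomb b c0 - (emb t)^-1 * lincomb b c.
      rewrite /lincomb mulr_sumr -sumrB; apply: eq_bigr => i _.
      by rewrite rmorphB rmorphM fmorphV mulrBl mulrA.
    by rewrite /w; field; rewrite fmorph_eq0.
  rewrite vabsM vabs_emb mulrCA ler_wpM2l ?vabs_ge0//.
  rewrite (le_trans hc0)// ler_wpM2l ?(ltW e'0)//.
  by apply: ge_inf => //; exists (fun i => c0 i - t^-1 * c i).
exists (rcons b w); split.
- by rewrite size_rcons.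
- by rewrite nth_rcons sb.
- move=> v; rewrite inE => /predU1P[->|/ab [c ->]].
    exists (fun i => if (i < size b)%N then c0 i else 1).
    rewrite lincomb_rcons ltnn rmorph1 mul1r /w.
    rewrite (_ : lincomb b _ = lincomb b c0) ?subrKC//.
    by apply: eq_bigr => i _; rewrite ltn_ord.
  exists (fun i => if (i < size b)%N then c i else 0).
  rewrite lincomb_rcons ltnn rmorph0 mul0r addr0.
  by apply: eq_bigr => i _; rewrite ltn_ord.
- move=> c j; rewrite size_rcons ltnS leq_eqVlt lincomb_rcons nth_rcons.
  move=> /predU1P[->|jb].
    rewrite ltnn eqxx (le_trans (hw c _))// ler_wpM2r ?vabs_ge0//.
  rewrite jb (le_trans (ob c j jb))// -ee -mulrA ler_wpM2l ?(ltW e'0)//.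
  rewrite -{1}(addrK (emb (c (size b)) * w) (lincomb b c)).
  rewrite (le_trans (vabsB_max _ _))// ge_max ler_peMl ?vabs_ge0 ?(ltW e'1)//=.
  by rewrite vabsM vabs_emb hw.
- move=> v; rewrite mem_rcons inE => /predU1P[->|/bS//].
  have := SD (-1) a0 (lincomb b c0); rewrite rmorphN1 mulN1r; apply => //.
  by apply: Sa; rewrite inE eqxx.
Qed.

(** The coordinate along the basis vector 1 is [k]-linear, sends 1 to 1 and has norm at most [e].
    Applied to the coefficients, it turns a relation over the closure into one over [k]. *)
Lemma tensor_relation (s : seq (kav * {poly k})) (g : {poly k}) e : 1 < e ->
  map_poly emb g = \sum_(p <- s) p.1%:P * map_poly emb p.2 ->
  exists l : kav -> k, (forall p, p \in s -> vabs (l p.1) <= e * vabs p.1) /\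
    g = \sum_(p <- s) (l p.1)%:P * p.2.
Proof.
move=> e1 gE.
have [b [sb b0 ab ob _]] := @orth_basis (fun=> True) (map fst s) e e1 I
  (fun _ _ => I) (fun _ _ _ _ _ => I).
have /choice[crd hcrd] : forall v, exists c, in_span b v -> v = lincomb b c.
  by move=> v; have [[c ->]|nv] := pselect (in_span b v); [exists c|exists (fun=> 0)].
have hs p : p \in s -> p.1 = lincomb b (crd p.1).
  by move=> ps; apply/hcrd/ab/map_f.
exists (fun v => crd v 0%N); split.
  move=> p ps; have := ob (crd p.1) 0%N sb; rewrite b0 vabs1 mulr1.
  by rewrite -hs.
apply/polyP => n; apply/eqP; rewrite -subr_eq0; apply/eqP/vabs_eq0/eqP.
(* These are coordinates in [b] of the [n]-th coefficient of the difference of the two sides, which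
   is zero; near-orthogonality then kills the coordinate along 1. *)
pose c j := (if j == 0%N then g`_n else 0) - \sum_(p <- s) crd p.1 j * p.2`_n.
have c0 : lincomb b c = 0.
  have := congr1 (fun F : {poly kav} => F`_n) gE.
  rewrite coef_map coef_sum /= => gn.
  rewrite /lincomb /c.
  under eq_bigr do rewrite rmorphB mulrBl.
  rewrite sumrB; apply/eqP; rewrite subr_eq0; apply/eqP.
  rewrite (bigD1 (Ordinal sb))//= b0 mulr1 big1 ?addr0; last first.
    by move=> i; rewrite -val_eqE /= => /negPf ->; rewrite rmorph0 mul0r.
  rewrite gn; transitivity (\sum_(p <- s) lincomb b (crd p.1) * emb p.2`_n).
    by rewrite !big_seq; apply: eq_bigr => p ps; rewrite coefCM coef_map -hs.
  rewrite /lincomb.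
  rewrite (eq_bigr (fun p : kav * {poly k} => \sum_(i < size b) emb (crd p.1 i) * b`_i * emb p.2`_n)).
    2: by move=> p _; rewrite mulr_suml.
  rewrite exchange_big /=; apply: eq_bigr => i _.
  rewrite rmorph_sum mulr_suml; apply: eq_bigr => p _.
  by rewrite rmorphM mulrAC.
have := ob c 0%N sb; rewrite c0 vabs0 mulr0 b0 vabs1 mulr1 /c /= => h.
rewrite eq_le vabs_ge0 andbT coef_sum (le_trans _ h)//.
rewrite (eq_bigr (fun p : kav * {poly k} => crd p.1 0%N * p.2`_n))//.
by move=> p _; rewrite coefCM.
Qed.

Local Notation La := kav.

Lemma exists_minpoly (w : La) : exists P : {poly k},
  [/\ P \is monic, root (map_poly emb P) w &
      forall Q : {poly k}, Q != 0 -> root (map_poly emb Q) w -> (size P <= size Q)%N].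
Proof.
pose Sz n := `[< exists P : {poly k}, [/\ P != 0, root (map_poly emb P) w & size P = n] >].
have exSz : exists n, Sz n.
  by have [P P0 Pw] := ka_algebraic w; exists (size P); apply/asboolP; exists P.
case: (ex_minnP exSz) => n /asboolP[P [P0 Pw sP]] nmin.
exists ((lead_coef P)^-1 *: P); have lP : (lead_coef P)^-1 != 0.
  by rewrite invr_eq0 lead_coef_eq0.
split.
- by rewrite monicE lead_coefZ mulVf// lead_coef_eq0.
- by rewrite map_polyZ rootZ// fmorph_eq0.
- move=> Q Q0 Qw; rewrite size_scale// sP; apply: nmin; apply/asboolP.
  by exists Q.
Qed.

Definition mpoly (w : La) : {poly k} := projT1 (cid (exists_minpoly w)).

Local Notation "p ^e" := (map_poly emb p) (at level 2, format "p ^e").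

Lemma mpoly_monic w : mpoly w \is monic.
Proof. by rewrite /mpoly; case: cid => P []. Qed.

Lemma mpoly_root w : root (mpoly w)^e w.
Proof. by rewrite /mpoly; case: cid => P []. Qed.

Lemma mpoly_min w (Q : {poly k}) : Q != 0 -> root Q^e w ->
  (size (mpoly w) <= size Q)%N.
Proof. by rewrite /mpoly; case: cid => P [] _ _ h /=; exact: h. Qed.

Lemma mpoly_neq0 w : mpoly w != 0.
Proof. exact/monic_neq0/mpoly_monic. Qed.

Lemma map_emb_eq0 (Q : {poly k}) : (Q^e == 0) = (Q == 0).
Proof. by rewrite map_poly_eq0. Qed.

Lemma size_mpoly_gt1 w : (1 < size (mpoly w))%N.
Proof.
have := root_size_gt1 _ (mpoly_root w).
by rewrite size_map_poly map_emb_eq0; apply; exact: mpoly_neq0.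
Qed.

Definition mdeg (w : La) := (size (mpoly w)).-1.

Lemma mdeg_gt0 w : (0 < mdeg w)%N.
Proof. by rewrite /mdeg -subn1 subn_gt0 size_mpoly_gt1. Qed.

Lemma size_mpoly w : size (mpoly w) = (mdeg w).+1.
Proof. by rewrite /mdeg prednK// (ltn_trans _ (size_mpoly_gt1 w)). Qed.

Lemma root_emb_modp (Q : {poly k}) w z : root (mpoly w)^e z ->
  Q^e.[z] = (Q %% mpoly w)^e.[z].
Proof.
move=> /rootP hz; rewrite {1}(divp_eq Q (mpoly w)) rmorphD rmorphM /=.
by rewrite hornerD hornerM hz mulr0 add0r.
Qed.

Lemma horner_emb_eq0 (Q : {poly k}) w : (Q^e.[w] == 0) = (mpoly w %| Q).
Proof.
apply/eqP/idP => [Qw|]; last first.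
  move=> /dvdpP[D ->]; rewrite rmorphM hornerM.
  by have /rootP -> := mpoly_root w; rewrite mulr0.
rewrite /dvdp; apply: contraT => Q0.
have := @mpoly_min w (Q %% mpoly w) Q0.
rewrite leqNgt ltn_modp mpoly_neq0 /= => h.
by apply: h; apply/rootP; rewrite -root_emb_modp ?mpoly_root.
Qed.

Lemma roots_exists w : {r : seq La | (mpoly w)^e = \prod_(z <- r) ('X - z%:P)}.
Proof.
have [r] := closed_field_poly_normal ((mpoly w)^e : {poly ka C}).
by rewrite lead_coef_map (monicP (mpoly_monic w)) rmorph1 scale1r; exists r.
Qed.

(** The roots are listed with multiplicity, so the length is the degree also for inseparable [w]. *)
Definition conjs (w : La) : seq La := projT1 (roots_exists w).

Lemma mpoly_prod w : (mpoly w)^e = \prod_(z <- conjs w) ('X - z%:P).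
Proof. by rewrite /conjs; case: roots_exists. Qed.

Lemma size_conjs w : size (conjs w) = mdeg w.
Proof.
have := congr1 (fun p : {poly La} => size p) (mpoly_prod w).
by rewrite size_prod_XsubC size_map_poly size_mpoly => -[].
Qed.

Lemma mem_conjs w z : (z \in conjs w) = root (mpoly w)^e z.
Proof. by rewrite mpoly_prod root_prod_XsubC. Qed.

Lemma conjs_self w : w \in conjs w.
Proof. by rewrite mem_conjs mpoly_root. Qed.

Lemma mpoly_conj w z : z \in conjs w -> mpoly z = mpoly w.
Proof.
rewrite mem_conjs => wz.
have zw : mpoly z %| mpoly w by rewrite -horner_emb_eq0 (rootP wz).
have [D DE] := dvdpP _ _ zw.
have D0 : D != 0.
  by apply: contra_eq_neq DE => ->; rewrite mul0r mpoly_neq0.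
have ww : root D^e w || root (mpoly z)^e w.
  by have := mpoly_root w; rewrite DE rmorphM rootM.
have sz : size (mpoly w) = (size D + mdeg z)%N.
  by rewrite DE size_mul ?mpoly_neq0// size_mpoly addnS.
have sD : size D = 1%N.
  have := orP ww => -[] /mpoly_min; rewrite ?D0 ?mpoly_neq0 sz => /(_ isT).
    by rewrite -{2}[size D]addn0 leq_add2l leqn0 (gtn_eqF (mdeg_gt0 z)).
  rewrite size_mpoly -add1n leq_add2r => D1.
  by apply/eqP; rewrite eqn_leq D1 lt0n size_poly_eq0.
have [d d0 Dd] : exists2 d, d != 0 & D = d%:P.
  by apply/size_poly1P; rewrite sD.
have := monicP (mpoly_monic w); rewrite DE Dd lead_coefM lead_coefC.
by rewrite (monicP (mpoly_monic z)) mulr1 => ->; rewrite mul1r.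
Qed.

(** Sending [w] to [z] defines a [k]-linear map k[w] -> k[z], bounded by a constant [M] thanks to a
    near-orthogonal basis of k[w]. Applying the bound to powers of [Q] removes [M]. *)
Lemma conj_abs w z (Q : {poly k}) : z \in conjs w -> vabs (Q^e.[z]) = vabs (Q^e.[w]).
Proof.
have main w' z' : z' \in conjs w' -> vabs (Q^e.[z']) <= vabs (Q^e.[w']).
  move: {w z} w' z' => w z; rewrite mem_conjs => zw.
  pose S v := exists G : {poly k}, v = G^e.[w].
  have [||||b [sb b0 ab ob bS]] :=
      @orth_basis S [seq w ^+ i | i <- iota 0 (mdeg w)] 2.
  - by rewrite ltr1n.
  - by exists 1; rewrite rmorph1 hornerC.
  - move=> v /mapP[i _ ->]; exists 'X^i.
    by rewrite map_polyXn hornerXn.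
  - move=> t u v [F ->] [G ->]; exists (F + t%:P * G).
    by rewrite rmorphD rmorphM /= map_polyC hornerD hornerM hornerC.
  have /choice[be hbe] : forall j, exists G : {poly k}, (j < size b)%N -> b`_j = G^e.[w].
    move=> j; have [jb|jb] := boolP (j < size b)%N; last by exists 0.
    by have [G hG] := bS _ (mem_nth 0 jb); exists G.
  have hb G : exists c, G^e.[w] = lincomb b c.
    rewrite (@root_emb_modp G w)// ?mpoly_root//; set H := G %% _.
    have sH : (size H <= mdeg w)%N.
      by rewrite -ltnS -size_mpoly ltn_modp mpoly_neq0.
    have /choice[cc hcc] : forall i, exists c, (i < mdeg w)%N -> w ^+ i = lincomb b c.
      move=> i; have [id|id] := boolP (i < mdeg w)%N; last by exists (fun=> 0).
      have [|c hc] := ab (w ^+ i); last by exists c.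
      by apply: map_f; rewrite mem_iota add0n id.
    exists (fun j => \sum_(i < mdeg w) H`_i * cc i j).
    rewrite (horner_coef_wide _ (_ : (size H^e <= mdeg w)%N)) ?size_map_poly//.
    rewrite /lincomb; under eq_bigr do rewrite coef_map hcc//.
    rewrite (eq_bigr (fun i : 'I_(mdeg w) => \sum_(j < size b) emb (H`_i * cc i j) * b`_j)).
      2: by move=> i _; rewrite /lincomb mulr_sumr; apply: eq_bigr => j _; rewrite rmorphM mulrA.
    by rewrite exchange_big /=; apply: eq_bigr => j _; rewrite rmorph_sum mulr_suml.
  have transfer G c : G^e.[w] = lincomb b c ->
      G^e.[z] = \sum_(j < size b) emb (c j) * (be j)^e.[z].
    move=> Gw; pose H := G - \sum_(j < size b) (c j)%:P * be j.
    have HE v : H^e.[v] = G^e.[v] - \sum_(j < size b) emb (c j) * (be j)^e.[v].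
      rewrite /H rmorphB rmorph_sum /= hornerD hornerN horner_sum; congr (_ - _).
      by apply: eq_bigr => j _; rewrite rmorphM /= map_polyC hornerM hornerC.
    have : H^e.[w] == 0.
      rewrite HE Gw subr_eq0; apply/eqP; apply: eq_bigr => j _.
      by rewrite hbe.
    rewrite horner_emb_eq0 => /dvdpP[D HD].
    have : H^e.[z] = 0 by rewrite HD rmorphM hornerM (rootP zw) mulr0.
    by rewrite HE => /eqP; rewrite subr_eq0 => /eqP.
  have be0 j : (j < size b)%N -> b`_j = 0 -> (be j)^e.[z] = 0.
    move=> jb bj0; have : (be j)^e.[w] == 0 by rewrite -hbe// bj0.
    by rewrite horner_emb_eq0 => /dvdpP[D ->]; rewrite rmorphM hornerM (rootP zw) mulr0.
  (* The factor 2 is the orthogonality constant of [b]. Where b_j = 0 the quotient is the default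
     value 0, which is harmless by [be0]. *)
  pose M := 2 * \sum_(j < size b) vabs (be j)^e.[z] / vabs b`_j.
  have t0 j : 0 <= vabs (be j)^e.[z] / vabs b`_j by rewrite divr_ge0 ?vabs_ge0.
  have bound G : vabs G^e.[z] <= M * vabs G^e.[w].
    have [c Gc] := hb G; rewrite (transfer G c Gc); apply: vabs_sum_le.
      by rewrite !mulr_ge0 ?vabs_ge0 ?sumr_ge0.
    move=> j _; rewrite vabsM vabs_emb.
    have [bj0|bj0] := eqVneq b`_j 0.
      by rewrite be0// vabs0 mulr0 !mulr_ge0 ?vabs_ge0 ?sumr_ge0.
    have cj := ob c j (ltn_ord j); rewrite -Gc in cj.
    have -> : vabs (c j) * vabs (be j)^e.[z] =
        (vabs (c j) * vabs b`_j) * (vabs (be j)^e.[z] / vabs b`_j).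
      by field; rewrite gt_eqF// vabs_gt0.
    apply: le_trans (ler_wpM2r (t0 j) cj) _.
    rewrite /M [leRHS]mulrAC ler_wpM2l ?mulr_ge0 ?vabs_ge0//.
    by rewrite (bigD1 j)//= lerDl sumr_ge0.
  apply: (@le_of_exp _ _ _ M); rewrite ?vabs_ge0// => n.
  by have := bound (Q ^+ n); rewrite rmorphXn !horner_exp !vabsX.
move=> zw; apply/eqP; rewrite eq_le main//= main//.
by rewrite mem_conjs (mpoly_conj zw) mpoly_root.
Qed.

Lemma coef_comp_XaddC (F : {poly La}) (w : La) n :
  (F \Po ('X + w%:P))`_n = F^`N(n).[w].
Proof.
rewrite /comp_poly addrC nderiv_taylor; last exact: mulrC.
under eq_bigr do rewrite nderivn_map horner_map /=.
rewrite coef_sum.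
under eq_bigr do rewrite coefCM coefXn.
rewrite size_map_polyC.
have [nF|nF] := ltnP n (size F).
  rewrite (bigD1 (Ordinal nF))//= eqxx mulr1 big1 ?addr0// => i.
  by rewrite -val_eqE /= eq_sym => /negPf ->; rewrite mulr0.
rewrite big1 => [|[i /= iF] _].
  by rewrite nderivn_poly0 ?horner0.
by rewrite gtn_eqF ?mulr0// (leq_trans iF).
Qed.

(** The Taylor coefficients at [w] are values at [w] of Hasse derivatives, polynomials over [k] in
    every characteristic, so [conj_abs] applies to each of them. *)
Lemma conj_disc_norm w z s (Q : {poly k}) : z \in conjs w ->
  disc_norm z s Q^e = disc_norm w s Q^e.
Proof.
move=> zw; rewrite /disc_norm /wnorm !size_comp_poly2; last 2 first.
- by rewrite size_XaddC.
- by rewrite size_XaddC.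
apply: eq_bigr => i _; congr (_ * _).
by rewrite !coef_comp_XaddC !nderivn_map (conj_abs _ zw).
Qed.

End AlgClosure.

(** * A multiplicative seminorm over the closure extending a given one *)

Section Lift.
Variables (R : realType) (k : valuedField R) (C : completedAlgClosure k).
Hypothesis k_complete : vf_complete k.
Variable x : {poly k} -> R.
Hypothesis hx : seminorm_pt x.

Local Notation La := (kav C).
Local Notation "p ^e" := (map_poly (emb C) p) (at level 2, format "p ^e").
Implicit Types (p : {poly La} -> R) (F G : {poly La}) (f g h : {poly k}).

(* Seminorms on La[T], homogeneous over k[T]; a minimal one is multiplicative. *)
Record ext_seminorm p : Prop := ExtSeminorm {
  ext_ge0 : forall F, 0 <= p F;
  extD : forall F G, p (F + G) <= Num.max (p F) (p G);
  extM_le : forall F G, p (F * G) <= p F * p G;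
  ext1 : p 1 = 1;
  extC_le : forall a : La, p a%:P <= vabs a;
  extZ : forall g F, p (g^e * F) = x g * p F }.

Lemma ler_mul_eps (a b c : R) : 0 <= a -> 0 <= b ->
  (forall e, 0 < e -> c <= (a + e) * (b + e)) -> c <= a * b.
Proof.
move=> a0 b0 h; rewrite leNgt; apply/negP => abc.
pose e := Num.min 1 ((c - a * b) / (2 * (a + b + 1))).
have s0 : 0 < a + b + 1 by lra.
have e0 : 0 < e by rewrite lt_min ltr01 divr_gt0 ?subr_gt0 ?mulr_gt0.
have e1 : e <= 1 by rewrite ge_min lexx.
have e2 : e * (2 * (a + b + 1)) <= c - a * b.
  by rewrite -ler_pdivlMr ?mulr_gt0// ge_min lexx orbT.
have := h e e0; nra.
Qed.

(** Shared by the tensor seminorm, infima of chains, the spectral seminorm and the localisation in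
    [min_mul]: each is an infimum of admissible bounds. *)
Lemma ext_seminorm_inf (V : {poly La} -> set R) :
  (forall F, V F !=set0) -> (forall F v, V F v -> 0 <= v) ->
  (forall F G v v', V F v -> V G v' -> exists2 u, V (F + G) u & u <= Num.max v v') ->
  (forall F G v v', V F v -> V G v' -> exists2 u, V (F * G) u & u <= v * v') ->
  (forall v, V 1 v -> 1 <= v) ->
  (forall a : La, exists2 u, V a%:P u & u <= vabs a) ->
  (forall g F v, V F v -> exists2 u, V (g^e * F) u & u <= x g * v) ->
  (forall g F v, x g != 0 -> V (g^e * F) v -> exists2 u, V F u & u <= v / x g) ->
  ext_seminorm (fun F => inf (V F)).
Proof.
move=> V0 Vge VD VM V1 VC VH VH'.
have Vlb F : has_lbound (V F) by exists 0 => v /Vge.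
have Vinf F : has_inf (V F) by split.
have ile F v : V F v -> inf (V F) <= v by move=> h; exact: ge_inf.
have ige F c : (forall v, V F v -> c <= v) -> c <= inf (V F).
  by move=> h; apply: lb_le_inf.
have eps F e : 0 < e -> exists2 v, V F v & v <= inf (V F) + e.
  by move=> e0; have [v Fv ve] := inf_adherent e0 (Vinf F); exists v => //; exact: ltW.
split.
- by move=> F; apply: ige => v /Vge.
- move=> F G; apply/ler_addgt0Pr => e e0.
  have [[v Fv ve] [v' Gv' ve']] := (eps F e e0, eps G e e0).
  have [u FGu uv] := VD _ _ _ _ Fv Gv'.
  rewrite (le_trans (ile _ _ FGu))// (le_trans uv)// ge_max.
  rewrite (le_trans ve) ?(le_trans ve')// lerD2r le_max lexx ?orbT//.
- move=> F G; apply: ler_mul_eps.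
  + by apply: ige => v /Vge.
  + by apply: ige => v /Vge.
  move=> e e0.
  have [[v Fv ve] [v' Gv' ve']] := (eps F e e0, eps G e e0).
  have [u FGu uv] := VM _ _ _ _ Fv Gv'.
  rewrite (le_trans (ile _ _ FGu))// (le_trans uv)// ler_pM//.
    exact: Vge Fv.
  exact: Vge Gv'.
- apply/eqP; rewrite eq_le ige// andbT.
  have [u V1u u1] := VC 1; rewrite vabs1 in u1.
  by rewrite (le_trans _ u1)// ile.
- by move=> a; have [u /ile h1 h2] := VC a; exact: le_trans h2.
- move=> g F; apply/eqP; rewrite eq_le; apply/andP; split; last first.
    have [->|xg] := eqVneq (x g) 0; first by rewrite mul0r; apply: ige => v /Vge.
    have xg0 : 0 < x g by rewrite lt_def xg (spt_ge0 hx).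
    apply: ige => v /(VH' _ _ _ xg)[u /ile Fu uv].
    by rewrite mulrC -ler_pdivlMr// (le_trans Fu).
  have [xg|xg] := eqVneq (x g) 0.
    have [v Fv] := V0 F; have [u /ile gu] := VH g _ _ Fv.
    by rewrite xg !mul0r; apply: le_trans.
  have xg0 : 0 < x g by rewrite lt_def xg (spt_ge0 hx).
  rewrite -ler_pdivrMl//; apply: ige => v Fv.
  have [u /ile gu uv] := VH g _ _ Fv.
  by rewrite ler_pdivrMl// (le_trans gu).
Qed.

(** Bounds for the ultrametric tensor product of the absolute value of [La] and of [x]. The
    denominator [g] makes the infimum exactly homogeneous over k[T]. *)
Definition tensor_bounds F : set R := [set v | 0 <= v /\
  exists g (s : seq (La * {poly k})), [/\ x g != 0,
    g^e * F = \sum_(q <- s) q.1%:P * q.2^e &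
    forall q, q \in s -> vabs q.1 * x q.2 <= v * x g]].

Lemma tensor_seminorm : ext_seminorm (fun F => inf (tensor_bounds F)).
Proof.
have x1 : x 1 = 1 := spt1 hx.
apply: ext_seminorm_inf.
- move=> F; pose s : seq (La * {poly k}) := [seq (F`_i, 'X^i) | i <- iota 0 (size F)].
  exists (\sum_(q <- s) vabs q.1 * x q.2); split.
    by rewrite sumr_ge0// => q _; rewrite mulr_ge0 ?vabs_ge0 ?(spt_ge0 hx).
  exists 1, s; split.
  + by rewrite x1 oner_eq0.
  + rewrite rmorph1 mul1r big_map -{1}[F]coefK poly_def -[size F in RHS]subn0 big_mkord.
    by apply: eq_bigr => i _; rewrite map_polyXn mul_polyC.
  + move=> q qs; rewrite x1 mulr1 (big_rem q qs) /= lerDl sumr_ge0// => q' _.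
    by rewrite mulr_ge0 ?vabs_ge0 ?(spt_ge0 hx).
- by move=> F v [].
- move=> F G v v' [v0 [g [s [xg gF hs]]]] [v'0 [g' [s' [xg' gG hs']]]].
  exists (Num.max v v') => //; split; first by rewrite le_max v0.
  exists (g * g'), ([seq (q.1, g' * q.2) | q <- s] ++ [seq (q.1, g * q.2) | q <- s']).
  split.
  + by rewrite (sptM hx) mulf_neq0.
  + have -> : (g * g')^e * (F + G) = g'^e * (g^e * F) + g^e * (g'^e * G).
      by rewrite rmorphM /=; ring.
    rewrite gF gG big_cat !big_map /= !mulr_sumr; congr (_ + _).
      by apply: eq_bigr => q _; rewrite rmorphM mulrCA.
    by apply: eq_bigr => q _; rewrite rmorphM mulrCA.
  + have xg0 : 0 <= x g := spt_ge0 hx g; have xg'0 : 0 <= x g' := spt_ge0 hx g'.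
    move=> q; rewrite mem_cat => /orP[] /mapP[q' /[dup] qs' + ->] /=; rewrite !(sptM hx).
      move=> /hs h; rewrite [leLHS]mulrCA (mulrC (x g)) [leRHS]mulrCA ler_wpM2l//.
      by rewrite (le_trans h)// ler_wpM2r// le_max lexx.
    move=> /hs' h; rewrite mulrCA [leRHS]mulrCA ler_wpM2l//.
    by rewrite (le_trans h)// ler_wpM2r// le_max lexx orbT.
- move=> F G v v' [v0 [g [s [xg gF hs]]]] [v'0 [g' [s' [xg' gG hs']]]].
  exists (v * v') => //; split; first exact: mulr_ge0.
  exists (g * g'), [seq (q.1 * q'.1, q.2 * q'.2) | q <- s, q' <- s']; split.
  + by rewrite (sptM hx) mulf_neq0.
  + rewrite rmorphM mulrACA gF gG big_allpairs_dep /= mulr_suml.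
    apply: eq_bigr => q _; rewrite mulr_sumr; apply: eq_bigr => q' _.
    by rewrite polyCM rmorphM mulrACA.
  + move=> _ /allpairsP[[q q'] /= [/hs h /hs' h' ->]] /=.
    rewrite vabsM !(sptM hx) mulrACA [leRHS]mulrACA ler_pM//;
      by rewrite mulr_ge0 ?vabs_ge0 ?(spt_ge0 hx).
- move=> v [v0 [g [s [xg gE hs]]]]; rewrite mulr1 in gE.
  have xg0 : 0 < x g by rewrite lt_def xg (spt_ge0 hx).
  rewrite leNgt; apply/negP => v1.
  (* If 1 had a bound v < 1, [tensor_relation] with this constant would give x g <= d v x g < x g.
     So the tensor seminorm does not collapse. *)
  have [d d1 dv] : exists2 d : R, 1 < d & d * v < 1.
    exists (2 / (1 + v)).
      by rewrite ltr_pdivlMr ?mul1r; lra.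
    by rewrite mulrAC ltr_pdivrMr ?mul1r; lra.
  have [l [hl gl]] := tensor_relation k_complete d1 gE.
  have : x g <= d * v * x g.
    rewrite {1}gl big_seq; apply: (spt_sum_le hx).
      by rewrite !mulr_ge0 ?(spt_ge0 hx)//; lra.
    move=> q qs; rewrite (sptM hx) (sptC hx).
    rewrite (le_trans (ler_wpM2r _ (hl _ qs))) ?(spt_ge0 hx)// -!mulrA.
    by rewrite ler_wpM2l ?hs//; lra.
  by rewrite leNgt -[ltRHS]mul1r ltr_pM2r ?dv.
- move=> a; exists (vabs a) => //; split; first exact: vabs_ge0.
  exists 1, [:: (a, 1)]; split.
  + by rewrite x1 oner_eq0.
  + by rewrite big_seq1 /= !rmorph1 mul1r mulr1.
  + by move=> q; rewrite inE => /eqP -> /=; rewrite x1.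
- move=> g F v [v0 [h [s [xh hF hs]]]].
  exists (x g * v) => //; split; first by rewrite mulr_ge0// (spt_ge0 hx).
  exists h, [seq (q.1, g * q.2) | q <- s]; split => //.
  + rewrite big_map mulrCA hF mulr_sumr; apply: eq_bigr => q _.
    by rewrite rmorphM mulrCA.
  + move=> q /mapP[q' /hs hq' ->] /=; rewrite (sptM hx) mulrCA -mulrA.
    by rewrite ler_wpM2l// (spt_ge0 hx).
- move=> g F v xg [v0 [h [s [xh hF hs]]]].
  exists (v / x g) => //; split; first by rewrite divr_ge0// (spt_ge0 hx).
  exists (h * g), s; split => //.
  + by rewrite (sptM hx) mulf_neq0.
  + by rewrite rmorphM -mulrA.
  + move=> q /hs; rewrite (sptM hx).
    by have -> : v / x g * (x h * x g) = v * x h by field.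
Qed.

Lemma ext_seminorm_chain (A : set ({poly La} -> R)) : A !=set0 ->
  (forall p, A p -> ext_seminorm p) ->
  (forall p q, A p -> A q -> (forall F, p F <= q F) \/ (forall F, q F <= p F)) ->
  ext_seminorm (fun F => inf [set p F | p in A]).
Proof.
move=> [p0 Ap0] hA tA; apply: ext_seminorm_inf.
- by move=> F; exists (p0 F), p0.
- by move=> F _ [p /hA hp <-]; exact: ext_ge0.
- move=> F G _ _ [p Ap <-] [q Aq <-].
  have [pq|qp] := tA p q Ap Aq.
    exists (p (F + G)); [by exists p|rewrite (le_trans (extD (hA p Ap) F G))//].
    by rewrite ge_max !le_max lexx pq orbT.
  exists (q (F + G)); [by exists q|rewrite (le_trans (extD (hA q Aq) F G))//].
  by rewrite ge_max !le_max lexx qp orbT.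
- move=> F G _ _ [p Ap <-] [q Aq <-].
  have [pq|qp] := tA p q Ap Aq.
    exists (p (F * G)); [by exists p|rewrite (le_trans (extM_le (hA p Ap) F G))//].
    by rewrite ler_pM ?(ext_ge0 (hA p Ap)).
  exists (q (F * G)); [by exists q|rewrite (le_trans (extM_le (hA q Aq) F G))//].
  by rewrite ler_pM ?(ext_ge0 (hA q Aq)).
- by move=> _ [p /hA hp <-]; rewrite (ext1 hp).
- by move=> a; exists (p0 a%:P); [exists p0|exact: (extC_le (hA p0 Ap0))].
- move=> g F _ [p Ap <-]; exists (p (g^e * F)); first by exists p.
  by rewrite (extZ (hA p Ap)).
- move=> g F _ xg [p Ap <-]; exists (p F); first by exists p.
  by rewrite (extZ (hA p Ap)) mulrAC divff// mul1r.
Qed.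

Section Minimal.
Variable p : {poly La} -> R.
Hypothesis hp : ext_seminorm p.

Lemma ext_sum_le (I : Type) (r : seq I) (P : pred I) (E : I -> {poly La}) (M : R) :
  0 <= M -> (forall i, P i -> p (E i) <= M) -> p (\sum_(i <- r | P i) E i) <= M.
Proof.
move=> M0 h; elim/big_ind : _ => //.
  by have := extZ hp 0 1; rewrite rmorph0 mul0r => ->; rewrite (spt0 hx) mul0r.
by move=> F G FM GM; rewrite (le_trans (extD hp _ _))// ge_max FM.
Qed.

Lemma extX_le F n : p (F ^+ n) <= p F ^+ n.
Proof.
elim: n => [|n ih]; first by rewrite !expr0 (ext1 hp).
by rewrite !exprS (le_trans (extM_le hp _ _))// ler_wpM2l// (ext_ge0 hp).
Qed.

Lemma ext_muln F n : p (F *+ n) <= p F.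
Proof.
have -> : F *+ n = n%:R%:P * F by rewrite polyC_natr mulr_natl.
rewrite (le_trans (extM_le hp _ _))// ler_piMl ?(ext_ge0 hp)//.
by rewrite (le_trans (extC_le hp _))// vabs_nat.
Qed.

(** Their infimum is the spectral radius of [F] for [p], phrased without roots or limits. *)
Definition spectral_bounds F : set R :=
  [set v | 0 <= v /\ exists c, forall n, p (F ^+ n) <= c * v ^+ n].

Lemma spectral_seminorm : ext_seminorm (fun F => inf (spectral_bounds F)).
Proof.
have cpos c F v : (forall n, p (F ^+ n) <= c * v ^+ n) -> 0 <= c.
  by move=> /(_ 0%N); rewrite !expr0 (ext1 hp) mulr1; apply: le_trans.
have self F : spectral_bounds F (p F).
  by split; [exact: ext_ge0|exists 1 => n; rewrite mul1r extX_le].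
apply: ext_seminorm_inf.
- by move=> F; exists (p F).
- by move=> F v [].
- move=> F G v v' [v0 [c hc]] [v'0 [c' hc']]; exists (Num.max v v') => //.
  have m0 : 0 <= Num.max v v' by rewrite le_max v0.
  split=> //; exists (c * c') => n; rewrite exprDn.
  have [c0 c'0] := (cpos _ _ _ hc, cpos _ _ _ hc').
  apply: ext_sum_le; first by rewrite !mulr_ge0 ?exprn_ge0.
  move=> [i /= ni] _; rewrite (le_trans (ext_muln _ _))//.
  rewrite (le_trans (extM_le hp _ _))//.
  apply: (@le_trans _ _ ((c * v ^+ (n - i)) * (c' * v' ^+ i))).
    by rewrite ler_pM ?(ext_ge0 hp).
  rewrite mulrACA ler_wpM2l ?mulr_ge0//.
  have -> : Num.max v v' ^+ n = Num.max v v' ^+ (n - i) * Num.max v v' ^+ i.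
    by rewrite -exprD subnK.
  by rewrite ler_pM ?exprn_ge0// lerXn2r ?nnegrE// le_max lexx ?orbT.
- move=> F G v v' [v0 [c hc]] [v'0 [c' hc']]; exists (v * v') => //.
  split; first exact: mulr_ge0.
  exists (c * c') => n; rewrite !exprMn (le_trans (extM_le hp _ _))//.
  by rewrite mulrACA ler_pM ?(ext_ge0 hp).
- move=> v [v0 [c hc]]; apply: (@le_of_exp _ _ _ c) => // n.
  by have := hc n; rewrite !expr1n (ext1 hp).
- by move=> a; exists (p a%:P) => //; exact: (extC_le hp).
- move=> g F v [v0 [c hc]]; exists (x g * v) => //.
  split; first by rewrite mulr_ge0// (spt_ge0 hx).
  exists c => n; rewrite !exprMn -rmorphXn (extZ hp) (sptX hx) mulrCA.
  by rewrite ler_wpM2l// exprn_ge0// (spt_ge0 hx).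
- move=> g F v xg [v0 [c hc]]; exists (v / x g) => //.
  have xg0 : 0 < x g by rewrite lt_def xg (spt_ge0 hx).
  split; first by rewrite divr_ge0// ltW.
  exists c => n; rewrite expr_div_n mulrA ler_pdivlMr ?exprn_gt0// mulrC.
  by have := hc n; rewrite exprMn -rmorphXn (extZ hp) (sptX hx).
Qed.

Hypothesis p_min : forall q, ext_seminorm q -> (forall F, q F <= p F) -> q = p.

Lemma min_spectral F v : 0 <= v -> (exists c, forall n, p (F ^+ n) <= c * v ^+ n) ->
  p F <= v.
Proof.
have E : (fun F => inf (spectral_bounds F)) = p.
  apply: p_min; first exact: spectral_seminorm.
  move=> G; apply: ge_inf; first by exists 0 => u [].
  by split; [exact: ext_ge0|exists 1 => n; rewrite mul1r extX_le].
have -> : p F = inf (spectral_bounds F) by rewrite -[in LHS]E.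
by move=> v0 hv; apply: ge_inf => //; exists 0 => u [].
Qed.

Lemma min_sqr F : p (F ^+ 2) = p F ^+ 2.
Proof.
apply/eqP; rewrite eq_le extX_le /=.
have [p0 q0] := (ext_ge0 hp F, ext_ge0 hp (F ^+ 2)).
suff : p F <= Num.sqrt (p (F ^+ 2)).
  move=> h; rewrite -[leRHS]sqr_sqrtr// lerXn2r// nnegrE.
  exact: sqrtr_ge0.
apply/ler_addgt0Pr => e e0; set v := _ + e.
have v0 : 0 < v by rewrite ltr_wpDl ?sqrtr_ge0.
have pv : p (F ^+ 2) <= v ^+ 2.
  by rewrite -[leLHS]sqr_sqrtr// lerXn2r ?nnegrE ?sqrtr_ge0 ?(ltW v0)// lerDl ltW.
apply: min_spectral; first exact: ltW.
(* Even powers are bounded by powers of [v]; the constant absorbs the one extra factor of an odd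
   power. *)
exists (1 + p F / v) => n.
have c1 : 1 <= 1 + p F / v by rewrite lerDl divr_ge0// ltW.
have ev i : p (F ^+ (i * 2)) <= v ^+ (i * 2).
  rewrite mulnC !exprM (le_trans (extX_le _ _))// lerXn2r ?nnegrE ?exprn_ge0 ?(ltW v0)//.
rewrite (divn_eq n 2); set i := (n %/ 2)%N; have : (n %% 2 < 2)%N by rewrite ltn_mod.
case: (n %% 2)%N => [|[|//]] _.
  rewrite addn0 (le_trans (ev i))// ler_peMl// exprn_ge0 ?(ltW v0)//.
rewrite addn1 !exprS (le_trans (extM_le hp _ _))//.
rewrite mulrA (_ : (1 + p F / v) * v = v + p F); last by field; rewrite gt_eqF.
rewrite (le_trans (ler_wpM2l p0 (ev i)))// ler_wpM2r ?exprn_ge0 ?(ltW v0)//.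
by rewrite lerDr ltW.
Qed.

(** Iterated squaring gives the exponents 2^m; submultiplicativity applied to a factorisation of
    F^(2^n) through F^n gives the rest. *)
Lemma min_pow F n : p (F ^+ n) = p F ^+ n.
Proof.
apply/eqP; rewrite eq_le extX_le /=.
have [->|pF0] := eqVneq (p F) 0; first by case: n => [|n]; rewrite ?expr0 ?(ext1 hp)// expr0n/= (ext_ge0 hp).
have pFgt0 : 0 < p F by rewrite lt_def pF0 (ext_ge0 hp).
have p2 m : p (F ^+ (2 ^ m)) = p F ^+ (2 ^ m).
  by elim: m => [|m ih]; rewrite ?expn0 ?expr1// expnSr !exprM min_sqr ih.
have n2 : (n <= 2 ^ n)%N by rewrite ltnW// ltn_expl.
have := p2 n; rewrite -{1}(subnK n2) exprD => h.
have := extM_le hp (F ^+ (2 ^ n - n)) (F ^+ n); rewrite h => h2.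
have := le_trans h2 (ler_wpM2r (ext_ge0 hp _) (extX_le F (2 ^ n - n))).
by rewrite -{1}(subnK n2) exprD ler_pM2l// exprn_gt0.
Qed.

(** Multiplying by F^n, dividing by p(F)^n and taking the infimum over n gives an extension seminorm
    below [p]. By minimality it equals [p], whence p(G) <= p(F G) / p(F). *)
Lemma min_mul F G : p (F * G) = p F * p G.
Proof.
apply/eqP; rewrite eq_le (extM_le hp) /=.
have [->|pF0] := eqVneq (p F) 0; first by rewrite mul0r (ext_ge0 hp).
have pFgt0 : 0 < p F by rewrite lt_def pF0 (ext_ge0 hp).
pose u H n := p (F ^+ n * H) / p F ^+ n.
have u_ge0 H n : 0 <= u H n by rewrite divr_ge0 ?exprn_ge0 ?(ext_ge0 hp)// ltW.
have u_dec H m n : (m <= n)%N -> u H n <= u H m.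
  move=> /subnK <-; elim: (n - m)%N => [//|i ih]; apply: le_trans ih.
  rewrite /u addSn ler_pdivrMr ?exprn_gt0// exprS -mulrA.
  rewrite (le_trans (extM_le hp _ _))// [p F ^+ _.+1]exprS [leRHS]mulrCA.
  by rewrite divfK// expf_neq0.
have E : (fun H => inf [set u H n | n in [set: nat]]) = p.
  apply: p_min; last first.
    move=> H; apply: ge_inf; first by exists 0 => _ [n _ <-].
    by exists 0%N => //; rewrite /u expr0 mul1r divr1.
  apply: ext_seminorm_inf.
  - by move=> H; exists (u H 0%N), 0%N.
  - by move=> H _ [n _ <-].
  - move=> H H' _ _ [n _ <-] [m _ <-]; exists (u (H + H') (maxn n m)); first by exists (maxn n m).
    apply: (@le_trans _ _ (Num.max (u H (maxn n m)) (u H' (maxn n m)))).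
      rewrite /u -maxr_pMl ?invr_ge0 ?exprn_ge0 ?(ltW pFgt0)//.
      by rewrite ler_wpM2r ?invr_ge0 ?exprn_ge0 ?(ltW pFgt0)// mulrDr (extD hp).
    by rewrite ge_max !le_max !u_dec ?leq_maxl ?leq_maxr ?orbT.
  - move=> H H' _ _ [n _ <-] [m _ <-]; exists (u (H * H') (n + m)%N); first by exists (n + m)%N.
    rewrite /u !exprD invfM mulrACA [leRHS]mulrACA ler_wpM2r//.
      by rewrite mulr_ge0 ?invr_ge0 ?exprn_ge0 ?(ltW pFgt0).
    by rewrite (extM_le hp).
  - by move=> _ [n _ <-]; rewrite /u mulr1 min_pow divff// expf_neq0.
  - move=> a; exists (u a%:P 0%N); first by exists 0%N.
    by rewrite /u expr0 mul1r divr1 (extC_le hp).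
  - move=> g H _ [n _ <-]; exists (u (g^e * H) n); first by exists n.
    by rewrite /u mulrCA (extZ hp) mulrA.
  - move=> g H _ xg [n _ <-]; exists (u H n); first by exists n.
    by rewrite /u mulrCA (extZ hp) mulrAC [x g * _]mulrC mulfK.
have E' : p G = inf [set u G n | n in [set: nat]] by rewrite -[in LHS]E.
rewrite mulrC -ler_pdivlMr// E'; apply: ge_inf; first by exists 0 => _ [n _ <-].
by exists 1%N => //; rewrite /u !expr1.
Qed.

End Minimal.

Lemma exists_min_ext : exists2 p, ext_seminorm p &
  forall q, ext_seminorm q -> (forall F, q F <= p F) -> q = p.
Proof.
pose T := {p : {poly La} -> R | ext_seminorm p}.
pose r (p q : T) := `[< forall F, sval q F <= sval p F >].
have [|||A tA|[p hp] pmin] := @Zorn T r.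
- by move=> p; apply/asboolP.
- move=> p q s /asboolP pq /asboolP qs; apply/asboolP => F.
  exact: le_trans (qs F) (pq F).
- move=> [p hp] [q hq] /asboolP /= pq /asboolP /= qp; apply: eq_exist => /=.
  by apply/funext => F; apply/eqP; rewrite eq_le pq qp.
(* The empty chain needs some extension seminorm to exist at all: this is the tensor seminorm. *)
- have [[p0 Ap0]|A0] := pselect (A !=set0); last first.
    exists (exist _ _ tensor_seminorm) => s As.
    by exfalso; apply: A0; exists s.
  have hq : ext_seminorm (fun F => inf [set p F | p in [set sval p | p in A]]).
    apply: ext_seminorm_chain.
    - by exists (sval p0), p0.
    - by move=> _ [p _ <-]; exact: (svalP p).
    - move=> _ _ [p Ap <-] [q Aq <-].
      by have [/asboolP|/asboolP] := tA p q Ap Aq; [right|left].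
  exists (exist _ _ hq) => s As; apply/asboolP => F /=; apply: ge_inf.
    by exists 0 => _ [_ [p _ <-] <-]; exact: (ext_ge0 (svalP p)).
  by exists (sval s) => //; exists s.
- exists p => // q hq qp.
  by have := pmin (exist _ q hq); rewrite /r => /(_ (asboolT qp)) [].
Qed.

(** Multiplicativity turns the upper bounds at [a] and at its inverse into the equality p(a) = |a|.
    Surjectivity of [restr] rests on this. *)
Theorem seminorm_lift : exists2 y, seminorm_pt y & forall g, y g^e = x g.
Proof.
have [p hp pmin] := exists_min_ext.
have pM := min_mul hp pmin.
exists p; last by move=> g; rewrite -[g^e]mulr1 (extZ hp) (ext1 hp) mulr1.
split; [exact: (ext_ge0 hp)|exact: (extD hp)|exact: pM|move=> a].
apply/eqP; rewrite eq_le (extC_le hp) /=.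
have [->|a0] := eqVneq a 0; first by rewrite vabs0 (ext_ge0 hp).
have va := vabs_gt0 a0.
have : p a%:P * p (a^-1)%:P = 1 by rewrite -pM -polyCM divff// (ext1 hp).
have := extC_le hp a^-1; rewrite vabsV => h1 h2.
have : 1 <= p a%:P / vabs a by rewrite -h2 ler_wpM2l// (ext_ge0 hp).
by rewrite ler_pdivlMr// mul1r.
Qed.

End Lift.

Lemma ler_eps (R : realType) (c a b : R) : 0 <= c ->
  (forall e, 0 < e -> e <= 1 -> a <= b + c * e) -> a <= b.
Proof.
move=> c0 h; apply/ler_addgt0Pr => e e0.
pose d := Num.min 1 (e / (c + 1)).
have d0 : 0 < d by rewrite lt_min ltr01 divr_gt0//; lra.
rewrite (le_trans (h d d0 _)) ?ge_min ?lexx// lerD2l.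
have : d * (c + 1) <= e by rewrite -ler_pdivlMr ?ge_min ?lexx ?orbT//; lra.
by apply: le_trans; rewrite mulrDr mulr1 mulrC lerDl ltW.
Qed.

Lemma arith_eps (R : realType) (a b e : R) :
  a + e + (b + e) + (e + e) = a + b + 4 * e.
Proof. ring. Qed.

Lemma sup_max (R : realType) (A : set R) (M : R) :
  A M -> (forall u, A u -> u <= M) -> sup A = M.
Proof.
move=> AM uM; apply/eqP; rewrite eq_le; apply/andP; split.
  by apply: ge_sup; [exists M|].
by apply: sup_upper_bound => //; split; exists M.
Qed.

(** * Points of the disc as seminorms on polynomials *)

Section PolyTate.
Variables (R : realType) (k : valuedField R).
Implicit Types (F G : {poly k}) (f g : tate k) (x z : berk k).

Fact ptate_subproof F : (fun n => F`_n) \in tate_pred (k := k).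
Proof.
apply/tate_predP => e e0; exists (size F) => i Fi.
by rewrite nth_default// vabs0.
Qed.

Definition ptate F : tate k := Tate (ptate_subproof F).

Lemma ptateD F G : ptate (F + G) = ptate F + ptate G.
Proof. by apply: tate_ext => n /=; rewrite coefD. Qed.

Lemma ptateB F G : ptate (F - G) = ptate F - ptate G.
Proof. by apply: tate_ext => n /=; rewrite coefB. Qed.

Lemma ptateM F G : ptate (F * G) = ptate F * ptate G.
Proof. by apply: tate_ext => n /=; rewrite coefM. Qed.

Lemma ptateC (a : k) : ptate a%:P = tateC a.
Proof. by apply: tate_ext => n /=; rewrite coefC. Qed.

Lemma ptateX : ptate 'X = tateX k.
Proof. by apply: tate_ext => n /=; rewrite coefX. Qed.

Lemma ptate0 : ptate 0 = 0.
Proof. by apply: tate_ext => n /=; rewrite coef0. Qed.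

Lemma ptate_XsubC (a : k) : ptate ('X - a%:P) = tateX k - tateC a.
Proof. by rewrite ptateB ptateX ptateC. Qed.

Lemma gauss_norm_ptate F : gauss_norm (ptate F) = wnorm 1 F.
Proof.
apply/eqP; rewrite eq_le; apply/andP; split.
  by apply: gauss_norm_le => i; have := wnorm_ub F i (@ler01 R); rewrite expr1n mulr1.
apply: wnorm_le => [|i]; first exact: gauss_norm_ge0.
by rewrite expr1n mulr1 (gauss_norm_ub (ptate F) i).
Qed.

Lemma tate_approx f (e : R) : 0 < e -> exists F, gauss_norm (f - ptate F) <= e.
Proof.
move=> e0; have [N hN] := tate_cvg f e0; exists (\poly_(i < N) f i).
apply: gauss_norm_le => i; rewrite tate_coefD tate_coefN /= coef_poly.
by have [iN|Ni] := ltnP; rewrite ?subrr ?vabs0 ?ltW// subr0 hN.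
Qed.

Lemma berk0 x : x 0 = 0.
Proof.
have -> : 0 = tateC 0 :> tate k by apply: tate_ext => -[|n].
by rewrite seminormC vabs0.
Qed.

Lemma berk1 x : x 1 = 1. Proof. by rewrite -[1]/(tateC 1) seminormC vabs1. Qed.

Lemma tateCD (a b : k) : tateC (a + b) = tateC a + tateC b.
Proof. by rewrite -!ptateC -ptateD polyCD. Qed.

Lemma tateCB (a b : k) : tateC (a - b) = tateC a - tateC b.
Proof. by rewrite -!ptateC -ptateB polyCB. Qed.

Lemma gauss_normN f : gauss_norm (- f) = gauss_norm f.
Proof.
have main g : gauss_norm (- g) <= gauss_norm g.
  by apply: gauss_norm_le => i; rewrite tate_coefN vabsN gauss_norm_ub.
by apply/eqP; rewrite eq_le main /= -{1}(opprK f) main.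
Qed.

Lemma gauss_distC f g : gauss_norm (f - g) = gauss_norm (g - f).
Proof. by rewrite -opprB gauss_normN. Qed.

Lemma berkN x f : x (- f) = x f.
Proof.
have -> : - f = tateC (-1) * f.
  suff -> : tateC (-1) = -1 :> tate k by rewrite mulN1r.
  by rewrite -[-1 in LHS]sub0r tateCB -ptateC ptate0 sub0r.
by rewrite seminormM seminormC vabsN vabs1 mul1r.
Qed.

Lemma berk_ge0 x f : 0 <= x f.
Proof.
have := seminormD x f (- f); rewrite subrr berk0 berkN -mulr2n.
by rewrite pmulrn_lge0.
Qed.

Lemma berkX x f n : x (f ^+ n) = x f ^+ n.
Proof. by elim: n => [|n ih]; rewrite ?expr0 ?berk1// !exprS seminormM ih. Qed.

Lemma berk_sum_le x (I : Type) (r : seq I) (E : I -> tate k) :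
  x (\sum_(i <- r) E i) <= \sum_(i <- r) x (E i).
Proof.
elim/big_ind2 : _ => //; first by rewrite berk0.
by move=> f u g v fu gv; rewrite (le_trans (seminormD _ _ _))// lerD.
Qed.

(** Points are only required to satisfy the triangle inequality; the binomial formula, the bound |n|
    <= 1 on integers and the power trick make it ultrametric. *)
Lemma berk_max x f g : x (f + g) <= Num.max (x f) (x g).
Proof.
have m0 : 0 <= Num.max (x f) (x g) by rewrite le_max berk_ge0.
apply: (@le_of_exp_lin _ _ _ 1) => // [|n]; first exact: berk_ge0.
rewrite -berkX exprDn (le_trans (berk_sum_le _ _ _))//.
rewrite mulr1 mulr_natl -[n.+1 in leRHS]card_ord -sumr_const; apply: ler_sum => -[i /= ni] _.
have -> : (f ^+ (n - i) * g ^+ i) *+ 'C(n, i) = tateC ('C(n, i)%:R) * (f ^+ (n - i) * g ^+ i).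
  rewrite -[LHS]mulr_natl; congr (_ * _).
  elim: ('C(n, i)) => [|m ih]; first by apply: tate_ext => -[|j].
  by rewrite -!natr1 ih -[X in _ + X]/(tateC 1) -tateCD.
rewrite seminormM seminormC (le_trans (ler_wpM2r (berk_ge0 _ _) (vabs_nat _ _)))//.
rewrite mul1r seminormM !berkX.
have -> : Num.max (x f) (x g) ^+ n = Num.max (x f) (x g) ^+ (n - i) * Num.max (x f) (x g) ^+ i.
  by rewrite -exprD subnK.
by rewrite ler_pM ?exprn_ge0 ?berk_ge0// lerXn2r ?nnegrE ?berk_ge0// le_max lexx ?orbT.
Qed.

Lemma berk_dist x f g : `|x f - x g| <= gauss_norm (f - g).
Proof.
have h u v : x u - x v <= gauss_norm (u - v).
  rewrite lerBlDr (le_trans _ (lerD (seminorm_le_gauss x _) (lexx _)))//.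
  by rewrite -{1}(subrK v u) seminormD.
rewrite ler_norml h andbT lerNl opprB (le_trans (h _ _))//.
by rewrite gauss_distC.
Qed.

Definition poly_pt x F := x (ptate F).

Lemma poly_pt_seminorm x : seminorm_pt (poly_pt x).
Proof.
split=> [F|F G|F G|a]; rewrite /poly_pt.
- exact: berk_ge0.
- by rewrite ptateD berk_max.
- by rewrite ptateM seminormM.
- by rewrite ptateC seminormC.
Qed.

Lemma gauss_X : gauss_norm (tateX k) = 1.
Proof.
have := @wnormX_sub R k 1 0 ler01; rewrite subr0 vabs0 max_l// -gauss_norm_ptate.
by rewrite ptateX.
Qed.

Lemma poly_ptX x : poly_pt x 'X <= 1.
Proof. by rewrite /poly_pt ptateX (le_trans (seminorm_le_gauss _ _))// gauss_X. Qed.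

Lemma berk_le_poly x z : (forall F, poly_pt x F <= poly_pt z F) -> berk_le x z.
Proof.
move=> h f; apply: (@ler_eps _ 2) => // e e0 e1.
have [F fF] := tate_approx f e0.
have := le_trans (berk_dist x f (ptate F)) fF.
have := le_trans (berk_dist z f (ptate F)) fF.
by have := h F; rewrite /poly_pt !ler_distl => ? /andP[? ?] /andP[? ?]; lra.
Qed.

Lemma berk_le_anti x z : berk_le x z -> berk_le z x -> x = z.
Proof.
by move=> xz zx; apply/berk_ext/funext => f; apply/eqP; rewrite eq_le xz zx.
Qed.

Lemma berk_le_refl x : berk_le x x. Proof. by move=> f. Qed.

Lemma berk_le_trans z x y : berk_le x z -> berk_le z y -> berk_le x y.
Proof. by move=> xz zy f; exact: le_trans (zy f). Qed.

Lemma spt_approx (y : {poly k} -> R) F G : seminorm_pt y -> y 'X <= 1 ->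
  `|y F - y G| <= wnorm 1 (F - G).
Proof.
move=> hy y1; have h u v : y u - y v <= y (u - v).
  rewrite lerBlDr -{1}(subrK v u) (le_trans (sptD hy _ _))//.
  by rewrite ge_max lerDl lerDr !(spt_ge0 hy).
rewrite (le_trans _ (spt_le_wnorm hy _ y1))// ler_norml h andbT lerNl opprB.
by rewrite (le_trans (h _ _))// -opprB (sptN hy).
Qed.

End PolyTate.

(** * Points of X_K as seminorms on polynomials over the algebraic closure *)

Section Extension.
Variables (R : realType) (k : valuedField R) (C : completedAlgClosure k).
Local Notation La := (kav C).
Local Notation K := (Kf C).

Definition toK : {rmorphism La -> K} := to_K C.

Local Notation "F ^K" := (map_poly toK F) (at level 2, format "F ^K").

Lemma vabs_toK (a : La) : vabs (toK a) = vabs a. Proof. by []. Qed.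

Lemma toK_dense (z : K) (e : R) : 0 < e -> exists w : La, vabs (z - toK w) < e.
Proof. exact: to_K_dense. Qed.

Lemma toK_emb (a : k) : toK (emb C a) = to_K C (to_ka C a).
Proof. by rewrite embE. Qed.

Opaque toK.

Lemma wnorm_map_toK s (F : {poly La}) : wnorm s F^K = wnorm s F.
Proof.
rewrite /wnorm size_map_poly; apply: eq_bigr => i _.
by rewrite coef_map vabs_toK.
Qed.

Lemma tate_approx_alg (f : tate K) (e : R) : 0 < e ->
  exists F : {poly La}, gauss_norm (f - ptate F^K) <= e.
Proof.
move=> e0; have [G fG] := tate_approx f e0.
have /choice[u hu] : forall i, exists w : La, vabs (G`_i - toK w) < e.
  by move=> i; exact: toK_dense.
exists (\poly_(i < size G) u i); apply: gauss_norm_le => i.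
have -> : (f - ptate (\poly_(i < size G) u i)^K) i =
    (f - ptate G) i + (G - (\poly_(i < size G) u i)^K)`_i.
  by rewrite !tate_coefD !tate_coefN /= coefB; ring.
rewrite (le_trans (vabsD_max _ _))// ge_max (le_trans (gauss_norm_ub _ i) fG) /=.
rewrite coefB coef_map coef_poly; case: ltnP => [_|iG]; first exact/ltW/hu.
by rewrite nth_default// raddf0 subrr vabs0 ltW.
Qed.

Section Ext.
Variable y : {poly La} -> R.
Hypothesis (hy : seminorm_pt y) (y1 : y 'X <= 1).

(** Extension by continuity, in McShane's form: [y] is 1-Lipschitz for the Gauss norm on a dense
    subring, so no approximating sequence has to be chosen. *)
Definition ext_val (f : tate K) : R :=
  sup [set y F - gauss_norm (f - ptate F^K) | F in [set: {poly La}]].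

Lemma ext_val_dist f F : `|ext_val f - y F| <= gauss_norm (f - ptate F^K).
Proof.
have main G H : y G - gauss_norm (f - ptate G^K) <= y H + gauss_norm (f - ptate H^K).
  rewrite lerBlDr -addrA -lerBlDl.
  rewrite (le_trans (ler_norm _))// (le_trans (spt_approx G H hy y1))//.
  rewrite -wnorm_map_toK rmorphB -gauss_norm_ptate ptateB.
  have -> : ptate G^K - ptate H^K = (f - ptate H^K) + (ptate G^K - f) by ring.
  by rewrite (le_trans (gauss_normD _ _))// (gauss_distC (ptate _)).
have ub H : ubound [set y F - gauss_norm (f - ptate F^K) | F in [set: {poly La}]]
    (y H + gauss_norm (f - ptate H^K)) by move=> _ [G _ <-]; exact: main.
rewrite ler_distl; apply/andP; split.
  apply: sup_upper_bound; last by exists F.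
  by split; [exists (y F - gauss_norm (f - ptate F^K)), F|exists (y F + gauss_norm (f - ptate F^K))].
by apply: ge_sup => //; exists (y F - gauss_norm (f - ptate F^K)), F.
Qed.

Opaque ext_val.

Lemma ext_val_approx f e : 0 < e -> exists F, [/\ gauss_norm (f - ptate F^K) <= e,
  ext_val f <= y F + e & y F <= ext_val f + e].
Proof.
move=> e0; have [F fF] := tate_approx_alg f e0; exists F; split => //.
  by have := le_trans (ext_val_dist f F) fF; rewrite ler_distl => /andP[? ?]; lra.
by have := le_trans (ext_val_dist f F) fF; rewrite ler_distl => /andP[? ?]; lra.
Qed.

Lemma ext_val_poly F : ext_val (ptate F^K) = y F.
Proof.
have := ext_val_dist (ptate F^K) F; rewrite subrr.
have -> : gauss_norm (0 : tate K) = 0.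
  apply/eqP; rewrite eq_le gauss_norm_ge0 andbT; apply: gauss_norm_le => i.
  by rewrite tate_coef0 vabs0.
by rewrite normr_le0 subr_eq0 => /eqP.
Qed.

Fact ext_valD f g : ext_val (f + g) <= ext_val f + ext_val g.
Proof.
apply: (@ler_eps _ 4) => // e e0 e1.
have [F [fF f1 f2]] := ext_val_approx f e0.
have [G [gG g1 g2]] := ext_val_approx g e0.
have := ext_val_dist (f + g) (F + G).
have : gauss_norm (f + g - ptate (F + G)^K) <= e + e.
  rewrite rmorphD /= ptateD.
  have -> : f + g - (ptate F^K + ptate G^K) = (f - ptate F^K) + (g - ptate G^K) by ring.
  by rewrite (le_trans (gauss_normD _ _))// lerD.
have : y (F + G) <= y F + y G.
  by rewrite (le_trans (sptD hy _ _))// ge_max lerDl lerDr !(spt_ge0 hy).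
rewrite ler_distl => h1 h2 /andP[_ h3].
rewrite (le_trans h3)// (le_trans (lerD h1 h2))// (le_trans (lerD (lerD f2 g2) (lexx _)))//.
by rewrite arith_eps.
Qed.

Fact ext_val_ge0 f : 0 <= ext_val f.
Proof.
apply: (@ler_eps _ 1) => // e e0 e1.
have [F [fF f1 f2]] := ext_val_approx f e0.
by have := spt_ge0 hy F; lra.
Qed.

Fact ext_val_le_gauss f : ext_val f <= gauss_norm f.
Proof.
apply: (@ler_eps _ 2) => // e e0 e1.
have [F [fF f1 f2]] := ext_val_approx f e0.
have := spt_le_wnorm hy F y1; rewrite -wnorm_map_toK -gauss_norm_ptate.
have : gauss_norm (ptate F^K) <= gauss_norm f + e.
  have -> : ptate F^K = f + (ptate F^K - f) by ring.
  by rewrite (le_trans (gauss_normD _ _))// lerD2l gauss_distC.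
lra.
Qed.

Fact ext_valM f g : ext_val (f * g) = ext_val f * ext_val g.
Proof.
(* Two errors are added, each at most e (|f| + |g| + e) with Gauss norms and e <= 1. *)
pose c := 2 * (gauss_norm f + gauss_norm g + 1).
have [nf ng] := (gauss_norm_ge0 f, gauss_norm_ge0 g).
have c0 : 0 <= c by rewrite /c; lra.
suff main e : 0 < e -> e <= 1 -> `|ext_val (f * g) - ext_val f * ext_val g| <= c * e.
  apply/eqP; rewrite -subr_eq0 -normr_le0; apply: (@ler_eps _ c) => // e e0 e1.
  by rewrite add0r main.
move=> e0 e1.
have [F [fF f1 f2]] := ext_val_approx f e0.
have [G [gG g1 g2]] := ext_val_approx g e0.
have h1 : gauss_norm (f * g - ptate (F * G)^K) <= e * (gauss_norm f + gauss_norm g + e).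
  rewrite rmorphM /= ptateM.
  have -> : f * g - ptate F^K * ptate G^K =
    (f - ptate F^K) * g + (f + (ptate F^K - f)) * (g - ptate G^K) by ring.
  rewrite (le_trans (gauss_normD _ _))// !gauss_normM.
  have := gauss_normD f (ptate F^K - f); rewrite (gauss_distC (ptate _)).
  move: fF gG (gauss_norm_ge0 (f - ptate F^K)) (gauss_norm_ge0 (g - ptate G^K))
    (gauss_norm_ge0 (f + (ptate F^K - f))).
  move: nf ng e0 e1.
  move: (gauss_norm f) (gauss_norm g) => nf ng.
  move: (gauss_norm (f - ptate F^K)) (gauss_norm (g - ptate G^K)) => A B.
  move: (gauss_norm (f + (ptate F^K - f))) => D.
  by clear; move=> *; nra.
have h2 := ext_val_dist (f * g) (F * G); rewrite (sptM hy) in h2.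
have [p1 p2] := (ext_val_ge0 f, ext_val_ge0 g).
have [q1 q2] := (spt_ge0 hy F, spt_ge0 hy G).
have [r1 r2] := (ext_val_le_gauss f, ext_val_le_gauss g).
have h3 : `|y F * y G - ext_val f * ext_val g| <= e * (gauss_norm f + gauss_norm g + e).
  move: nf ng e0 e1 f1 f2 g1 g2 p1 p2 q1 q2 r1 r2.
  move: (gauss_norm f) (gauss_norm g) (ext_val f) (ext_val g) (y F) (y G).
  by clear; move=> *; rewrite ler_distl; apply/andP; split; nra.
apply: (le_trans (ler_distD (y F * y G) _ _)).
apply: (le_trans (lerD (le_trans h2 h1) h3)); rewrite /c.
move: nf ng e0 e1; move: (gauss_norm f) (gauss_norm g); clear; move=> *; nra.
Qed.

Fact ext_valC a : ext_val (tateC a) = vabs a.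
Proof.
suff main e : 0 < e -> e <= 1 -> `|ext_val (tateC a) - vabs a| <= 2 * e.
  apply/eqP; rewrite -subr_eq0 -normr_le0; apply: (@ler_eps _ 2) => // e e0 e1.
  by rewrite add0r main.
move=> e0 e1; have [w /ltW aw] := toK_dense a e0.
have := ext_val_dist (tateC a) w%:P; rewrite map_polyC /= ptateC (sptC hy).
rewrite -tateCB gauss_normC -vabs_toK => /le_trans/(_ aw) h.
have : `|vabs (toK w) - vabs a| <= e.
  have wE : vabs (toK w) <= vabs a + e.
    have -> : toK w = a - (a - toK w) by ring.
    rewrite (le_trans (vabsB_max _ _))// ge_max lerDl ltW//= (le_trans aw)//.
    by rewrite lerDr vabs_ge0.
  have aE : vabs a <= vabs (toK w) + e.
    rewrite -{1}(subrK (toK w) a) (le_trans (vabsD_max _ _))// ge_max.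
    by rewrite (le_trans aw) ?lerDr ?vabs_ge0//= lerDl ltW.
  by rewrite ler_distl; apply/andP; split; lra.
move=> h2; have -> : ext_val (tateC a) - vabs a =
  (ext_val (tateC a) - vabs (toK w)) + (vabs (toK w) - vabs a) by ring.
by rewrite (le_trans (ler_normD _ _))//; lra.
Qed.

Definition ext_berk : berk K := Berk ext_valD ext_valM ext_valC ext_val_le_gauss.

End Ext.

(* The restriction of a point of X_K to polynomials over the algebraic closure,
   a dense subalgebra of K{T}. *)
Definition alg_pt (y : berk K) (F : {poly La}) : R := y (ptate F^K).

Lemma alg_pt_seminorm y : seminorm_pt (alg_pt y).
Proof.
have hy := poly_pt_seminorm y; split=> [F|F G|F G|a]; rewrite /alg_pt.
- exact: (spt_ge0 hy).
- by rewrite rmorphD; exact: (sptD hy).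
- by rewrite rmorphM; exact: (sptM hy).
- by rewrite map_polyC /= ptateC seminormC.
Qed.

Lemma alg_ptX y : alg_pt y 'X <= 1.
Proof. by rewrite /alg_pt map_polyX; exact: poly_ptX. Qed.

Lemma alg_pt_ext y (hy : seminorm_pt y) (y1 : y 'X <= 1) F :
  alg_pt (ext_berk hy y1) F = y F.
Proof. exact: ext_val_poly. Qed.

Lemma berk_le_alg (y z : berk K) :
  (forall F, alg_pt y F <= alg_pt z F) -> berk_le y z.
Proof.
move=> h f; apply: (@ler_eps _ 2) => // e e0 e1.
have [F fF] := tate_approx_alg f e0.
have := le_trans (berk_dist y f _) fF.
have := le_trans (berk_dist z f _) fF.
by have := h F; rewrite /alg_pt !ler_distl => ? /andP[? ?] /andP[? ?]; lra.
Qed.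

Lemma restr_poly (y : berk K) (g : {poly k}) :
  poly_pt (restr y) g = alg_pt y (map_poly (emb C) g).
Proof.
rewrite /poly_pt /alg_pt /=; congr (seminorm y _); apply: tate_ext => n /=.
by rewrite coef_map /= coef_map /= toK_emb.
Qed.

Lemma restr_surj (x : berk k) : vf_complete k -> exists y : berk K, restr y = x.
Proof.
move=> hk; have [y hy yx] := @seminorm_lift _ _ C hk _ (poly_pt_seminorm x).
have y1 : y 'X <= 1.
  by have := yx 'X; rewrite map_polyX => ->; exact: poly_ptX.
exists (ext_berk hy y1); apply: berk_le_anti; apply: berk_le_poly => F;
  by rewrite restr_poly alg_pt_ext yx.
Qed.

Section DiscPt.
Variables (w : K) (s : R).
Hypothesis (w1 : vabs w <= 1) (s01 : 0 <= s <= 1).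

Let s0 : 0 <= s. Proof. by case/andP: s01. Qed.
Let hd := disc_norm_pt w s0.

Fact disc_alg_pt : seminorm_pt (fun F : {poly La} => disc_norm w s F^K).
Proof.
split=> [F|F G|F G|a].
- exact: (spt_ge0 hd).
- by rewrite rmorphD; exact: (sptD hd).
- by rewrite rmorphM; exact: (sptM hd).
- by rewrite map_polyC /= (sptC hd).
Qed.

Lemma disc_normX_le1 : disc_norm w s 'X <= 1.
Proof.
by rewrite -['X]subr0 disc_normX_sub// subr0 ge_max w1 andbT; case/andP: s01.
Qed.

Fact disc_alg_pt1 : disc_norm w s ('X : {poly La})^K <= 1.
Proof. by rewrite map_polyX disc_normX_le1. Qed.

Definition disc_pt : berk K := ext_berk disc_alg_pt disc_alg_pt1.

Lemma alg_disc_pt F : alg_pt disc_pt F = disc_norm w s F^K.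
Proof. exact: alg_pt_ext. Qed.

Lemma poly_disc_pt (G : {poly K}) : poly_pt disc_pt G = disc_norm w s G.
Proof.
suff main e : 0 < e -> e <= 1 -> `|poly_pt disc_pt G - disc_norm w s G| <= 2 * e.
  apply/eqP; rewrite -subr_eq0 -normr_le0; apply: (@ler_eps _ 2) => // e e0 e1.
  by rewrite add0r main.
move=> e0 e1; have [F GF] := tate_approx_alg (ptate G) e0.
have h1 := le_trans (berk_dist disc_pt (ptate G) (ptate F^K)) GF.
have h2 := spt_approx F^K G hd disc_normX_le1.
rewrite -gauss_norm_ptate ptateB gauss_distC in h2.
have h3 := le_trans h2 GF.
rewrite -alg_disc_pt -/(poly_pt _ _) in h1 h3 *.
have -> : poly_pt disc_pt G - disc_norm w s G =
  (poly_pt disc_pt G - alg_pt disc_pt F) + (alg_pt disc_pt F - disc_norm w s G) by ring.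
by rewrite (le_trans (ler_normD _ _))// -[2]/(1 + 1) mulrDl mul1r lerD.
Qed.

Lemma le_disc_pt (z : berk K) : z (tateX K - tateC w) <= s -> berk_le z disc_pt.
Proof.
move=> zw; apply: berk_le_poly => G; rewrite poly_disc_pt.
by apply: (spt_le_disc (poly_pt_seminorm z)); rewrite /poly_pt ptate_XsubC.
Qed.

(** The supremum over the Berkovich disc is attained at [disc_pt], its largest point. *)
Lemma is_disc_ptP (y : berk K) : is_disc_pt w s y <-> y = disc_pt.
Proof.
have E f : sup [set z f | z in [set z : berk K | z (tateX K - tateC w) <= s]] = disc_pt f.
  apply: sup_max; last by move=> _ [z /le_disc_pt zd <-]; exact: zd.
  exists disc_pt => //; change (disc_pt (tateX K - tateC w) <= s).
  rewrite -ptate_XsubC -/(poly_pt _ _) poly_disc_pt.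
  by rewrite disc_normX_sub// subrr vabs0 max_l.
split=> [h|->]; last by move=> f; rewrite E.
by apply/berk_ext/funext => f; rewrite h E.
Qed.

End DiscPt.
End Extension.

Lemma seq_argmin (R : realType) (T : eqType) (f : T -> R) (s : seq T) x0 :
  x0 \in s -> exists2 z, z \in s & forall z', z' \in s -> f z <= f z'.
Proof.
elim: s x0 => // a s ih x0 _.
case: s ih => [_|b s ih].
  by exists a; rewrite ?inE// => z'; rewrite inE => /eqP ->.
have [z zs zmin] := ih b (mem_head _ _).
have [az|za] := leP (f a) (f z).
  exists a; rewrite ?mem_head// => z'; rewrite inE => /predU1P[->//|/zmin].
  exact: le_trans.
exists z; first by rewrite inE zs orbT.
by move=> z'; rewrite inE => /predU1P[->|/zmin//]; exact: ltW.
Qed.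

(** * Distances to Galois orbits *)

Section Distance.
Variables (R : realType) (k : valuedField R) (C : completedAlgClosure k).
Hypothesis k_complete : vf_complete k.

Local Notation La := (kav C).
Local Notation K := (Kf C).
Local Notation "p ^e" := (map_poly (emb C) p) (at level 2, format "p ^e").
Local Notation "F ^K" := (map_poly (@toK R k C) F) (at level 2, format "F ^K").
Implicit Types (y : {poly La} -> R) (v w z : La) (s t : R) (x : berk k).

(** The value at x_{w,s} of the minimal polynomial of [w]. It is strictly increasing in [s], so the
    value of that polynomial at a point determines the distance of the point to the orbit of [w]. *)
Definition Lam w s : R := \prod_(z <- conjs w) Num.max s (vabs (w - z)).

Lemma disc_norm_mpoly w s : 0 <= s -> disc_norm w s (mpoly w)^e = Lam w s.
Proof.
move=> s0; rewrite mpoly_prod (spt_prod (disc_norm_pt w s0)).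
by apply: eq_bigr => z _; rewrite disc_normX_sub.
Qed.

Lemma Lam_rem w s : 0 <= s ->
  Lam w s = s * \prod_(z <- rem w (conjs w)) Num.max s (vabs (w - z)).
Proof.
by move=> s0; rewrite /Lam (big_rem _ (conjs_self w)) /= subrr vabs0 max_l.
Qed.

Lemma Lam_lt w s t : 0 <= s -> s < t -> Lam w s < Lam w t.
Proof.
move=> s0 st; have t0 : 0 < t by exact: le_lt_trans st.
rewrite !Lam_rem ?(ltW t0)//.
apply: (@le_lt_trans _ _ (s * \prod_(z <- rem w (conjs w)) Num.max t (vabs (w - z)))).
  rewrite ler_wpM2l//; apply: ler_prod => z _; rewrite le_max s0/=.
  by rewrite ge_max !le_max (ltW st) lexx orbT.
rewrite ltr_pM2r//; apply: prodr_gt0 => z _.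
by rewrite lt_max t0.
Qed.

Lemma Lam_gt0 w s : 0 < s -> 0 < Lam w s.
Proof. by move=> s0; apply: prodr_gt0 => z _; rewrite lt_max s0. Qed.

Lemma Lam_le w s t : 0 <= s -> 0 <= t -> (Lam w s <= Lam w t) = (s <= t).
Proof.
move=> s0 t0; have [st|ts|->] := ltgtP s t; last by rewrite !lexx.
  by rewrite ltW// Lam_lt.
by apply/negbTE; rewrite -ltNge Lam_lt.
Qed.

Lemma Lam_inj w s t : 0 <= s -> 0 <= t -> Lam w s = Lam w t -> s = t.
Proof.
by move=> s0 t0 h; apply/eqP; rewrite eq_le -(@Lam_le w s t)// -(@Lam_le w t s)// h lexx.
Qed.

Fact nearest_exists y w : exists z, z \in conjs w /\
  forall z', z' \in conjs w -> y ('X - z%:P) <= y ('X - z'%:P).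
Proof.
by have [z ? ?] := seq_argmin (fun z => y ('X - z%:P)) (conjs_self w); exists z.
Qed.

Definition nearest y w : La := projT1 (cid (nearest_exists y w)).

Definition dist_alg y w : R := y ('X - (nearest y w)%:P).

Lemma nearest_conj y w : nearest y w \in conjs w.
Proof. by rewrite /nearest; case: cid => z []. Qed.

Lemma dist_alg_le y w z : z \in conjs w -> dist_alg y w <= y ('X - z%:P).
Proof. by rewrite /dist_alg /nearest; case: cid => z' /= []; auto. Qed.

Lemma dist_alg_ge0 y w : seminorm_pt y -> 0 <= dist_alg y w.
Proof. by move=> hy; exact: (spt_ge0 hy). Qed.

(** For [z] the conjugate nearest to [y], at distance d, the ultrametric inequality gives |T - z'|_y
    = max(d, |z - z'|) for every conjugate z'. Hence [y] and x_{z,d} agree on the minimal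
    polynomial. *)
Lemma spt_mpoly y w : seminorm_pt y -> y (mpoly w)^e = Lam w (dist_alg y w).
Proof.
move=> hy; have d0 := dist_alg_ge0 w hy.
have zw := nearest_conj y w; set z := nearest y w in zw *.
rewrite -disc_norm_mpoly// -(conj_disc_norm k_complete _ _ zw).
rewrite mpoly_prod (spt_prod hy) (spt_prod (disc_norm_pt _ d0)).
rewrite !big_seq; apply: eq_bigr => z' z'w.
rewrite disc_normX_sub//; apply/eqP; rewrite eq_le (spt_dist_max hy) /=.
rewrite ge_max dist_alg_le//= (le_trans (vabs_spt_max hy z z'))//.
by rewrite ge_max lexx (dist_alg_le _ z'w).
Qed.

Definition ev v : {poly La} -> R := disc_norm v 0.

Lemma ev_pt v : seminorm_pt (ev v). Proof. exact: disc_norm_pt. Qed.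

Lemma evX v z : ev v ('X - z%:P) = vabs (v - z).
Proof. by rewrite /ev disc_normX_sub// max_r// vabs_ge0. Qed.

(* Distance between the Galois orbits of v and w. *)
Definition del v w : R := dist_alg (ev v) w.

Lemma del_ge0 v w : 0 <= del v w.
Proof. exact/dist_alg_ge0/ev_pt. Qed.

Lemma del_le v w z : z \in conjs w -> del v w <= vabs (v - z).
Proof. by move=> /(dist_alg_le (ev v)); rewrite evX. Qed.

Lemma del_attained v w : exists2 z, z \in conjs w & del v w = vabs (v - z).
Proof.
by exists (nearest (ev v) w); rewrite ?nearest_conj// /del /dist_alg evX.
Qed.

Lemma del_self w : del w w = 0.
Proof.
apply/eqP; rewrite eq_le del_ge0 andbT.
by rewrite (le_trans (del_le _ (conjs_self w)))// subrr vabs0.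
Qed.

Lemma del_conjl v z w : z \in conjs v -> del z w = del v w.
Proof.
move=> zv; apply: (@Lam_inj w); rewrite ?del_ge0//.
by rewrite /del -!(spt_mpoly _ (ev_pt _)) /ev !disc_norm0 (conj_abs k_complete _ zv).
Qed.

Lemma dist_alg_max y v w : seminorm_pt y ->
  dist_alg y w <= Num.max (dist_alg y v) (del v w).
Proof.
move=> hy; rewrite -(del_conjl _ (nearest_conj y v)).
have [z zw ->] := del_attained (nearest y v) w.
by rewrite (le_trans (dist_alg_le _ zw))// (spt_dist_max hy).
Qed.

Lemma del_max y v w : seminorm_pt y ->
  del v w <= Num.max (dist_alg y v) (dist_alg y w).
Proof.
move=> hy; rewrite -(del_conjl _ (nearest_conj y v)).
by rewrite (le_trans (del_le _ (nearest_conj y w)))// (vabs_spt_max hy).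
Qed.

Lemma delC v w : del v w = del w v.
Proof.
have main a b : del a b <= del b a.
  have := del_max a b (ev_pt b); rewrite -!/(del _ _) del_self.
  by rewrite max_l// del_ge0.
by apply/eqP; rewrite eq_le !main.
Qed.

Definition lift x : berk K := get [set y : berk K | restr y = x].

Lemma liftK x : restr (lift x) = x.
Proof. by apply: (@getPex _ [set y : berk K | restr y = x]); exact: restr_surj. Qed.

Definition dst x w : R := dist_alg (alg_pt (lift x)) w.

Lemma dst_ge0 x w : 0 <= dst x w.
Proof. exact/dist_alg_ge0/alg_pt_seminorm. Qed.

Lemma mpoly_dst x w : poly_pt x (mpoly w) = Lam w (dst x w).
Proof.
by rewrite -(spt_mpoly _ (alg_pt_seminorm _)) -restr_poly liftK.
Qed.

(** The distance does not depend on the chosen lift: its image under the injective [Lam w] is the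
    value at a point of X of a polynomial over [k]. *)
Lemma dst_restr (y : berk K) w : dst (restr y) w = dist_alg (alg_pt y) w.
Proof.
have hy := alg_pt_seminorm y.
apply: (@Lam_inj w); rewrite ?dst_ge0 ?dist_alg_ge0//.
by rewrite -mpoly_dst -spt_mpoly// restr_poly.
Qed.

Lemma dst_max x v w : dst x w <= Num.max (dst x v) (del v w).
Proof. exact/dist_alg_max/alg_pt_seminorm. Qed.

Lemma del_dst_max x v w : del v w <= Num.max (dst x v) (dst x w).
Proof. exact/del_max/alg_pt_seminorm. Qed.

Lemma poly_factor_ind (P : {poly k} -> Prop) :
  (forall c, P c%:P) -> (forall w F, P F -> P (mpoly (w : La) * F)) -> forall F, P F.
Proof.
move=> Pc Pm F; have [n] := ubnP (size F); elim: n F => // n ih F.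
rewrite ltnS => Fn; have [sF|sF] := leqP (size F) 1.
  by rewrite (size1_polyC sF); exact: Pc.
have [w Fw] : exists w : ka C, root (F^e : {poly ka C}) w.
  by apply/closed_rootP; rewrite size_map_poly gtn_eqF.
have : mpoly (w : La) %| F by rewrite -horner_emb_eq0; exact/eqP/rootP.
move=> /dvdpP[G FG]; rewrite FG mulrC; apply: Pm; apply: ih.
apply: leq_trans Fn; rewrite FG size_Mmonic ?mpoly_monic//; last first.
  by apply: contraTneq sF => G0; rewrite FG G0 mul0r size_poly0.
by rewrite size_mpoly addnS /= -{1}[size G]addn0 ltn_add2l mdeg_gt0.
Qed.

(** A polynomial over [k] is a constant times a product of minimal polynomials, and each of these
    takes the value [Lam w] of the distance. *)
Lemma berk_le_dst x (z : berk k) : berk_le x z <-> forall w, dst x w <= dst z w.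
Proof.
split=> [xz w|h].
  by rewrite -(@Lam_le w) ?dst_ge0// -!mpoly_dst; exact: xz.
apply: berk_le_poly; apply: poly_factor_ind => [c|w F ih].
  by rewrite !(sptC (poly_pt_seminorm _)).
rewrite !(sptM (poly_pt_seminorm _)) ler_pM ?(spt_ge0 (poly_pt_seminorm _))//.
by rewrite !mpoly_dst Lam_le ?dst_ge0.
Qed.

Lemma disc_norm_toK w s (F : {poly La}) : disc_norm (toK C w) s F^K = disc_norm w s F.
Proof.
rewrite /disc_norm -(wnorm_map_toK s (F \Po _)) map_comp_poly rmorphD /=.
by rewrite map_polyX map_polyC.
Qed.

Lemma dst_le_max1 x w : dst x w <= Num.max 1 (vabs w).
Proof.
rewrite (le_trans (dist_alg_le _ (conjs_self w)))//.
rewrite (le_trans (sptB (alg_pt_seminorm _) _ _))//.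
by rewrite (sptC (alg_pt_seminorm _)) ge_max !le_max alg_ptX lexx orbT.
Qed.

Definition nice w s := vabs w <= 1 /\ 0 <= s <= 1.

(* The image in X of x_{w,s}. *)
Definition pt w s : berk k :=
  if pselect (nice w s) is left h then restr (disc_pt (w := toK C w) h.1 h.2)
  else gauss_pt k.

Lemma ptE w s (h : nice w s) : exists h1 h2,
  pt w s = restr (@disc_pt _ _ C (toK C w) s h1 h2).
Proof.
rewrite /pt; case: pselect => // h'.
by exists h'.1, h'.2.
Qed.

Lemma dst_pt w s v : nice w s -> dst (pt w s) v = Num.max s (del w v).
Proof.
move=> h; have s0 : 0 <= s by case: h => _ /andP[].
have [h1 [h2 ->]] := ptE h; rewrite dst_restr.
have E z : alg_pt (disc_pt h1 h2) ('X - z%:P) = Num.max s (vabs (w - z)).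
  by rewrite alg_disc_pt disc_norm_toK disc_normX_sub.
apply/eqP; rewrite eq_le; apply/andP; split.
  have [z zv ->] := del_attained w v.
  by rewrite (le_trans (dist_alg_le _ zv))// E.
rewrite /dist_alg E ge_max !le_max lexx /=; apply/orP; right.
exact/del_le/nearest_conj.
Qed.

Lemma gauss_ptE : gauss_pt k = pt 0 1.
Proof.
have n01 : nice 0 1 by split; rewrite ?vabs0 ?lexx ?ler01.
apply: berk_le_anti; last exact: seminorm_le_gauss.
have [h1 [h2 ->]] := ptE n01; apply: berk_le_poly => F.
rewrite restr_poly alg_disc_pt disc_norm_toK /poly_pt /= gauss_norm_ptate.
rewrite /disc_norm addr0 comp_polyXr /wnorm size_map_poly le_eqVlt.
apply/orP; left; apply/eqP; apply: eq_bigr => i _.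
by rewrite coef_map vabs_emb.
Qed.

Lemma nice_mono w s t : nice w s -> s <= t -> t <= 1 -> nice w t.
Proof. by move=> [w1 /andP[s0 s1]] st t1; split=> //; rewrite t1 (le_trans s0). Qed.

Lemma le_pt x w s : nice w s -> berk_le x (pt w s) <-> dst x w <= s.
Proof.
move=> h; have s0 : 0 <= s by case: h => _ /andP[].
split=> [/berk_le_dst/(_ w)|xw].
  by rewrite dst_pt// del_self max_l.
apply/berk_le_dst => v; rewrite dst_pt// (le_trans (dst_max x w v))//.
by rewrite ge_max !le_max xw lexx orbT.
Qed.

Lemma le_gauss x : berk_le x (gauss_pt k).
Proof. by move=> f; exact: seminorm_le_gauss. Qed.

Lemma dst_gauss w : vabs w <= 1 -> dst (gauss_pt k) w = 1.
Proof.
move=> w1; have n01 : nice 0 1 by split; rewrite ?vabs0 ?lexx ?ler01.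
rewrite gauss_ptE dst_pt// max_l// (le_trans (del_le _ (conjs_self w)))//.
by rewrite sub0r vabsN.
Qed.

Lemma dst_le1 x w : vabs w <= 1 -> dst x w <= 1.
Proof. by move=> w1; rewrite -(dst_gauss w1); apply: (berk_le_dst _ _).1; exact: le_gauss. Qed.

Lemma dst_big x w : 1 < vabs w -> dst x w = vabs w.
Proof.
move=> w1; have wz z : z \in conjs w -> vabs z = vabs w.
  by move=> /(conj_abs k_complete 'X); rewrite !map_polyX !hornerX.
have hy := alg_pt_seminorm (lift x).
apply/eqP; rewrite eq_le (le_trans (dst_le_max1 _ _)) ?ge_max ?lexx ?(ltW w1)//=.
rewrite -(wz _ (nearest_conj (alg_pt (lift x)) w)) -/(dst x w).
have := vabs_spt_max hy 0 (nearest (alg_pt (lift x)) w).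
rewrite sub0r vabsN subr0 => /le_trans -> //; rewrite ge_max lexx andbT.
have := vabs_spt_max hy 0 (nearest (alg_pt (lift x)) w).
rewrite sub0r vabsN subr0 (wz _ (nearest_conj _ w)) le_max => /orP[|]; last first.
  by apply: le_trans; rewrite (le_trans (alg_ptX _))// ltW.
by move=> /(lt_le_trans w1)/lt_le_trans/(_ (alg_ptX _)); rewrite ltxx.
Qed.

End Distance.

(** * Pointwise convergence and evaluation *)

Section BerkTopology.
Variables (R : realType) (k : valuedField R).

Lemma cvg_berk (G : set_system (berk k)) (x : berk k) : Filter G ->
  (forall f, (z : berk k) f @[z --> G] --> x f) -> G --> x.
Proof.
move=> FG h A /= [_ [ [U Uo <-] Ux] OA].
have hx : (fun z : berk k => (seminorm z : {ptws tate k -> R})) @ G -->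
    (seminorm x : {ptws tate k -> R}).
  apply/cvg_sup => f B /= [_ [ [D Do <-] Dx] DB].
  by apply: filterS DB _; apply: (h f); apply: open_nbhs_nbhs; split.
by apply: filterS OA _; apply: hx; apply: open_nbhs_nbhs; split.
Qed.

Lemma berk_eval_continuous (f : tate k) : continuous (fun x : berk k => x f).
Proof.
move=> x; apply: (@continuous_comp _ _ _
  (fun x : berk k => (seminorm x : {ptws tate k -> R})) (@proj (tate k) (fun=> R) f)).
  exact: (@initial_continuous _ _ (fun x : berk k => (seminorm x : {ptws tate k -> R}))).
exact: proj_continuous.
Qed.

Lemma nbhs_eval_lt (f : tate k) (x : berk k) (c : R) : x f < c ->
  \forall z \near x, (z : berk k) f < c.
Proof. by move=> xc; exact: (cvgr_lt _ (@berk_eval_continuous f x)). Qed.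

Lemma nbhs_eval_gt (f : tate k) (x : berk k) (c : R) : c < x f ->
  \forall z \near x, c < (z : berk k) f.
Proof. by move=> xc; exact: (cvgr_gt _ (@berk_eval_continuous f x)). Qed.

End BerkTopology.

(** * The tree structure *)

Section Tree.
Variables (R : realType) (k : valuedField R) (C : completedAlgClosure k).
Hypothesis k_complete : vf_complete k.

Local Notation La := (kav C).
Local Notation K := (Kf C).
Local Notation "p ^e" := (map_poly (emb C) p) (at level 2, format "p ^e").
Local Notation "F ^K" := (map_poly (@toK R k C) F) (at level 2, format "F ^K").
Local Notation dst := (@dst R k C).
Local Notation pt := (@pt R k C).
Implicit Types (v w : La) (s t : R) (x u : berk k).

(** It agrees with the [radius] of the statement by [radiusE]; in this form the ultrametric
    inequalities between distances apply directly. *)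
Definition rad x : R := inf (range (dst x)).

Let dst_has_inf x : has_inf (range (dst x)).
Proof. by split; [exists (dst x 0), 0|exists 0 => _ [w _ <-]; exact: dst_ge0]. Qed.

Lemma rad_le_dst x w : rad x <= dst x w.
Proof. by apply: ge_inf; [case: (dst_has_inf x)|exists w]. Qed.

Lemma rad_ge x s : (forall w, s <= dst x w) -> s <= rad x.
Proof.
by move=> h; apply: lb_le_inf; [case: (dst_has_inf x)|move=> _ [w _ <-]].
Qed.

Lemma rad_ge0 x : 0 <= rad x.
Proof. by apply: rad_ge => w; exact: dst_ge0. Qed.

Lemma rad_lt x s : rad x < s -> exists2 w, vabs w <= 1 & dst x w < s.
Proof.
move=> xs; have e0 : 0 < s - rad x by rewrite subr_gt0.
have [_ [w _ <-]] := inf_adherent e0 (dst_has_inf x); rewrite -/(rad x) addrC subrK => ws.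
have [w1|w1] := leP (vabs w) 1; first by exists w.
exists 0; first by rewrite vabs0.
rewrite (le_lt_trans _ ws)// (dst_big k_complete x w1) (le_trans _ (ltW w1))//.
by rewrite dst_le1// vabs0.
Qed.

Lemma rad_le1 x : rad x <= 1.
Proof. by rewrite (le_trans (rad_le_dst x 0))// dst_le1// vabs0. Qed.

Lemma rad_mono x u : berk_le x u -> rad x <= rad u.
Proof.
move=> xu; apply: rad_ge => w; rewrite (le_trans (rad_le_dst x w))//.
exact: (berk_le_dst C k_complete x u).1.
Qed.

Lemma rad_pt w s : nice w s -> rad (pt w s) = s.
Proof.
move=> h; have s0 : 0 <= s by case: h => _ /andP[].
apply/eqP; rewrite eq_le; apply/andP; split.
  by rewrite (le_trans (rad_le_dst _ w))// dst_pt// del_self max_l.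
by apply: rad_ge => v; rewrite dst_pt// le_max lexx.
Qed.

Lemma rad_gauss : rad (gauss_pt k) = 1.
Proof.
by rewrite (gauss_ptE C) rad_pt//; split; rewrite ?vabs0 ?lexx ?ler01.
Qed.

(** If u' were strictly closer than u to some [w], a centre [v] of u could be chosen closer to u
    than [w] is. Both [v] and [w] are then close to x, hence to each other, contradicting the
    distance from u to [w]. *)
Lemma chain_le x u u' : berk_le x u -> berk_le x u' -> rad u <= rad u' ->
  berk_le u u'.
Proof.
move=> /(berk_le_dst C k_complete) xu /(berk_le_dst C k_complete) xu' uu'.
apply/(berk_le_dst C k_complete) => w; rewrite leNgt; apply/negP => wlt.
have [v _ vu] : exists2 v, vabs v <= 1 & dst u v < dst u w.
  by apply: rad_lt; rewrite (le_lt_trans uu')// (le_lt_trans (rad_le_dst u' w)).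
have := dst_max k_complete u v w; apply/negP; rewrite -ltNge gt_max vu /=.
rewrite (le_lt_trans (del_dst_max k_complete x v w))// gt_max.
by rewrite (le_lt_trans (xu v) vu) (le_lt_trans (xu' w) wlt).
Qed.

Lemma chain_total x u u' : berk_le x u -> berk_le x u' ->
  berk_le u u' \/ berk_le u' u.
Proof.
by move=> xu xu'; have [/chain_le h|/ltW/chain_le h] := leP (rad u) (rad u');
  [left|right]; apply: h.
Qed.

Lemma rad_eq x u : berk_le x u -> rad x = rad u -> x = u.
Proof.
move=> xu r; apply: berk_le_anti => //; apply: (@chain_le x) => //.
by rewrite r.
Qed.

Lemma rad_lt_strict x u : berk_le x u -> x <> u -> rad x < rad u.
Proof.
by move=> xu n; rewrite lt_neqAle rad_mono// andbT; apply/eqP => /(rad_eq xu).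
Qed.

Lemma above_eq x u w : vabs w <= 1 -> berk_le x u -> dst x w <= rad u ->
  u = pt w (rad u).
Proof.
move=> w1 xu xw; have n : nice w (rad u) by split; rewrite ?rad_ge0 ?rad_le1.
have xp : berk_le x (pt w (rad u)) by apply/le_pt.
by apply: rad_eq; rewrite ?rad_pt//; apply: (@chain_le x); rewrite ?rad_pt.
Qed.

Lemma above_nice x u : berk_le x u -> x <> u ->
  exists2 w, vabs w <= 1 & dst x w < rad u /\ u = pt w (rad u).
Proof.
move=> xu n; have [w w1 xw] := rad_lt (rad_lt_strict xu n).
by exists w => //; split=> //; apply: (@above_eq x) => //; exact: ltW.
Qed.

Lemma dst_above x u w : berk_le x u -> dst u w <= Num.max (rad u) (dst x w).
Proof.
move=> xu; have [<-|n] := pselect (x = u); first by rewrite le_max lexx orbT.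
have [v v1 [xv uE]] := above_nice xu n.
have nv : nice v (rad u) by split; rewrite ?rad_ge0 ?rad_le1.
rewrite {1}uE dst_pt// ge_max le_max lexx /=.
rewrite (le_trans (del_dst_max k_complete x v w))// ge_max !le_max (ltW xv).
by rewrite lexx orbT.
Qed.

Lemma pt_eq v w s : nice v s -> nice w s -> del v w <= s -> pt v s = pt w s.
Proof.
move=> nv nw vw; have s0 : 0 <= s by case: nv => _ /andP[].
by apply: rad_eq; rewrite ?rad_pt//; apply/le_pt => //; rewrite dst_pt// ge_max lexx.
Qed.

Lemma pt_le v w s t : nice v s -> nice w t ->
  berk_le (pt v s) (pt w t) <-> s <= t /\ del v w <= t.
Proof.
move=> nv nw; rewrite (le_pt k_complete)// dst_pt// ge_max.
by split=> [/andP[]|[-> ->]].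
Qed.

End Tree.

(** * Agreement with the radius function *)

Section Radius.
Variables (R : realType) (k : valuedField R) (C : completedAlgClosure k).
Hypothesis k_complete : vf_complete k.

Local Notation La := (kav C).
Local Notation K := (Kf C).
Local Notation "p ^e" := (map_poly (emb C) p) (at level 2, format "p ^e").
Local Notation "F ^K" := (map_poly (@toK R k C) F) (at level 2, format "F ^K").
Implicit Types (v w : La) (x u : berk k) (y : berk K).

Lemma alg_le y y' :
  (forall a : La, alg_pt y ('X - a%:P) <= alg_pt y' ('X - a%:P)) -> berk_le y y'.
Proof.
move=> h; have [hy hy'] := (alg_pt_seminorm y, alg_pt_seminorm y').
apply: berk_le_alg => F.
have [r ->] := closed_field_poly_normal (F : {poly ka C}).
rewrite -mul_polyC !(sptM hy, sptM hy') (sptC hy) (sptC hy') ler_wpM2l ?vabs_ge0//.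
rewrite (spt_prod hy) (spt_prod hy'); apply: ler_prod => a _.
by rewrite (spt_ge0 hy) h.
Qed.

Lemma alg_cvg (G : set_system (berk K)) y : Filter G ->
  (forall a : La, alg_pt z ('X - a%:P) @[z --> G] --> alg_pt y ('X - a%:P)) ->
  G --> y.
Proof.
move=> FG h.
have hF F : alg_pt z F @[z --> G] --> alg_pt y F.
  have [r ->] := closed_field_poly_normal (F : {poly ka C}).
  rewrite (_ : (fun z => _) = fun z : berk K => vabs (lead_coef F) *
     \prod_(a <- r) alg_pt z ('X - a%:P)); last first.
    apply/funext => z; have hz := alg_pt_seminorm z.
    by rewrite -mul_polyC (sptM hz) (sptC hz) (spt_prod hz).
  have hy := alg_pt_seminorm y.
  rewrite -mul_polyC (sptM hy) (sptC hy) (spt_prod hy).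
  apply: cvgMr; elim: r => [|a r ih].
    by under eq_fun do rewrite big_nil; rewrite big_nil; exact: cvg_cst.
  under eq_fun do rewrite big_cons; rewrite big_cons.
  exact: cvgM.
apply: cvg_berk => f; apply/cvgrPdist_lt => e e0.
have e3 : 0 < e / 3 by rewrite divr_gt0.
have [F fF] := tate_approx_alg f e3.
have /cvgrPdist_lt/(_ _ e3) := hF F; apply: filterS => z hz.
have h1 := le_trans (berk_dist y f _) fF.
have h2 := le_trans (berk_dist z f _) fF.
rewrite distrC in h2.
apply: (le_lt_trans (ler_distD (alg_pt y F) _ _)).
have h3 := ler_distD (alg_pt z F) (alg_pt y F) (z f).
have -> : e = e / 3 + (e / 3 + e / 3) by field.
by rewrite ler_ltD// (le_lt_trans h3)// ltr_leD.
Qed.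

Lemma rad_restr_le y w : rad C (restr y) <= alg_pt y ('X - w%:P).
Proof.
rewrite (le_trans (rad_le_dst _ w))// dst_restr//.
exact/dist_alg_le/conjs_self.
Qed.

Lemma rad_restr_ge y s : (forall w, s <= alg_pt y ('X - w%:P)) -> s <= rad C (restr y).
Proof. by move=> h; apply: rad_ge => w; rewrite (dst_restr k_complete); exact: h. Qed.

Lemma rad_restr_lt y s : rad C (restr y) < s ->
  exists2 w, vabs w <= 1 & alg_pt y ('X - w%:P) < s.
Proof.
move=> /(rad_lt k_complete)[w w1]; rewrite dst_restr// => ws.
exists (nearest (alg_pt y) w) => //.
have := conj_abs k_complete 'X (nearest_conj (alg_pt y) w).
by rewrite !map_polyX !hornerX => ->.
Qed.

Lemma alg_disc_ptX (w : K) (s : R) h1 h2 (a : La) :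
  alg_pt (@disc_pt R k C w s h1 h2) ('X - a%:P) = Num.max s (vabs (w - toK C a)).
Proof.
rewrite alg_disc_pt rmorphB /= map_polyX map_polyC disc_normX_sub//.
by case/andP: h2.
Qed.

(** Centres lie in [K] here; density provides algebraic centres at the same distance up to e, on
    which [rad] can be tested. *)
Lemma radius_unique y rho : is_radius_K y rho -> rho = rad C (restr y).
Proof.
move=> [[w [w1 rho01 /(is_disc_ptP w1 rho01) yE]]|].
  apply/eqP; rewrite eq_le; apply/andP; split.
    by apply: rad_restr_ge => v; rewrite yE alg_disc_ptX le_max lexx.
  apply/ler_addgt0Pr => e e0; have [v wv] := toK_dense w e0.
  rewrite (le_trans (rad_restr_le y v))// yE alg_disc_ptX ge_max lerDl ltW//=.
  by rewrite (le_trans (ltW wv))// lerDr; case/andP: (rho01).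
move=> [w [s [u [hu nest _ uy srho]]]].
have s_dec i j : (i <= j)%N -> s j <= s i.
  move=> /subnK <-; elim: (j - i)%N => // n; apply: le_trans.
  by rewrite addSn; case: (nest (n + i)%N).
have rho_le i : rho <= s i.
  move/cvgrPdist_lt : srho => h; rewrite leNgt; apply/negP => lt.
  have e0 : 0 < rho - s i by rewrite subr_gt0.
  have [N _ hN] := h _ e0.
  have := hN (maxn N i) (leq_maxl _ _); rewrite /= ltNge => /negP; apply.
  rewrite (le_trans _ (ler_norm _))// lerD2l lerN2.
  by apply: s_dec; rewrite leq_maxr.
have wij i j : (i <= j)%N -> vabs (w j - w i) <= s i.
  move=> /subnK <-; elim: (j - i)%N => [|n ih].
    by rewrite add0n subrr vabs0; case: (hu i) => _ /andP[].
  rewrite addSn (le_trans (vabs_dist_max (w (n + i)%N) _ _))// ge_max ih andbT.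
  case: (nest (n + i)%N) => + _; move/le_trans; apply; apply: s_dec.
  by rewrite leq_addl.
have Du i v : alg_pt (u i) ('X - v%:P) = Num.max (s i) (vabs (w i - toK C v)).
  case: (hu i) => w1 s01 /(is_disc_ptP w1 s01) ->; exact: alg_disc_ptX.
have Dcv v : alg_pt (u n) ('X - v%:P) @[n --> \oo] --> alg_pt y ('X - v%:P).
  exact: (continuous_cvg _ (@berk_eval_continuous R K (ptate ('X - v%:P)^K) y)).
apply/eqP; rewrite eq_le; apply/andP; split.
  apply: rad_restr_ge => v; apply: (cvgr_to_ge (Dcv v)).
  by apply: nearW => n; rewrite Du le_max rho_le.
apply/ler_addgt0Pr => e e0.
have [N _ hN] := (cvgrPdist_lt _ _).1 srho e e0.
have sN : s N <= rho + e.
  have := hN N (leqnn N); rewrite /= distrC => /(le_lt_trans (ler_norm _)).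
  by rewrite ltrBlDl => /ltW.
have [v wv] := toK_dense (w N) e0.
rewrite (le_trans (rad_restr_le y v))//; apply: (cvgr_to_le (Dcv v)).
exists N => // n /= Nn; rewrite Du ge_max (le_trans (s_dec _ _ Nn) sN) /=.
rewrite (le_trans (vabs_dist_max (w N) _ _))// ge_max.
rewrite (le_trans (wij _ _ Nn) sN) (le_trans (ltW wv))// lerDr.
apply: (cvgr_to_ge srho); apply: nearW => i.
by case: (hu i) => _ /andP[].
Qed.

Lemma inv_nat_small (d : R) : 0 < d -> exists N, forall n, (N <= n)%N -> n.+1%:R^-1 < d.
Proof.
move=> d0; exists (Num.bound d^-1) => n Nn.
rewrite invf_plt ?posrE ?ltr0n//.
apply: lt_le_trans (archi_boundP _) _; first by rewrite invr_ge0 ltW.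
by rewrite ler_nat (leq_trans Nn).
Qed.

(** Algebraic centres that almost realise the infimum give a decreasing sequence of discs around
    [y]. Whether these discs have a common point in [K] decides between the two clauses. *)
Lemma radius_exists y : is_radius_K y (rad C (restr y)).
Proof.
set rho := rad C (restr y).
have hy := alg_pt_seminorm y; have hp := poly_pt_seminorm y.
have [rho0 rho1] : 0 <= rho /\ rho <= 1 by split; [exact: rad_ge0|exact: rad_le1].
(* The cap at 1 keeps every disc of the sequence inside the unit disc. *)
pose s (n : nat) : R := Num.min 1 (rho + n.+1%:R^-1).
have rho_s n : rho <= s n by rewrite le_min rho1 lerDl invr_ge0 ler0n.
have s1 n : s n <= 1 by rewrite ge_min lexx.
have s0 n : 0 <= s n by rewrite (le_trans rho0).
have s_dec n : s n.+1 <= s n.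
  rewrite /s le_min ge_min lexx /= ge_min lerD2l lef_pV2 ?posrE ?ltr0n//.
  by rewrite ler_nat leqnSn orbT.
have /choice[w hw] : forall n, exists w : La,
    vabs w <= 1 /\ alg_pt y ('X - w%:P) <= s n.
  move=> n; have [w w1 wy] : exists2 w, vabs w <= 1 &
      alg_pt y ('X - (w : La)%:P) < rho + n.+1%:R^-1.
    by apply: rad_restr_lt; rewrite ltrDl invr_gt0 ltr0n.
  exists w; split=> //; rewrite le_min (ltW wy) andbT.
  rewrite (le_trans (sptB hy _ _))// (sptC hy) ge_max w1 andbT.
  exact: alg_ptX.
have wK1 n : vabs (toK C (w n)) <= 1 by rewrite vabs_toK; case: (hw n).
have sn01 n : 0 <= s n <= 1 by rewrite s0 s1.
have ww m n : (m <= n)%N -> vabs (w n - w m) <= s m.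
  move=> mn; rewrite vabs_distC (le_trans (vabs_spt_max hy _ _))// ge_max.
  case: (hw m) => _ -> /=; case: (hw n) => _ /le_trans; apply.
  move: mn => /subnK <-; elim: (n - m)%N => // i; apply: le_trans.
  by rewrite addSn s_dec.
have s_cvg : s n @[n --> \oo] --> rho.
  apply/cvgrPdist_lt => e e0; have [N hN] := inv_nat_small e0.
  exists N => // n /= /hN h; rewrite distrC ger0_norm ?subr_ge0//.
  rewrite ltrBlDl (le_lt_trans (_ : _ <= rho + n.+1%:R^-1)) ?ltrD2l//.
  by rewrite ge_min lexx orbT.
have [[z hz]|nz] := pselect (exists z : K, forall i, vabs (z - toK C (w i)) <= s i).
  left; exists z.
  have z1 : vabs z <= 1.
    rewrite -(subrK (toK C (w 0%N)) z) (le_trans (vabsD_max _ _))// ge_max wK1 andbT.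
    exact: le_trans (hz 0%N) (s1 0%N).
  have rho01 : 0 <= rho <= 1 by rewrite rho0.
  split=> //; apply/(is_disc_ptP z1 rho01).
  have yz : poly_pt y ('X - z%:P) <= rho.
    apply: (cvgr_to_ge s_cvg); apply: nearW => n.
    rewrite (le_trans (spt_dist_max hp (toK C (w n)) z))// ge_max.
    rewrite vabs_distC hz andbT; case: (hw n) => _.
    by rewrite /alg_pt rmorphB /= map_polyX map_polyC.
  apply: berk_le_anti; first by apply: le_disc_pt; rewrite -ptate_XsubC.
  apply: alg_le => a; rewrite alg_disc_ptX ge_max rad_restr_le /=.
  rewrite (le_trans (vabs_spt_max hp _ _))// ge_max (le_trans yz) ?rad_restr_le//=.
  by rewrite /alg_pt rmorphB /= map_polyX map_polyC.
right; exists (fun n => toK C (w n)), s, (fun n => disc_pt (wK1 n) (sn01 n)); split => //.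
- by move=> i; split=> //; apply/(is_disc_ptP (wK1 i) (sn01 i)).
- by move=> i; split=> //; rewrite -rmorphB vabs_toK ww.
- apply: alg_cvg => a.
  change ((fun n => alg_pt (disc_pt (wK1 n) (sn01 n)) ('X - a%:P)) @ \oo --> alg_pt y ('X - a%:P)).
  under eq_fun do rewrite alg_disc_ptX -rmorphB vabs_toK.
  have ge n : alg_pt y ('X - a%:P) <= Num.max (s n) (vabs (w n - a)).
    rewrite (le_trans (spt_dist_max hy (w n) a))// ge_max !le_max lexx orbT andbT.
    by case: (hw n) => _ ->.
  have le n : Num.max (s n) (vabs (w n - a)) <= alg_pt y ('X - a%:P) + (s n - rho).
    have ya : rho <= alg_pt y ('X - a%:P) := rad_restr_le y a.
    rewrite ge_max; apply/andP; split; first by lra.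
    rewrite (le_trans (vabs_spt_max hy (w n) a))// ge_max lerDl subr_ge0 rho_s andbT.
    by case: (hw n) => _ /le_trans; apply; lra.
  apply: (@squeeze_cvgr _ _ _ _ (fun=> alg_pt y ('X - a%:P))
     (fun n => alg_pt y ('X - a%:P) + (s n - rho))).
  + by apply: nearW => n; rewrite ge le.
  + exact: cvg_cst.
  + rewrite -[X in _ --> X]addr0; apply: cvgD; first exact: cvg_cst.
    by rewrite -[0](subrr rho); apply: cvgB => //; exact: cvg_cst.
Qed.

Lemma radiusE x : Defs.radius C x = rad C x.
Proof.
have [y yx] := restr_surj C x k_complete.
rewrite /Defs.radius; set A := [set rho | _].
have : A (get A).
  by apply: (@getPex _ A); exists (rad C x), y; split=> //; rewrite -yx; exact: radius_exists.
by move=> [y' [y'x /radius_unique ->]]; rewrite y'x.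
Qed.

End Radius.

Lemma size_classes (T U : eqType) (f : T -> U) (r : seq T) n :
  (forall z, z \in r -> count (fun z' => f z' == f z) r = n) ->
  size r = (size (undup (map f r)) * n)%N.
Proof.
move=> h.
have cover (s : seq U) (r' : seq T) : uniq s -> (forall z, z \in r' -> f z \in s) ->
    (\sum_(y <- s) count (fun z => f z == y) r')%N = size r'.
  move=> us; elim: r' => [|a r' ih] hs; first by rewrite big1.
  rewrite /= big_split /= ih; last by move=> z zr; apply: hs; rewrite inE zr orbT.
  have fas : f a \in s by apply: hs; rewrite mem_head.
  rewrite -add1n; congr (_ + _)%N.
  have := count_uniq_mem (f a) us; rewrite fas /= => <-.
  rewrite -sum1_count [RHS]big_mkcond /=; apply: eq_bigr => y _.
  by rewrite eq_sym; case: eqP.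
rewrite -{1}(cover (undup (map f r)) r) ?undup_uniq//; last first.
  by move=> z zr; rewrite mem_undup map_f.
rewrite big_seq (eq_bigr (fun=> n)) => [|y]; last first.
  by rewrite mem_undup => /mapP[z zr ->]; exact: h.
by rewrite -big_seq big_const_seq count_predT iter_addn_0 mulnC.
Qed.

(** * Counting through products of truncated distances *)

Section MaxProducts.
Variable R : realType.
Implicit Types (A B : seq R) (u v s t : R).

Lemma prod_max_scale A u v : 0 < u -> u <= v ->
  (forall a, a \in A -> a <= u \/ v <= a) ->
  \prod_(a <- A) Num.max v a =
  (v / u) ^+ count (fun a => a <= u) A * \prod_(a <- A) Num.max u a.
Proof.
move=> u0 uv; elim: A => [|a A ih] h; first by rewrite !big_nil mulr1.
rewrite !big_cons ih => [|b bA]; last by apply: h; rewrite inE bA orbT.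
have [au|va] := h a (mem_head _ _).
  rewrite /= au add1n exprS max_l ?(le_trans au)// max_l//.
  by field; rewrite gt_eqF.
rewrite /= max_r// [Num.max u a]max_r ?(le_trans uv)//.
have [au|_] := leP a u; last by rewrite add0n mulrCA.
have -> : a = v by apply/eqP; rewrite eq_le va (le_trans au).
have -> : v = u by apply/eqP; rewrite eq_le uv (le_trans va).
by rewrite divff ?gt_eqF// !expr1n !mul1r.
Qed.

Lemma gap_above A u v : u < v ->
  exists t, [/\ u < t, t <= v & forall a, a \in A -> a <= u \/ t <= a].
Proof.
move=> uv; elim: A => [|a A [t [ut tv h]]]; first by exists v.
have [au|ua] := leP a u.
  by exists t; split=> // b; rewrite inE => /predU1P[->|/h//]; left.
exists (Num.min t a); split; first by rewrite lt_min ut ua.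
  by rewrite ge_min tv.
move=> b; rewrite inE => /predU1P[->|/h[|tb]]; first by right; rewrite ge_min lexx orbT.
  by left.
by right; rewrite ge_min tb.
Qed.

(** The growth exponent of the product immediately to the right of [s] is the number of entries that
    are at most [s]. *)
Lemma count_of_prod A B s : 0 < s ->
  (forall t, 0 <= t -> \prod_(a <- A) Num.max t a = \prod_(a <- B) Num.max t a) ->
  count (fun a => a <= s) A = count (fun a => a <= s) B.
Proof.
move=> s0 h; have [t [st _ hAB]] := gap_above (A ++ B) (ltr_pwDr ltr01 (lexx s)).
have t0 : 0 < t := lt_trans s0 st.
have E : (t / s) ^+ count (fun a => a <= s) A = (t / s) ^+ count (fun a => a <= s) B.
  have := h t (ltW t0).
  rewrite !(prod_max_scale s0 (ltW st)); last 2 first.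
  - by move=> a aB; apply: hAB; rewrite mem_cat aB orbT.
  - by move=> a aA; apply: hAB; rewrite mem_cat aA.
  rewrite (h s (ltW s0)); apply: mulIf; rewrite gt_eqF//.
  by apply: prodr_gt0 => a _; rewrite lt_max s0.
apply: (@ieexprIn R (t / s)) => //; first by rewrite divr_gt0.
by rewrite gt_eqF// ltr_pdivlMr// mul1r.
Qed.

End MaxProducts.

(** * Multiplicity and metric *)

Section Multiplicity.
Variables (R : realType) (k : valuedField R) (C : completedAlgClosure k).
Hypothesis k_complete : vf_complete k.

Local Notation La := (kav C).
Local Notation K := (Kf C).
Local Notation "p ^e" := (map_poly (emb C) p) (at level 2, format "p ^e").
Local Notation dst := (@dst R k C).
Local Notation pt := (@pt R k C).
Local Notation rad := (rad C).
Implicit Types (v w z : La) (s t : R) (x u : berk k) (y : berk K).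

Definition nu w s := count (fun z => vabs (w - z) <= s) (conjs w).

Lemma nu_gt0 w s : 0 <= s -> (0 < nu w s)%N.
Proof.
move=> s0; rewrite -has_count; apply/hasP; exists w; first exact: conjs_self.
by rewrite subrr vabs0.
Qed.

(** By [conj_disc_norm] the products of max(t, |z - z'|) over the conjugates z' are the same for [z]
    and [w] at every t, and these products determine the counts. *)
Lemma nu_conj w z s : 0 < s -> z \in conjs w ->
  count (fun z' => vabs (z - z') <= s) (conjs w) = nu w s.
Proof.
move=> s0 zw.
have := @count_of_prod R [seq vabs (z - z') | z' <- conjs w]
  [seq vabs (w - z') | z' <- conjs w] s s0.
rewrite !count_map; apply => t t0; rewrite !big_map.
have E v : \prod_(z' <- conjs w) Num.max t (vabs (v - z')) = disc_norm v t (mpoly w)^e.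
  rewrite mpoly_prod (spt_prod (disc_norm_pt v t0)).
  by apply: eq_bigr => z' _; rewrite disc_normX_sub.
by rewrite !E (conj_disc_norm k_complete _ _ zw).
Qed.

Lemma vabs_conj w z : z \in conjs w -> vabs z = vabs w.
Proof. by move=> /(conj_abs k_complete 'X); rewrite !map_polyX !hornerX. Qed.

Lemma nice_conj w z s : z \in conjs w -> nice w s -> nice z s.
Proof. by move=> /vabs_conj zw [w1 s01]; split=> //; rewrite zw. Qed.

Lemma pt_conj w z s : nice w s -> z \in conjs w -> pt z s = pt w s.
Proof.
move=> n zw; apply: (pt_eq k_complete) => //; first exact: nice_conj n.
by rewrite (del_conjl k_complete _ zw) del_self; case: n => _ /andP[].
Qed.

Definition ptK z s : berk K :=
  if pselect (nice z s) is left h then disc_pt (w := toK C z) h.1 h.2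
  else gauss_pt K.

Lemma ptKE z s (h : nice z s) : exists h1 h2, ptK z s = @disc_pt _ _ C (toK C z) s h1 h2.
Proof.
rewrite /ptK; case: pselect => // h'.
by exists h'.1, h'.2.
Qed.

Lemma restr_ptK z s : nice z s -> restr (ptK z s) = pt z s.
Proof. by move=> h; rewrite /ptK /pt; case: pselect. Qed.

Lemma alg_ptK z s a : nice z s -> alg_pt (ptK z s) ('X - a%:P) = Num.max s (vabs (z - a)).
Proof.
by move=> /ptKE[h1 [h2 ->]]; rewrite alg_disc_ptX -rmorphB vabs_toK.
Qed.

Lemma ptK_eq z z' s : nice z s -> nice z' s ->
  (ptK z s == ptK z' s) = (vabs (z - z') <= s).
Proof.
move=> n n'; have s0 : 0 <= s by case: n => _ /andP[].
apply/eqP/idP => [E|zz].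
  have := congr1 (fun y => alg_pt y ('X - z'%:P)) E.
  rewrite !alg_ptK// subrr vabs0 [RHS]max_l// => <-.
  by rewrite le_max lexx orbT.
apply: berk_le_anti; apply: alg_le => a; rewrite !alg_ptK// ge_max le_max lexx /=.
  rewrite (le_trans (vabs_dist_max z' _ _))// ge_max !le_max zz lexx orbT andbT.
  by rewrite orTb.
rewrite (le_trans (vabs_dist_max z _ _))// ge_max !le_max vabs_distC zz lexx orbT.
by rewrite orTb.
Qed.

(** A point of the fibre attains its distance to the orbit at some conjugate z. This distance equals
    [s], its radius, which forces the point to be x_{z,s}. *)
Lemma fiber_pt w s : nice w s ->
  (@restr R k C) @^-1` [set pt w s] = [set` [seq ptK z s | z <- conjs w]].
Proof.
move=> n; have s0 : 0 <= s by case: n => _ /andP[].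
apply/seteqP; split => y /=; last first.
  move=> /mapP[z zw ->]; have nz := nice_conj zw n.
  by rewrite restr_ptK// (pt_conj n zw).
move=> yE; apply/mapP; have hy := alg_pt_seminorm y.
pose z := nearest (alg_pt y) w; have zw : z \in conjs w := nearest_conj _ _.
have nz := nice_conj zw n.
exists z => //.
have yz : alg_pt y ('X - z%:P) = s.
  have := dst_restr k_complete y w; rewrite yE dst_pt// del_self max_l//.
have rs : s = rad (restr y) by rewrite yE rad_pt.
apply: berk_le_anti; apply: alg_le => a; rewrite alg_ptK//.
  by rewrite (le_trans (spt_dist_max hy z a))// yz.
rewrite ge_max {1}rs rad_restr_le//= (le_trans (vabs_spt_max hy z a))// ge_max lexx.
by rewrite yz rs rad_restr_le.
Qed.

Definition mult x : nat := #|` fset_set ((@restr R k C) @^-1` [set x])|.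

Lemma fiber_fset w s : nice w s ->
  (@restr R k C) @^-1` [set pt w s] =
  [set` [fset y in [seq ptK z s | z <- conjs w]]%fset].
Proof.
by move=> /fiber_pt ->; apply/seteqP; split => y /=; rewrite !inE.
Qed.

Lemma mult_undup w s : nice w s -> mult (pt w s) = size (undup [seq ptK z s | z <- conjs w]).
Proof. by move=> n; rewrite /mult fiber_fset// set_fsetK card_fseq. Qed.

Lemma multiplicity_pt w s : nice w s ->
  multiplicity C (pt w s) = (mult (pt w s))%:R%:E.
Proof.
move=> n; rewrite /multiplicity /mult; case: asboolP => // h; exfalso; apply: h.
by rewrite fiber_fset//; exact: finite_fset.
Qed.

Lemma count_ptK w z s : 0 < s -> nice w s -> z \in conjs w ->
  count (fun z' => ptK z' s == ptK z s) (conjs w) = nu w s.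
Proof.
move=> s0 n zw; rewrite -(nu_conj s0 zw); apply: eq_in_count => z' z'w.
by rewrite (ptK_eq (nice_conj z'w n) (nice_conj zw n)) vabs_distC.
Qed.

(** The conjugates of [w] are spread evenly over the discs of the fibre. *)
Lemma mdeg_mult w s : 0 < s -> nice w s -> mdeg w = (mult (pt w s) * nu w s)%N.
Proof.
move=> s0 n; rewrite -size_conjs mult_undup//; apply: size_classes => z zw.
exact: count_ptK.
Qed.

Lemma mult_gt0 w s : 0 < s -> nice w s -> (0 < mult (pt w s))%N.
Proof.
move=> s0 n; have := mdeg_gt0 w; rewrite (mdeg_mult s0 n).
by rewrite muln_gt0 => /andP[].
Qed.

(** A disc of radius [t] splits into discs of radius [s]; those meeting the orbit contain equally
    many conjugates. *)
Lemma nu_dvd w s t : 0 < s -> s <= t -> nice w t -> (nu w s %| nu w t)%N.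
Proof.
move=> s0 st n; have t0 : 0 < t := lt_le_trans s0 st.
have ns : nice w s by case: n => w1 /andP[_ t1]; split=> //; rewrite (ltW s0) (le_trans st).
pose r := [seq z <- conjs w | vabs (w - z) <= t].
have -> : nu w t = size r by rewrite size_filter.
rewrite (@size_classes _ _ (fun z => ptK z s) r (nu w s)) ?dvdn_mull// => z.
rewrite mem_filter => /andP[wz zw]; rewrite count_filter -(count_ptK s0 ns zw).
apply: eq_in_count => z' z'w /=; have [E|//] := boolP (ptK z' s == ptK z s).
move: E; rewrite (ptK_eq (nice_conj z'w ns) (nice_conj zw ns)) => z'z.
by rewrite (le_trans (vabs_dist_max z _ _))// ge_max wz vabs_distC (le_trans z'z).
Qed.

Lemma mult_dvd w s t : 0 < s -> s <= t -> nice w t ->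
  (mult (pt w t) %| mult (pt w s))%N.
Proof.
move=> s0 st n; have t0 : 0 < t := lt_le_trans s0 st.
have ns : nice w s by case: n => w1 /andP[_ t1]; split=> //; rewrite (ltW s0) (le_trans st).
have /dvdnP[c cE] := nu_dvd s0 st n.
have := mdeg_mult s0 ns; rewrite (mdeg_mult t0 n) cE mulnA => /eqP.
rewrite eqn_pmul2r ?nu_gt0 ?ltW// => /eqP <-.
by rewrite dvdn_mulr.
Qed.

End Multiplicity.

Lemma le_ln_max (R : realType) (t s a : R) : 0 < s -> s <= expR (- t) ->
  (t <= - ln (Num.max s a)) = (a <= expR (- t)).
Proof.
move=> s0 es; have m0 : 0 < Num.max s a by rewrite lt_max s0.
by rewrite lerNr -[LHS]ler_expR; rewrite lnK ?posrE// ge_max es.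
Qed.

(** * A formula for alpha *)

Section Alpha.
Variables (R : realType) (k : valuedField R) (C : completedAlgClosure k).
Hypothesis k_complete : vf_complete k.

Local Notation La := (kav C).
Local Notation K := (Kf C).
Local Notation dst := (@dst R k C).
Local Notation pt := (@pt R k C).
Local Notation rad := (rad C).
Implicit Types (v w z : La) (s t : R) (x u : berk k).

Lemma A_XE x : A_X C x = if rad x == 0 then +oo%E else (- ln (rad x))%:E.
Proof.
rewrite /A_X radiusE// /lne; have := rad_ge0 C x; rewrite le_eqVlt => /predU1P[<-|r0].
  by rewrite lexx eqxx.
by rewrite leNgt r0 gt_eqF.
Qed.

Lemma A_X_pt w s : nice w s -> 0 < s -> A_X C (pt w s) = (- ln s)%:E.
Proof. by move=> n s0; rewrite A_XE rad_pt// gt_eqF. Qed.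

Lemma segment_gauss x u : segment x (gauss_pt k) u <-> berk_le x u.
Proof.
have -> : segment x (gauss_pt k) u <-> berk_le u (berk_join x (gauss_pt k)) /\
    (berk_le x u \/ berk_le (gauss_pt k) u) by [].
have -> : berk_join x (gauss_pt k) = gauss_pt k.
  set A := [set z : berk k | [/\ berk_le x z, berk_le (gauss_pt k) z &
    forall u', berk_le x u' -> berk_le (gauss_pt k) u' -> berk_le z u']].
  have [_ h _] : A (berk_join x (gauss_pt k)).
    apply: (@getPex _ A); exists (gauss_pt k); split=> //.
    exact: le_gauss.
  by apply: berk_le_anti => //; exact: le_gauss.
split=> [[_ [//|gu]]|xu].
  by apply: berk_le_trans gu; exact: le_gauss.
by split; [exact: le_gauss|left].
Qed.

Lemma segment_ptE w s t : nice w s -> 0 < s -> 0 <= t -> t <= - ln s ->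
  segment_pt C (pt w s) t = pt w (expR (- t)).
Proof.
move=> n s0 t0 ts.
have [w1 _] := n.
have es : s <= expR (- t) by rewrite -[s]lnK ?posrE// ler_expR lerNr.
have e1 : expR (- t) <= 1 by rewrite -expR0 ler_expR oppr_le0.
have ne : nice w (expR (- t)) by exact: nice_mono n es e1.
rewrite /segment_pt; set A := [set u : berk k | _].
have [/segment_gauss xu Au] : A (get A).
  apply: (@getPex _ A); exists (pt w (expR (- t))); split.
    by apply/segment_gauss/pt_le => //; rewrite del_self expR_ge0.
  by rewrite A_X_pt ?expR_gt0// expRK opprK.
have r : rad (get A) = expR (- t).
  move: Au; rewrite A_XE; case: eqP => // /eqP r0 [<-].
  by rewrite opprK lnK// posrE lt_def r0 rad_ge0.
rewrite -r; apply: (above_eq k_complete w1 xu).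
by rewrite dst_pt// del_self r ge_max es expR_ge0.
Qed.

(** At radius e^{-t} the integrand 1 / m is the proportion of conjugates z with |w - z| <= e^{-t}, a
    mean of indicators of the intervals [[0, l z]]. Integrating, the lengths [l z] add up to the
    logarithm of a product. *)
Lemma alpha_pt w s : nice w s -> 0 < s ->
  alpha C (pt w s) = (- (ln (Lam w s) / (mdeg w)%:R))%:E.
Proof.
move=> n s0; have [w1 /andP[_ s1]] := n.
pose l z := - ln (Num.max s (vabs (w - z))).
have D : [set t : R | 0 <= t /\ (t%:E <= A_X C (pt w s))%E] = `[0, - ln s]%classic.
  by apply/seteqP; split=> t /=; rewrite A_X_pt// lee_fin in_itv /= => /andP.
rewrite /alpha D.
pose f z (t : R) := (((mdeg w)%:R^-1)%:E * (\1_(`[0, l z]%classic) t)%:E : \bar R)%E.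
have d0 : 0 < (mdeg w)%:R :> R by rewrite ltr0n mdeg_gt0.
have wz z : z \in conjs w -> vabs (w - z) <= 1.
  move=> zw; rewrite (le_trans (vabsB_max _ _))// ge_max w1.
  by rewrite (vabs_conj k_complete zw).
transitivity (\int[lebesgue_measure]_(t in `[0%R, (- ln s)%R])
    (\sum_(z <- conjs w) f z t))%E.
  apply: eq_integral => t /set_mem; rewrite /= in_itv /= => /andP[t0 ts].
  rewrite segment_ptE//.
  have es : s <= expR (- t) by rewrite -[s]lnK ?posrE// ler_expR lerNr.
  have e1 : expR (- t) <= 1 by rewrite -expR0 ler_expR oppr_le0.
  have ne : nice w (expR (- t)) by exact: nice_mono n es e1.
  have m0 := mult_gt0 k_complete (expR_gt0 (- t)) ne.
  rewrite multiplicity_pt// inver pnatr_eq0 gtn_eqF//.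
  have -> : ((mult C (pt w (expR (- t))))%:R)^-1 = (nu w (expR (- t)))%:R / (mdeg w)%:R :> R.
    rewrite (mdeg_mult k_complete (expR_gt0 (- t)) ne) natrM.
    field; rewrite !pnatr_eq0 (gtn_eqF m0) gtn_eqF//.
    by rewrite nu_gt0// expR_ge0.
  rewrite /f; under eq_bigr do rewrite -EFinM.
  rewrite sumEFin -mulr_sumr mulrC; congr (_ * _)%:E.
  rewrite /nu -sum1_count natr_sum big_mkcond /= !big_seq; apply: eq_bigr => z zw.
  rewrite indicE mem_setE in_itv /= t0 /= /l.
  rewrite (le_ln_max _ s0 es).
  by case: (_ <= _).
rewrite ge0_integral_sum//=; last 2 first.
- by move=> z; apply: measurable_funeM; apply/measurable_EFinP; exact: measurable_indic.
- by move=> z t _; rewrite /f mule_ge0// lee_fin ?invr_ge0 ?(ltW d0)// indicE ler0n.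
rewrite big_seq (eq_bigr (fun z => (((mdeg w)%:R^-1) * l z)%:E)) => [|z zw]; last first.
  have m0 : 0 < Num.max s (vabs (w - z)) by rewrite lt_max s0.
  have m1 : Num.max s (vabs (w - z)) <= 1 by rewrite ge_max s1 wz.
  have l0 : 0 <= l z by rewrite /l oppr_ge0 ln_le0.
  have ll : l z <= - ln s by rewrite /l lerN2 ler_ln ?posrE// le_max lexx.
  rewrite /f ge0_integralZl_EFin//=; last first.
    by apply/measurable_EFinP; exact: measurable_indic.
  rewrite integral_indic// (_ : _ `&` _ = `[0, l z]%classic); last first.
    apply/setIidPl => t /=; rewrite !in_itv /= => /andP[-> tl] /=.
    exact: le_trans ll.
  rewrite [X in (_ * X)%E](lebesgue_measure_itv `[0, l z]) /= lte_fin.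
  have := l0; rewrite le_eqVlt => /predU1P[<-|->]; first by rewrite ltxx mule0 mulr0.
  by rewrite -EFinB subr0 -EFinM.
rewrite -big_seq sumEFin -mulr_sumr sumrN; congr EFin.
rewrite mulrN mulrC; congr (- (_ / _)).
rewrite /Lam; elim: (conjs w) => [|z r ih]; first by rewrite !big_nil ln1.
rewrite !big_cons lnM ?ih// posrE; first by rewrite lt_max s0.
by apply: prodr_gt0 => z' _; rewrite lt_max s0.
Qed.

End Alpha.

(** * Neighbourhoods described by distances and radii *)

Section Topology.
Variables (R : realType) (k : valuedField R) (C : completedAlgClosure k).
Hypothesis k_complete : vf_complete k.

Local Notation La := (kav C).
Local Notation dst := (@dst R k C).
Local Notation pt := (@pt R k C).
Local Notation rad := (rad C).
Implicit Types (v w : La) (s t : R) (x u : berk k).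

Lemma dist_max2 (a b c : R) : `|Num.max a c - Num.max b c| <= `|a - b|.
Proof.
wlog ba : a b / b <= a => [h|].
  by have [/h//|/ltW/h] := leP b a; rewrite distrC (distrC a).
have mab : Num.max b c <= Num.max a c by rewrite ge_max !le_max ba lexx orbT.
rewrite !ger0_norm ?subr_ge0// lerBlDr ge_max.
have bM : b <= Num.max b c by rewrite le_max lexx.
have cM : c <= Num.max b c by rewrite le_max lexx orbT.
by apply/andP; split; lra.
Qed.

Lemma Lam_cvg (T : Type) (G : set_system T) (f : T -> R) w (s : R) : Filter G ->
  f u @[u --> G] --> s -> Lam w (f u) @[u --> G] --> Lam w s.
Proof.
move=> FG fs; rewrite /Lam; elim: (conjs w) => [|a r ih].
  rewrite big_nil; under eq_fun do rewrite big_nil; exact: cvg_cst.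
rewrite big_cons; under eq_fun do rewrite big_cons.
apply: cvgM => //; apply/cvgrPdist_le => e e0.
move/cvgrPdist_le : fs => /(_ e e0); apply: filterS => u.
exact: le_trans (dist_max2 _ _ _).
Qed.

Lemma poly_pt_cvg (G : set_system (berk k)) x (F : {poly k}) : Filter G ->
  (forall w, dst u w @[u --> G] --> dst x w) ->
  poly_pt u F @[u --> G] --> poly_pt x F.
Proof.
move=> FG h; elim/(@poly_factor_ind R k C) : F => [c|w F ih].
  rewrite (sptC (poly_pt_seminorm x)).
  under eq_fun do rewrite (sptC (poly_pt_seminorm _)).
  exact: cvg_cst.
rewrite (sptM (poly_pt_seminorm x)) (mpoly_dst k_complete).
under eq_fun do rewrite (sptM (poly_pt_seminorm _)) (mpoly_dst k_complete).
by apply: cvgM => //; exact: Lam_cvg.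
Qed.

(** Polynomials are dense and split into minimal polynomials, so convergence can be tested on
    distances. *)
Lemma dst_cvg (G : set_system (berk k)) x : Filter G ->
  (forall w, dst u w @[u --> G] --> dst x w) -> G --> x.
Proof.
move=> FG h; apply: cvg_berk => f; apply/cvgrPdist_le => e e0.
have e3 : 0 < e / 3 by rewrite divr_gt0.
have [F fF] := tate_approx f e3.
have /cvgrPdist_le/(_ _ e3) /= := @poly_pt_cvg G x F FG h.
apply: filterS => u /= uF.
have := le_trans (berk_dist x f (ptate F)) fF.
have := le_trans (berk_dist u f (ptate F)) fF.
move: uF; rewrite -!/(poly_pt _ _).
move: (x f) (u f) (poly_pt x F) (poly_pt u F) => a b c d.
rewrite !ler_norml => /andP[h1 h2] /andP[h3 h4] /andP[h5 h6].
by apply/andP; split; lra.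
Qed.

Definition above x (s1 : R) : set (berk k) := [set u | berk_le x u /\ rad u < s1].

Lemma nbhs_above x (A : set (berk k)) : x <> gauss_pt k -> nbhs x A ->
  exists2 s1, rad x < s1 & above x s1 `<=` A.
Proof.
move=> xG xA.
pose G := filter_from [set s1 | rad x < s1] (above x).
have FG : Filter G.
  apply: filter_from_filter; first by exists (rad x + 1); rewrite /= ltrDl.
  move=> s t xs xt; exists (Num.min s t); rewrite /= ?lt_min ?xs//.
  by move=> u [xu]; rewrite lt_min => /andP[us ut].
suff Gx : G --> x by have [s1 /= xs1 h] := Gx _ xA; exists s1.
apply: dst_cvg => w; apply/cvgrPdist_le => e e0.
exists (rad x + e) => /=; first by rewrite ltrDl.
move=> u [xu ue]; have h1 := (berk_le_dst C k_complete x u).1 xu w.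
have := dst_above k_complete w xu.
rewrite distrC ger0_norm ?subr_ge0// lerBlDr => h2; apply: (le_trans h2).
rewrite ge_max addrC (le_trans (ltW ue)) ?lerD2r ?rad_le_dst//=.
by rewrite lerDl ltW.
Qed.

Lemma nbhs_curve w s (A : set (berk k)) : nice w s -> nbhs (pt w s) A ->
  exists2 d, 0 < d & forall t, nice w t -> `|s - t| < d -> A (pt w t).
Proof.
move=> ws xA.
pose G := filter_from [set d : R | 0 < d] 
    (fun d => [set u | exists t, [/\ nice w t, `|s - t| < d & u = pt w t]]).
have FG : Filter G.
  apply: filter_from_filter; first by exists 1 => /=.
  move=> d e d0 e0; exists (Num.min d e); rewrite /= ?lt_min ?d0//.
  by move=> u [r [wr]]; rewrite lt_min => /andP[rd re] ->; split; exists r.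
suff Gx : G --> pt w s.
  by have [d /= d0 h] := Gx _ xA; exists d => // t wt td; apply: h; exists t.
apply: dst_cvg => v; apply/cvgrPdist_le => e e0.
exists e => // _ [t [wt td ->]].
by rewrite !dst_pt// (le_trans (dist_max2 _ _ _))// ltW.
Qed.

End Topology.

(** * Finite subtrees and directional derivatives *)

Section Trees.
Variables (R : realType) (k : valuedField R) (C : completedAlgClosure k).
Hypothesis k_complete : vf_complete k.

Local Notation La := (kav C).
Local Notation dst := (@dst R k C).
Local Notation pt := (@pt R k C).
Local Notation rad := (rad C).
Implicit Types (v w : La) (s t : R) (x u z : berk k) (S Y : set (berk k)).

Lemma join_ub x z : berk_le x (berk_join x z) /\ berk_le z (berk_join x z).
Proof.
rewrite /berk_join; case: xgetP => [y -> []//|_]; by split; apply: le_gauss.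
Qed.

Lemma join_le x z : berk_le x z -> berk_join x z = z.
Proof.
move=> xz; rewrite /berk_join; case: xgetP => [y -> [xy zy h]|/(_ z)[]].
  apply: berk_le_anti => //; apply: h => //; exact: berk_le_refl.
by split=> //; exact: berk_le_refl.
Qed.

Lemma berk_joinC x z : berk_join x z = berk_join z x.
Proof.
rewrite /berk_join; congr (get _); apply/seteqP; split=> y [h1 h2 h]; split=> // t h3 h4.
  exact: h.
exact: h.
Qed.

Lemma segmentC x z : segment x z = segment z x.
Proof. by rewrite /segment berk_joinC; apply/seteqP; split=> u [h1 [|]]; split; tauto. Qed.

Lemma segment_le x z u : berk_le x z -> segment x z u <-> berk_le x u /\ berk_le u z.
Proof.
move=> xz; rewrite /segment (join_le xz); split=> [[uz [xu|zu]]|[xu uz]] //=; last by tauto.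
by split=> //; exact: berk_le_trans zu.
Qed.

(** The convex hull of [S] and x_G, for nonempty [S]; admissible subtrees are exactly those with [S]
    finite, nonempty and free of rigid points. *)
Definition upset S : set (berk k) := [set u | exists2 z, S z & berk_le z u].

Lemma upset_convex S : seg_convex (upset S).
Proof.
move=> x y [z Sz zx] [z' Sz' zy] u [_ [xu|yu]].
  by exists z => //; exact: berk_le_trans xu.
by exists z' => //; exact: berk_le_trans yu.
Qed.

Lemma sub_upset S : S `<=` upset S.
Proof. by move=> z Sz; exists z => //; exact: berk_le_refl. Qed.

Lemma upset_least S Y : seg_convex Y -> S `<=` Y -> Y (gauss_pt k) -> upset S `<=` Y.
Proof.
move=> cY SY YG u [z /SY Yz zu]; apply: cY Yz YG _ _.
by apply/segment_gauss.
Qed.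

Transparent toK.
Lemma rigid_pt x : rigid C x -> exists2 w, vabs w <= 1 & x = pt w 0.
Proof.
move=> [w [y [w1 yw <-]]].
have n0 : @nice R k C w 0 by split; rewrite ?lexx ?ler01 -?(vabs_toK C w).
exists w; first by case: n0.
have [h1 [h2 ->]] := ptE n0.
congr restr; exact/is_disc_ptP.
Qed.
Opaque toK.

Lemma rigid_min x z : rigid C x -> berk_le z x -> z = x.
Proof.
move=> /rigid_pt[w w1 ->] zx; apply: (@rad_eq _ _ C k_complete _ _ zx).
have n0 : nice w 0 by split=> //; rewrite lexx ler01.
by apply/eqP; rewrite eq_le (rad_mono _ k_complete zx)// rad_pt// rad_ge0.
Qed.

Lemma nonrigid_pt w s : nice w s -> 0 < s -> ~ rigid C (pt w s).
Proof.
move=> ws s0 /rigid_pt[v v1 e].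
have n0 : nice v 0 by split=> //; rewrite lexx ler01.
by have := congr1 rad e; rewrite !rad_pt// => e'; rewrite e' ltxx in s0.
Qed.

Lemma upset_admissible S : finite_set S -> S !=set0 -> S `<=` ~` rigid C ->
  admissible_subtree C (upset S).
Proof.
move=> fS [z0 Sz0] nS; split.
- exists (S `|` [set gauss_pt k]); split.
  + by rewrite finite_setU.
  + by exists z0; left.
  + apply/seteqP; split.
      move=> u Su Y [cY SY]; move: u Su; apply: upset_least => //; last by apply: SY; right.
      by move=> z Sz; apply: SY; left.
    apply: smallest_sub; first exact: upset_convex.
    move=> u [Su|->]; first exact: sub_upset.
    by exists z0 => //; by apply: le_gauss.
- move=> u [z Sz zu] ru; apply: (nS z Sz).
  by rewrite (rigid_min ru zu).
- by exists z0 => //; by apply: le_gauss.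
Qed.

Lemma admissible_upset Y : admissible_subtree C Y ->
  exists S, [/\ finite_set S, S !=set0, S `<=` ~` rigid C & Y = upset S].
Proof.
move=> [[S [fS S0 YE]] nY YG]; exists S; split => //.
  by move=> z Sz; apply: nY; rewrite YE; exact: sub_gen_smallest.
apply/seteqP; split.
  by rewrite YE; apply: smallest_sub; [exact: upset_convex|exact: sub_upset].
apply: upset_least => //; first last.
  by rewrite YE; exact: sub_gen_smallest.
by rewrite YE => x y Yx Yy u xyu Z [cZ SZ]; apply: (cZ x y) => //; [exact: Yx|exact: Yy].
Qed.

Lemma admissibleU Y x : admissible_subtree C Y -> ~ rigid C x ->
  admissible_subtree C (Y `|` upset [set x]).
Proof.
move=> /admissible_upset[S [fS [z Sz] nS ->]] nx.
have -> : upset S `|` upset [set x] = upset (S `|` [set x]).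
  apply/seteqP; split=> u.
    by move=> [[v Sv vu]|[v vx vu]]; exists v => //; [left|right].
  by move=> [v [Sv|->] vu]; [left; exists v|right; exists x].
apply: upset_admissible; first by rewrite finite_setU.
  by exists z; left.
by move=> u [/nS//|->].
Qed.

(** The least point of [Y] above a rigid point has as radius the smallest distance from [w] to the
    finitely many generators. It is positive: a generator at distance 0 would itself be rigid. *)
Lemma retraction_pt Y w s : admissible_subtree C Y -> nice w s -> 0 < s ->
  Y (pt w s) -> exists r, [/\ 0 < r, r <= s & retraction Y (pt w 0) = pt w r].
Proof.
move=> /admissible_upset[S [fS S0 nS YE]] ws s0 Yws.
have n0 : nice w 0 by split; [case: ws|rewrite lexx ler01].
have [z [Sz zmin]] : exists z, S z /\ forall z', S z' -> dst z w <= dst z' w.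
  have [r rE] := (finite_seqP S).1 fS; have [z0 Sz0] := S0.
  have z0r : z0 \in r by rewrite rE in Sz0.
  have [z zr zmin] := seq_argmin (fun z => dst z w) z0r.
  by exists z; rewrite rE; split => // z' /zmin.
have rw : rigid C (pt w 0).
  Transparent toK.
  have [h1 [h2 ->]] := ptE n0.
  by exists w, (disc_pt h1 h2); split=> //; exact/is_disc_ptP.
  Opaque toK.
set r := dst z w.
have r0 : 0 < r.
  rewrite lt_def dst_ge0 andbT; apply/eqP => r0; apply: (nS z Sz).
  have zw : berk_le z (pt w 0) by apply/(le_pt k_complete) => //; rewrite -/r r0.
  by rewrite (rigid_min rw zw).
have rs : r <= s.
  move: Yws; rewrite YE => -[z' /zmin h /(le_pt k_complete _ ws)]; exact: le_trans.
have rn : nice w r by split; [case: ws|rewrite ltW//= (le_trans rs)//; case: ws => _ /andP[]].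
have le0 : berk_le (pt w 0) (pt w r).
  by apply/(le_pt k_complete) => //; rewrite dst_pt// del_self// maxxx ltW.
have Yr : Y (pt w r) by rewrite YE; exists z => //; exact/(le_pt k_complete).
have min y : Y y -> berk_le (pt w 0) y -> berk_le (pt w r) y.
  rewrite YE => -[z' Sz' zy] xy; apply: (@chain_le _ _ C k_complete _ _ _ le0 xy).
  rewrite (rad_pt k_complete rn) (le_trans (zmin _ Sz'))//.
  rewrite (le_trans ((berk_le_dst C k_complete _ _).1 zy w))//.
  have := dst_above k_complete w xy; rewrite dst_pt// del_self// maxxx.
  by rewrite max_l// rad_ge0.
exists r; split=> //; rewrite /retraction; case: xgetP => [y _ yE|/(_ (pt w r))[]]; last first.
  apply/seteqP; split=> u.
    move=> [/(segment_le _ le0)[xu ur] Yu]; apply: berk_le_anti => //; exact: min.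
  by move=> ->; split=> //; apply/(segment_le _ le0); split=> //; exact: berk_le_refl.
rewrite /= in yE.
(* The value selected by [retraction] is not known to lie above the rigid point. Its join with that
   point is in [Y] and on the segment, so the two coincide. *)
have [xy Yy] : (segment (pt w 0) y `&` Y) y by rewrite yE.
have Yj : Y (berk_join (pt w 0) y).
  move: Yy; rewrite YE => -[v Sv vy]; exists v => //; apply: berk_le_trans vy _.
  by have [] := join_ub (pt w 0) y.
have [xj yj] := join_ub (pt w 0) y.
have jE : berk_join (pt w 0) y = y.
  have : (segment (pt w 0) y `&` Y) (berk_join (pt w 0) y).
    by split=> //; split; [exact: berk_le_refl|left].
  by rewrite yE.
have {}xy : berk_le (pt w 0) y by rewrite -jE.
have : (segment (pt w 0) y `&` Y) (pt w r).
  by split=> //; apply/(segment_le _ xy); split=> //; exact: min.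
by rewrite yE => <-.
Qed.

Lemma rad_lt1 x : x <> gauss_pt k -> rad x < 1.
Proof.
move=> xG; rewrite lt_neqAle rad_le1// andbT; apply/eqP => x1; apply: xG.
apply: (@rad_eq _ _ C k_complete) => //; first exact: le_gauss.
by rewrite rad_gauss.
Qed.

Lemma exists_above x (s1 : R) : x <> gauss_pt k -> rad x < s1 ->
  exists w t, [/\ nice w t, rad x < t, t < s1 & berk_le x (pt w t)].
Proof.
move=> /rad_lt1 x1 xs1; have : rad x < Num.min s1 1 by rewrite lt_min xs1.
move=> /(rad_lt k_complete)[w w1 wd].
have xw := rad_le_dst x w; have x0 := rad_ge0 C x.
pose t := (dst x w + Num.min s1 1) / 2.
have t1 : dst x w < t by rewrite /t; move: wd; move: (dst _ _) (Num.min _ _) => a b; lra.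
have t2 : t < Num.min s1 1 by rewrite /t; move: wd; move: (dst _ _) (Num.min _ _) => a b; lra.
exists w, t; have := t2; rewrite lt_min => /andP[t3 t4].
have nt : nice w t by split=> //; rewrite !ltW// (le_lt_trans _ t1)// (le_trans x0).
split=> //; first exact: le_lt_trans t1.
by apply/(le_pt k_complete) => //; exact: ltW.
Qed.

(** Reaches [phi x] from above: by continuity on the path to x_G when [x] is not rigid, and by the
    limit over retractions when it is. *)
Lemma phi_above (phi : berk k -> \bar R) c x (s1 : R) (U : set (\bar R)) :
  subharmonic C c phi -> x <> gauss_pt k -> rad x < s1 -> nbhs (phi x) U ->
  exists w t, [/\ nice w t, rad x < t, t < s1, berk_le x (pt w t) & U (phi (pt w t))].
Proof.
move=> [_ _ tree net] xG xs1 xU; have [rx|nx] := pselect (rigid C x); last first.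
  have Y1 : admissible_subtree C (upset [set x]).
    by apply: upset_admissible => //; [exists x|move=> _ ->].
  have [/subspace_continuousP cts _ _] := tree _ Y1.
  have := cts x (sub_upset (erefl : [set x] x)).
  move=> /(_ _ xU) /(@nbhs_above R k C k_complete x _ xG)[s2 xs2 h].
  have xm : rad x < Num.min s1 s2 by rewrite lt_min xs1.
  have [w [t [wt xt]]] := exists_above xG xm.
  rewrite lt_min => /andP[t1 t2] xwt; exists w, t; split => //.
  by apply: (h (pt w t)); [split=> //; rewrite rad_pt|exists x].
have [w w1 xE] := rigid_pt rx.
have x0 : rad x = 0.
  by rewrite xE rad_pt//; split=> //; rewrite lexx ler01.
have xm : rad x < Num.min s1 1 by rewrite x0 in xs1 *; rewrite lt_min xs1 ltr01.
have [t [t0 tm]] : exists t, rad x < t /\ t < Num.min s1 1.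
  by exists ((rad x + Num.min s1 1) / 2); move: xm; move: (rad x) (Num.min _ _) => a b; lra.
rewrite lt_min in tm; have /andP[ts1 t1] := tm.
have wt : nice w t by split=> //; rewrite -x0 !ltW.
have [Y0 Y0a Y0U] := net x _ xU.
have t0' : 0 < t by rewrite -x0.
(* Enlarging the tree by [pt w t] forces the retraction of [x] to have radius at most [t]. *)
have Ya := admissibleU Y0a (nonrigid_pt wt t0').
have Yt : (Y0 `|` upset [set pt w t]) (pt w t) by right; exact: sub_upset.
have [r [r0 rt rE]] := retraction_pt Ya wt t0' Yt.
have rn : nice w r by split=> //; rewrite ltW//= (le_trans rt)// ltW.
exists w, r; split => //.
- by rewrite x0.
- exact: le_lt_trans ts1.
- rewrite xE; apply/(le_pt k_complete) => //.
  by rewrite dst_pt ?del_self ?max_l// ?ltW//; split=> //; rewrite lexx ler01.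
- rewrite -rE -xE; apply: Y0U; split => //; exact: subsetUl.
Qed.

End Trees.

Lemma cvg_from_above (R : realType) (T : Type) (F : set_system T) (q : T -> \bar R)
    (l : \bar R) : Filter F -> (l < +oo)%E ->
  (forall e : R, (l < e%:E)%E -> \forall x \near F, (q x <= e%:E)%E) ->
  (\forall x \near F, (l <= q x)%E) -> q x @[x --> F] --> l.
Proof.
move=> FF; case: l => [r _ h1 h2|//|_ h1 _]; last first.
  by apply/cvgeNyPle => A; apply: h1; exact: ltNyr.
have h3 : \forall x \near F, q x \is a fin_num.
  have := h1 (r + 1); rewrite lte_fin ltrDl ltr01 => /(_ isT).
  apply: filterS2 h2 => x; case: (q x) => [a| |] //=.
apply/fine_cvgP; split=> //; apply/cvgrPdist_le => e e0.
have := h1 (r + e); rewrite lte_fin ltrDl e0 => /(_ isT).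
apply: filterS3 h2 h3 => x /=; case: (q x) => [a| |] //=.
rewrite !lee_fin => h4 _ h5; rewrite distrC ger0_norm ?subr_ge0//.
by rewrite lerBlDl.
Qed.

(** * Convexity and slopes with respect to alpha *)

Section Slopes.
Variables (R : realType) (k : valuedField R) (C : completedAlgClosure k).
Hypothesis k_complete : vf_complete k.

Local Notation La := (kav C).
Local Notation dst := (@dst R k C).
Local Notation pt := (@pt R k C).
Local Notation rad := (rad C).
Implicit Types (v w : La) (s t r : R) (x y u z : berk k).

(* The points of type II and III. *)
Definition inner x := exists w s, [/\ nice w s, 0 < s & x = pt w s].

Let chain_tot x y z : berk_le x y -> berk_le x z -> berk_le y z \/ berk_le z y.
Proof. exact: (chain_total C k_complete). Qed.

(* Sealed: unfolding alpha makes unification diverge. *)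
Fact al_subproof : {a : berk k -> R | a = fun x => fine (alpha C x)}.
Proof. by eexists. Qed.

Definition al : berk k -> R := sval al_subproof.

Let alD x : al x = fine (alpha C x).
Proof. by rewrite /al (svalP al_subproof). Qed.

Lemma inner_pt w s : nice w s -> 0 < s -> inner (pt w s).
Proof. by exists w, s. Qed.

Lemma inner_gauss : inner (gauss_pt k).
Proof.
exists 0, 1; split=> //; last exact: gauss_ptE.
by split; rewrite ?vabs0 ?ler01 ?lexx.
Qed.

Lemma inner_rad x : inner x -> 0 < rad x.
Proof. by move=> [w [s [ws s0 ->]]]; rewrite rad_pt. Qed.

Lemma nonrigid_inner x : inner x -> ~ rigid C x.
Proof. by move=> [w [s [ws s0 ->]]]; exact: nonrigid_pt. Qed.

Lemma al_pt w s : nice w s -> 0 < s -> al (pt w s) = - (ln (Lam w s) / (mdeg w)%:R).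
Proof. by move=> ws s0; rewrite alD alpha_pt. Qed.

Lemma alE x : inner x -> alpha C x = (al x)%:E.
Proof. by move=> [w [s [ws s0 ->]]]; rewrite alD alpha_pt. Qed.

Lemma inner_above w s u : nice w s -> berk_le (pt w s) u ->
  [/\ nice w (rad u), s <= rad u & u = pt w (rad u)].
Proof.
move=> ws wu; have := rad_mono C k_complete wu; rewrite rad_pt// => su.
split=> //; first by apply: nice_mono ws su _; exact: rad_le1.
by apply: above_eq (wu) _ => //; [case: ws|rewrite dst_pt// del_self// max_l//; case: ws => _ /andP[]].
Qed.

Lemma inner_up z u : inner z -> berk_le z u -> inner u.
Proof.
move=> [w [s [ws s0 ->]]] /inner_above-/(_ ws)[wu su ->].
by exists w, (rad u); split=> //; exact: lt_le_trans su.
Qed.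

Lemma pt_le_same w s t : nice w s -> nice w t -> berk_le (pt w s) (pt w t) <-> s <= t.
Proof.
move=> ws wt; rewrite pt_le// del_self//; split=> [[]//|st]; split=> //.
by case: wt => _ /andP[].
Qed.

Lemma al_lt z u : inner z -> berk_le z u -> z <> u -> al u < al z.
Proof.
move=> [w [s [ws s0 ->]]] wu; have [wr su uE] := inner_above ws wu.
rewrite uE => ne; have {}su : s < rad u.
  by rewrite lt_neqAle su andbT; apply: contra_notN ne => /eqP ->.
rewrite !al_pt//; last exact: lt_trans su.
rewrite ltrN2 ltr_pM2r ?invr_gt0 ?ltr0n ?mdeg_gt0//.
by rewrite ltr_ln ?posrE ?Lam_gt0 ?Lam_lt ?(lt_trans s0 su)// ltW.
Qed.

Lemma al_le z u : inner z -> berk_le z u -> al u <= al z.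
Proof.
move=> iz zu; have [->//|ne] := pselect (z = u).
exact/ltW/al_lt.
Qed.

Lemma dist_le z u : inner z -> berk_le z u -> dist C z u = (al z - al u)%:E.
Proof.
move=> iz zu; rewrite /dist (join_le zu) {2}/absdiff eqxx adde0 /absdiff.
rewrite !alE//; last exact: inner_up zu.
have [[->]|ne] := eqVneq (al z)%:E (al u)%:E; first by rewrite subrr.
by rewrite -EFinB /= ger0_norm// subr_ge0 al_le.
Qed.

Lemma distC z u : dist C z u = dist C u z.
Proof. by rewrite /dist (berk_joinC u z); exact: addeC. Qed.

Lemma nbhs_between w s t (A : set (berk k)) : nice w s -> nice w t -> s <> t ->
  nbhs (pt w s) A -> exists r, Num.min s t < r /\ r < Num.max s t /\ A (pt w r).
Proof.
move=> ws wt /eqP st wA; have [d d0 h] := nbhs_curve k_complete ws wA.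
pose th := Num.min (1 / 2) (d / 2).
have th0 : 0 < th by rewrite lt_min !divr_gt0.
have th1 : th < 1 by rewrite gt_min ltr_pdivrMr// mul1r ltr1n.
have thd : th < d by rewrite gt_min orbC ltr_pdivrMr// ltr_pMr// ltr1n.
have [[_ /andP[s0 s1]] [w1 /andP[t0 t1]]] := (ws, wt).
have rb : Num.min s t < s + th * (t - s) /\ s + th * (t - s) < Num.max s t.
  move: st; rewrite neq_lt => /orP[lt|lt].
    rewrite (min_idPl (ltW lt)) (max_idPr (ltW lt)); split; nra.
  rewrite (min_idPr (ltW lt)) (max_idPl (ltW lt)); split; nra.
exists (s + th * (t - s)); case: rb => rb1 rb2; split=> //; split=> //; apply: h.
  split=> //; apply/andP; split.
    by apply: le_trans (ltW rb1); rewrite le_min s0.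
  by apply: le_trans (ltW rb2) _; rewrite ge_max s1.
rewrite opprD addNKr normrN normrM (gtr0_norm th0).
apply: le_lt_trans thd; rewrite ler_piMr ?(ltW th0)// ler_norml; apply/andP; split; lra.
Qed.

Lemma al_left w s : nice w s -> 0 < s -> al (pt w t) @[t --> s^'-] --> al (pt w s).
Proof.
move=> ws s0; rewrite (al_pt ws s0).
have nr : \forall t \near s^'-, 0 < t /\ t < s.
  near=> t; split; near: t; [exact: nbhs_left_gt|exact: nbhs_left_lt].
apply: (@cvg_trans _ ((- (ln (Lam w t) / (mdeg w)%:R)) @[t --> s^'-])).
  apply: near_eq_cvg; apply: filterS nr => t [t0 ts]; rewrite al_pt//.
  by case: ws => w1 /andP[_ s1]; split=> //; rewrite ltW//= ltW// (lt_le_trans ts).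
apply: cvgN; apply: cvgM; last exact: cvg_cst.
apply: (@continuous_cvg _ _ _ _ _ _ (@ln R)); first by apply: continuous_ln; exact: Lam_gt0.
by apply: Lam_cvg; apply: cvg_at_left_filter; exact: cvg_id.
Unshelve. all: by end_near. Qed.

Section Subharmonic.
Variables (c : R) (phi : berk k -> \bar R).
Hypothesis hphi : subharmonic C c phi.

Local Notation g := (fun u => fine (phi u)).

Lemma phiE z : inner z -> phi z = (g z)%:E.
Proof.
move=> iz; case: hphi => [h1 h2 _ _]; have := h1 z; have := h2 z.
by rewrite alE// => /(_ (ltry _)); case: (phi z).
Qed.

Lemma upset1_admissible a : inner a -> admissible_subtree C (upset [set a]).
Proof.
move=> ia; apply: upset_admissible => //; first by exists a.
by move=> _ ->; exact: nonrigid_inner.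
Qed.

Lemma phi_curve w s e : nice w s -> 0 < s -> 0 < e -> exists2 d, 0 < d &
  forall t, nice w t -> 0 < t -> `|s - t| < d -> `|g (pt w s) - g (pt w t)| < e.
Proof.
move=> ws s0 e0; case: (hphi) => [_ _ tree _].
have wr : nice w (s / 2).
  case: ws => w1 /andP[_ s1]; split=> //; apply/andP; split; lra.
have r0 : 0 < s / 2 by rewrite divr_gt0.
have [/subspace_continuousP cts _ _] := tree _ (upset1_admissible (inner_pt wr r0)).
have Ys : upset [set pt w (s / 2)] (pt w s).
  exists (pt w (s / 2)) => //; apply/pt_le_same => //.
  lra.
have [d d0 h] : exists2 d, 0 < d & forall t, nice w t -> `|s - t| < d ->
    upset [set pt w (s / 2)] (pt w t) -> `|g (pt w s) - g (pt w t)| < e.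
  have := cts _ Ys [set b | `|g (pt w s) - fine b| < e].
  have U : nbhs (phi (pt w s)) [set b | `|g (pt w s) - fine b| < e].
    have -> : phi (pt w s) = (g (pt w s))%:E by apply: phiE; exact: inner_pt.
    change (nbhs (g (pt w s)) [set a : R | `|g (pt w s) - a| < e]).
    exact: nbhsx_ballx.
  move=> /(_ U) /(nbhs_curve k_complete ws)[d d0 h].
  by exists d => // t wt td; apply: h.
exists (Num.min d (s / 2)); first by rewrite lt_min d0.
move=> t wt t0; rewrite lt_min => /andP[td ts]; apply: h => //.
exists (pt w (s / 2)) => //; apply/pt_le_same => //.
by move: ts; rewrite ltr_norml => /andP[_]; lra.
Qed.

Lemma g_left w s : nice w s -> 0 < s -> g (pt w t) @[t --> s^'-] --> g (pt w s).
Proof.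
move=> ws s0; apply/cvgrPdist_lt => e e0.
have [d d0 h] := phi_curve ws s0 e0.
near=> t.
have t0 : 0 < t by near: t; exact: nbhs_left_gt.
have ts : t < s by near: t; exact: nbhs_left_lt.
apply: h => //.
  by case: ws => w1 /andP[_ s1]; split=> //; rewrite ltW//= ltW// (lt_le_trans ts).
rewrite gtr0_norm ?subr_gt0// ltrBlDl -ltrBlDr.
by near: t; apply: nbhs_left_gt; rewrite ltrBlDr ltrDl.
Unshelve. all: by end_near. Qed.

Let cvx_core a z b : inner a -> berk_le a z -> berk_le z b -> b <> gauss_pt k ->
  (al a - al b) * g z <= (al z - al b) * g a + (al a - al z) * g b.
Proof.
move=> ia az zb bG; case: (hphi) => [_ _ tree _].
have [_ cv _] := tree _ (upset1_admissible ia).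
have ab := berk_le_trans az zb.
have [iz ib] := (inner_up ia az, inner_up ia ab).
have Ya : upset [set a] a by exact: sub_upset.
have Yb : upset [set a] b by exists a.
have aba : segment a b a by apply/segment_le => //; split=> //; exact: berk_le_refl.
have abb : segment a b b by apply/segment_le => //; split=> //; exact: berk_le_refl.
have abz : segment a b z by apply/segment_le.
have nG : ~ segment a b (gauss_pt k).
  by move=> /(segment_le _ ab)[_ Gb]; apply: bG; apply: berk_le_anti => //; exact: le_gauss.
have key (d1 d2 d3 : \bar R) : d1 = (al a - al b)%:E -> d2 = (al z - al b)%:E ->
    d3 = (al a - al z)%:E ->
    ((d1 < +oo)%E -> (d1 * phi z <= d2 * phi a + d3 * phi b)%E) ->
    (al a - al b) * g z <= (al z - al b) * g a + (al a - al z) * g b.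
  move=> -> -> ->; rewrite (phiE ia) (phiE iz) (phiE ib) ltry -!EFinM -EFinD lee_fin.
  exact.
exact (key _ _ _ (dist_le ia ab) (dist_le iz zb) (dist_le ia az)
  (cv a b Ya Yb ab nG a b z aba abb abz)).
Qed.

Lemma phi_convex a z b : inner a -> berk_le a z -> berk_le z b ->
  (al a - al b) * g z <= (al z - al b) * g a + (al a - al z) * g b.
Proof.
move=> ia az zb; have [bG|] := pselect (b = gauss_pt k); last exact: cvx_core.
have [zG|nzG] := pselect (z = gauss_pt k).
  by rewrite bG zG subrr mul0r add0r lexx.
have [v [r [vr r0 aE]]] := ia.
have [vz rz zE] := inner_above vr (eq_ind _ (fun u => berk_le u z) az _ aE).
have s0 : 0 < rad z := lt_le_trans r0 rz.
have s1 : rad z < 1 := rad_lt1 C k_complete nzG.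
have v1 : nice v 1 by case: vr => ? _; split=> //; rewrite ler01 lexx.
have bE : b = pt v 1.
  have [_ _] := inner_above v1 (le_gauss (pt v 1)).
  by rewrite bG rad_gauss.
have bal : al (pt v t) @[t --> 1^'-] --> al b by rewrite bE; exact: al_left.
have bg : g (pt v t) @[t --> 1^'-] --> g b by rewrite bE; exact: g_left.
apply: (@ler_cvg_to _ (at_left (1 : R)) _ _
  (fun t => (al a - al (pt v t)) * g z)
  (fun t => (al z - al (pt v t)) * g a + (al a - al z) * g (pt v t))).
- by apply: cvgM; [apply: cvgB => //; exact: cvg_cst|exact: cvg_cst].
- apply: cvgD; first by apply: cvgM; [apply: cvgB => //; exact: cvg_cst|exact: cvg_cst].
  by apply: cvgM => //; exact: cvg_cst.
- near=> t.
  have zt : rad z < t by near: t; exact: nbhs_left_gt.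
  have t1 : t < 1 by near: t; exact: nbhs_left_lt.
  have vt : nice v t by case: vr => ? _; split=> //; rewrite !ltW// (lt_trans s0).
  apply: cvx_core => //.
    by rewrite zE; apply/pt_le_same => //; exact: ltW.
  move=> tG; have := rad_pt k_complete vt; rewrite tG (rad_gauss C)// => t1'.
  by rewrite -t1' ltxx in t1.
Unshelve. all: by end_near. Qed.

(** The slope going up from [x] to [y]: [al] decreases upwards, so the denominator is positive. *)
Definition slope x y : R := (g y - g x) / (al x - al y).

Lemma slopeE x y : slope x y = (g y - g x) / (al x - al y).
Proof. by []. Qed.

Lemma slope_le_r a z b : inner a -> berk_le a z -> a <> z -> berk_le z b ->
  slope a z <= slope a b.
Proof.
move=> ia az naz zb; have h1 := al_lt ia az naz.
have h2 := al_le (inner_up ia az) zb; have h3 := phi_convex ia az zb.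
rewrite /slope; move: (g a) (g z) (g b) (al a) (al z) (al b) h1 h2 h3 => ga gz gb x y t h1 h2 h3.
rewrite ler_pdivrMr ?subr_gt0// mulrAC ler_pdivlMr ?subr_gt0 1?(le_lt_trans h2)//.
nra.
Qed.

Lemma slope_le_l a z b : inner a -> berk_le a z -> berk_le z b -> z <> b ->
  slope a b <= slope z b.
Proof.
move=> ia az zb nzb; have h1 := al_lt (inner_up ia az) zb nzb.
have h2 := al_le ia az; have h3 := phi_convex ia az zb.
rewrite /slope; move: (g a) (g z) (g b) (al a) (al z) (al b) h1 h2 h3 => ga gz gb x y t h1 h2 h3.
rewrite ler_pdivrMr ?subr_gt0 1?(lt_le_trans h1)// mulrAC ler_pdivlMr ?subr_gt0//.
nra.
Qed.

Definition dquot y z : R := (g z - g y) / `|al y - al z|.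

Lemma dquot_down y z : inner z -> berk_le z y -> dquot y z = - slope z y.
Proof.
move=> iz zy; rewrite /dquot /slope distrC ger0_norm ?subr_ge0 ?al_le//.
by rewrite -mulNr opprB.
Qed.

Lemma dquot_up y z : inner y -> berk_le y z -> dquot y z = slope y z.
Proof. by move=> iy yz; rewrite /dquot /slope ger0_norm// subr_ge0 al_le. Qed.

Lemma dquotE y z : inner y -> inner z -> z <> y -> berk_le y z \/ berk_le z y ->
  ((phi z - phi y) / dist C y z)%E = (dquot y z)%:E.
Proof.
move=> iy iz ne h.
have key (d : \bar R) : d = `|al y - al z|%:E -> 0 < `|al y - al z| ->
    ((phi z - phi y) / d)%E = (dquot y z)%:E.
  move=> -> d0; rewrite (phiE iy) (phiE iz) -EFinB inver gt_eqF//.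
have [al0 dE] : 0 < `|al y - al z| /\ dist C y z = `|al y - al z|%:E.
  case: h => h.
    have lt := al_lt iy h (fun e => ne (esym e)).
    by split; [rewrite normr_gt0 subr_eq0 gt_eqF|rewrite ger0_norm ?subr_ge0 ?ltW//; exact: dist_le].
  have lt := al_lt iz h ne.
  split; first by rewrite normr_gt0 subr_eq0 lt_eqF.
  rewrite distC distrC ger0_norm ?subr_ge0 ?ltW//; exact: dist_le.
exact (key _ dE al0).
Qed.

(** The difference quotients decrease towards [y], so the derivative is their infimum and lies below
    each of them. *)
Lemma dir_derivative_le y (V : set (berk k)) z0 : inner y ->
  (forall z, V z -> [/\ inner z, z <> y & berk_le y z \/ berk_le z y]) ->
  (forall A, nbhs y A -> exists2 z, V z & A z) ->
  (forall z1, V z1 -> \forall z \near y, V z -> dquot y z <= dquot y z1) ->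
  V z0 -> (dir_derivative C phi y V <= (dquot y z0)%:E)%E.
Proof.
move=> iy hV Vy mono Vz0.
have FF : ProperFilter (within V (nbhs y)).
  by apply: within_nbhs_proper => A /Vy[z Vz Az]; exists z.
pose l := ereal_inf [set (dquot y z)%:E | z in V].
have lz z : V z -> (l <= (dquot y z)%:E)%E.
  by move=> Vz; apply: ereal_inf_lbound; exists z.
suff -> : dir_derivative C phi y V = l by exact: lz.
apply: cvg_lim => //.
have e1 : \forall z \near within V (nbhs y),
    (dquot y z)%:E = ((phi z - phi y) / dist C y z)%E.
  rewrite near_withinE; apply: filterE => z Vz; have [iz zy cz] := hV z Vz.
  exact: esym (dquotE iy iz zy cz).
apply: (cvg_trans (near_eq_cvg e1)); apply: cvg_from_above.
- by apply: le_lt_trans (lz _ Vz0) _; rewrite ltry.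
- move=> e /ereal_inf_lt[_ [z1 Vz1 <-]]; rewrite lte_fin => /ltW z1e.
  rewrite near_withinE; apply: filterS (mono _ Vz1) => z h /h; rewrite lee_fin => /le_trans; exact.
- by rewrite near_withinE; apply: filterE => z; exact: lz.
Qed.

(** The value of [mpoly w] is an increasing function of the distance to [w], so a strict comparison
    with z1 along a chain is an open condition. *)
Lemma near_le y z1 : inner y -> berk_le y z1 -> y <> z1 ->
  \forall z \near y, berk_le y z -> berk_le z z1.
Proof.
move=> [w [s [ws s0 yE]]] yz ne; rewrite yE in yz.
have [wz sz zE] := inner_above ws yz.
have lt : s < rad z1.
  by rewrite lt_neqAle sz andbT; apply: contra_notN ne => /eqP e; rewrite yE e -zE.
have dy : dst y w = s by rewrite yE dst_pt// del_self// max_l// ltW.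
have : y (ptate (mpoly w)) < Lam w (rad z1).
  by rewrite -/(poly_pt y _) mpoly_dst// dy Lam_lt// ltW.
move=> /nbhs_eval_lt; apply: filterS => z; rewrite -/(poly_pt z _) mpoly_dst// => zl yz'.
rewrite -yE in yz.
have [//|z1z] := chain_tot yz' yz.
have := (berk_le_dst C k_complete _ _).1 z1z w; rewrite leNgt => /negP[].
by rewrite zE dst_pt// del_self// max_l ?rad_ge0// ltNge -(@Lam_le _ _ _ w) ?dst_ge0 ?rad_ge0// -ltNge.
Qed.

Lemma near_ge y z0 z1 : inner z0 -> berk_le z0 z1 -> berk_le z1 y -> z1 <> y ->
  \forall z \near y, berk_le z0 z -> berk_le z1 z.
Proof.
move=> iz0 z01 zy ne; have [w [s [ws s0 zE]]] := inner_up iz0 z01.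
rewrite zE in zy; have [wy sy yE] := inner_above ws zy.
have lt : s < rad y.
  by rewrite lt_neqAle sy andbT; apply: contra_notN ne => /eqP e; rewrite zE e -yE.
have dy : dst y w = rad y by rewrite yE dst_pt ?rad_pt// del_self// max_l// rad_ge0.
have : Lam w s < y (ptate (mpoly w)).
  by rewrite -/(poly_pt y _) mpoly_dst// dy Lam_lt// ltW.
move=> /nbhs_eval_gt; apply: filterS => z; rewrite -/(poly_pt z _) mpoly_dst// => zl z0z.
have [//|zz1] := chain_tot z01 z0z.
have := (berk_le_dst C k_complete _ _).1 zz1 w; rewrite leNgt => /negP[].
rewrite zE dst_pt// del_self// max_l ?(ltW s0)//.
by rewrite ltNge -(@Lam_le _ _ _ w) ?dst_ge0 ?(ltW s0)// -ltNge.
Qed.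

(** * The star inequality for chords *)

Section Star.
Variables (y : berk k) (ds : seq (berk k)).
Hypotheses (iy : inner y) (ds_uniq : uniq ds).
Hypothesis ds_inner : forall d, d \in ds ->
  [/\ inner d, d <> y & berk_le y d \/ berk_le d y].
Hypothesis ds_down : forall a b u, a \in ds -> b \in ds -> a <> b ->
  berk_le a y -> berk_le b y -> berk_le a u -> berk_le b u -> berk_le y u.
Hypothesis ds_up : forall a b, a \in ds -> b \in ds ->
  berk_le y a -> berk_le y b -> a = b.
Hypothesis ds_up_ex : y <> gauss_pt k -> exists2 d, d \in ds & berk_le y d.

Let Y := upset [set` y :: ds].

Let cls d := [set z' | [/\ Y z', z' <> y & segment y d `&` segment y z' <> [set y]]].

Let Y_cases z : Y z -> berk_le y z \/ exists2 d, d \in ds & berk_le d y /\ berk_le d z.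
Proof.
move=> [d]; rewrite /= inE => /orP[/eqP -> ?|dds dz]; first by left.
have [_ _ [yd|dy]] := ds_inner dds; first by left; exact: berk_le_trans dz.
by right; exists d.
Qed.

Let Y_comp z : Y z -> berk_le y z \/ berk_le z y.
Proof.
move=> /Y_cases[|[d _ [dy dz]]]; first by left.
exact: chain_tot dy dz.
Qed.

Let Y_inner z : Y z -> inner z.
Proof.
move=> /Y_cases[yz|[d dds [_ dz]]]; first exact: inner_up yz.
by have [id _ _] := ds_inner dds; exact: inner_up dz.
Qed.

Let Yds d : d \in ds -> Y d.
Proof. by move=> dds; apply: sub_upset; rewrite /= inE dds orbT. Qed.

Let Yy : Y y. Proof. by apply: sub_upset; rewrite /= inE eqxx. Qed.

Let seg_up z u : berk_le y z -> segment y z u <-> berk_le y u /\ berk_le u z.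
Proof. exact: segment_le. Qed.

Let seg_down z u : berk_le z y -> segment y z u <-> berk_le z u /\ berk_le u y.
Proof. by rewrite segmentC; exact: segment_le. Qed.

Let cls_up d z : berk_le y d -> d <> y -> cls d z <-> berk_le y z /\ z <> y.
Proof.
move=> yd ndy; split.
  move=> [Yz nzy]; have [//|zy h] := Y_comp Yz; exfalso; apply: h.
  apply/seteqP; split=> u /=.
    by move=> [/(seg_up _ yd)[yu _] /(seg_down _ zy)[_ uy]]; exact: berk_le_anti.
  move=> ->; split; first by apply/(seg_up _ yd); split=> //; exact: berk_le_refl.
  by apply/(seg_down _ zy); split=> //; exact: berk_le_refl.
move=> [yz nzy]; split=> //; first by exists y => //; rewrite /= inE eqxx.
move=> e; have := chain_tot yd yz => -[dz|zd].
  apply: ndy; suff : (segment y d `&` segment y z) d by rewrite e.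
  by split; [apply/(seg_up _ yd)|apply/(seg_up _ yz)]; split=> //; exact: berk_le_refl.
apply: nzy; suff : (segment y d `&` segment y z) z by rewrite e.
by split; [apply/(seg_up _ yd)|apply/(seg_up _ yz)]; split=> //; exact: berk_le_refl.
Qed.

Let cls_down d z u : d \in ds -> berk_le d z -> berk_le z y -> z <> y ->
  cls z u <-> [/\ berk_le d u, berk_le u y & u <> y].
Proof.
move=> dds dz zy nzy; have dy := berk_le_trans dz zy; split.
  move=> [Yu nuy h].
  have nyu : ~ berk_le y u.
    move=> yu; apply: h; apply/seteqP; split=> u' /=.
      by move=> [/(seg_down _ zy)[_ uy] /(seg_up _ yu)[yu' _]]; exact: berk_le_anti.
    move=> ->; split; first by apply/(seg_down _ zy); split=> //; exact: berk_le_refl.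
    by apply/(seg_up _ yu); split=> //; exact: berk_le_refl.
  have [//|[d' d'ds [d'y d'u]]] := Y_cases Yu.
  have [//|uy] := Y_comp Yu.
  have [dd'|dd'] := pselect (d = d'); first by rewrite dd'.
  exfalso; apply: h; apply/seteqP; split=> u' /=.
    move=> [/(seg_down _ zy)[zu' u'y] /(seg_down _ uy)[uu' _]].
    apply: berk_le_anti => //; apply: (ds_down dds d'ds) => //.
      exact: berk_le_trans zu'.
    exact: berk_le_trans uu'.
  move=> ->; split; first by apply/(seg_down _ zy); split=> //; exact: berk_le_refl.
  by apply/(seg_down _ uy); split=> //; exact: berk_le_refl.
move=> [du uy nuy]; split=> //; first by exists d => //; rewrite /= inE dds orbT.
move=> e; have := chain_tot dz du => -[zu|uz].
  apply: nuy; suff : (segment y z `&` segment y u) u by rewrite e.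
  by split; [apply/(seg_down _ zy)|apply/(seg_down _ uy)]; split=> //; exact: berk_le_refl.
apply: nzy; suff : (segment y z `&` segment y u) z by rewrite e.
by split; [apply/(seg_down _ zy)|apply/(seg_down _ uy)]; split=> //; exact: berk_le_refl.
Qed.

Let cls_self d : d \in ds -> cls d d.
Proof.
move=> dds; have [id ndy [yd|dy]] := ds_inner dds; first exact/(cls_up _ yd ndy).
have dd := @berk_le_refl _ _ d.
by apply/(cls_down _ dds dd dy ndy).
Qed.

Let cls_inj d d' : d \in ds -> d' \in ds -> cls d = cls d' -> d = d'.
Proof.
move=> dds d'ds e; have := cls_self dds; rewrite e.
have [_ nd'y [yd'|d'y]] := ds_inner d'ds.
  by move=> /(cls_up _ yd' nd'y)[yd _]; exact: ds_up.
move=> /(cls_down _ d'ds (@berk_le_refl _ _ d') d'y nd'y)[d'd dy ndy]; apply: contrapT => ne.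
have := ds_down dds d'ds ne dy d'y (@berk_le_refl _ _ d) d'd.
by move=> yd; apply: ndy; exact: berk_le_anti.
Qed.

Let tangent_cls : tangent_dirs Y y = [set cls d | d in [set` ds]].
Proof.
apply/seteqP; split=> V /=; last first.
  by move=> [d dds <-]; exists d; have [_ ? _] := ds_inner dds; split=> //; exact: Yds.
move=> [z [Yz nzy ->]].
suff [d dds dE] : exists2 d, d \in ds & forall u, cls z u <-> cls d u.
  by exists d => //; apply/seteqP; split=> u /dE.
have up : berk_le y z -> exists2 d, d \in ds & forall u, cls z u <-> cls d u.
  move=> yz; have yG : y <> gauss_pt k.
    by move=> yG; apply: nzy; apply: berk_le_anti => //; rewrite yG; exact: le_gauss.
  have [d dds yd] := ds_up_ex yG.
  have [_ ndy _] := ds_inner dds; exists d => // u.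
  by split=> [/(cls_up _ yz nzy)|/(cls_up _ yd ndy)] h; [apply/(cls_up _ yd ndy)|apply/(cls_up _ yz nzy)].
have [/up//|[d dds [dy dz]]] := Y_cases Yz.
have [/up//|zy] := Y_comp Yz.
have [_ ndy _] := ds_inner dds; exists d => // u.
have dd := @berk_le_refl _ _ d.
by split=> [/(cls_down _ dds dz zy nzy)|/(cls_down _ dds dd dy ndy)] h;
  [apply/(cls_down _ dds dd dy ndy)|apply/(cls_down _ dds dz zy nzy)].
Qed.

Let cls_dir d : d \in ds -> (dir_derivative C phi y (cls d) <= (dquot y d)%:E)%E.
Proof.
move=> dds; have [id ndy cd] := ds_inner dds.
have clsy z : cls d z -> [/\ inner z, z <> y & berk_le y z \/ berk_le z y].
  by move=> [Yz nz _]; split=> //; [exact: Y_inner|exact: Y_comp].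
apply: dir_derivative_le => //; last exact: cls_self.
- move=> A yA; have [yd|dy] := cd.
    have [w [s [ws s0 yE]]] := iy; rewrite yE in yA yd.
    have [wd sd dE] := inner_above ws yd.
    have sd' : s <> rad d by move=> e; apply: ndy; rewrite yE e -dE.
    have [r [r1 [r2 Ar]]] := nbhs_between ws wd sd' yA.
    rewrite (min_idPl sd) in r1; rewrite (max_idPr sd) in r2.
    have wr : nice w r by apply: nice_mono ws (ltW r1) _; rewrite (le_trans (ltW r2))// rad_le1.
    exists (pt w r) => //; rewrite -yE in yd; apply/(cls_up _ yd ndy); rewrite yE.
    split; first by apply/pt_le_same => //; exact: ltW.
    move=> e; have := rad_pt k_complete wr; rewrite e rad_pt// => e'.
    by rewrite e' ltxx in r1.
  have [w [s [ws s0 dE]]] := id; rewrite dE in dy.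
  have [wy sy yE] := inner_above ws dy.
  have sd' : rad y <> s by move=> e; apply: ndy; rewrite dE -e -yE.
  rewrite yE in yA; have [r [r1 [r2 Ar]]] := nbhs_between wy ws sd' yA.
  rewrite (min_idPr sy) in r1; rewrite (max_idPl sy) in r2.
  have wr : nice w r by apply: nice_mono ws (ltW r1) _; rewrite (le_trans (ltW r2))// rad_le1.
  exists (pt w r) => //; rewrite -dE in dy; apply/(cls_down _ dds (@berk_le_refl _ _ d) dy ndy).
  split; first by rewrite dE; apply/pt_le_same => //; exact: ltW.
    by rewrite yE; apply/pt_le_same => //; exact: ltW.
  move=> e; have := rad_pt k_complete wr; rewrite e => e'.
  by rewrite e' ltxx in r2.
- move=> z1 cz1; have [iz1 nz1 _] := clsy z1 cz1; have [yd|dy] := cd.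
    have [yz1 _] := (cls_up z1 yd ndy).1 cz1.
    apply: filterS (near_le iy yz1 (fun e => nz1 (esym e))) => z h cz.
    have [yz nz] := (cls_up z yd ndy).1 cz; rewrite !dquot_up//.
    by apply: slope_le_r => //; [exact: nesym|exact: h].
  have dd := @berk_le_refl _ _ d.
  have [dz1 z1y _] := (cls_down z1 dds dd dy ndy).1 cz1.
  apply: filterS (near_ge id dz1 z1y nz1) => z h cz.
  have [dz zy nz] := (cls_down z dds dd dy ndy).1 cz; rewrite !dquot_down//.
    by rewrite lerN2; apply: slope_le_l => //; exact: h.
  exact: inner_up dz.
Qed.

(** In the tree spanned by [y] and [ds] the tangent directions at [y] are exactly those of the
    members of [ds], and each derivative is at most the chord quotient. An admissible tree has an
    upward direction at every [y] other than x_G, hence the hypothesis [ds_up_ex]. *)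
Lemma star_core : 0 <= c * (y == gauss_pt k)%:R + \sum_(d <- ds) dquot y d.
Proof.
have Ya : admissible_subtree C Y.
  apply: (upset_admissible k_complete).
    by apply/finite_seqP; exists (y :: ds).
    by exists y; rewrite /= inE eqxx.
  move=> u /=; rewrite inE => /orP[/eqP ->|/ds_inner[iu _ _]]; exact: nonrigid_inner.
case: (hphi) => [_ _ /(_ _ Ya)[_ _ /(_ _ Yy) h] _]; move: h.
rewrite tangent_cls fsbig_image/=; last first.
  by move=> a b /set_mem /= ha /set_mem /= hb; exact: cls_inj.
rewrite -fsbig_seq// -lee_fin EFinD => /le_trans; apply.
rewrite leeD2l//.
rewrite -sumEFin big_seq [leRHS]big_seq.
by apply: lee_sum => d; exact: cls_dir.
Qed.

End Star.

Definition branches y zs := [/\ uniq zs,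
  forall z, z \in zs -> [/\ inner z, berk_le z y & z <> y] &
  forall a b u, a \in zs -> b \in zs -> a <> b -> berk_le a u -> berk_le b u -> berk_le y u].

(** The chords going down have quotient minus the upward slope, so the star inequality becomes a
    balance: the slopes arriving from distinct branches add up to at most the slope leaving [y]. *)
Lemma star_slope y zs u : inner y -> branches y zs -> berk_le y u -> y <> u ->
  \sum_(z <- zs) slope z y <= slope y u.
Proof.
move=> iy [uz hz hb] yu nyu; have iu := inner_up iy yu.
have nuz : u \notin zs.
  by apply/negP => /hz[_ uy _]; apply: nyu; exact: berk_le_anti.
have nyG : y <> gauss_pt k.
  by move=> yG; apply: nyu; apply: berk_le_anti => //; rewrite yG; exact: le_gauss.
have notup a : a \in zs -> ~ berk_le y a.
  by move=> /hz[_ ay nay] ya; apply: nay; exact: berk_le_anti.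
have := @star_core y (u :: zs) iy; rewrite /= nuz uz big_cons => /(_ isT).
have -> : (y == gauss_pt k) = false by apply/eqP.
rewrite mulr0 add0r (dquot_up iy yu) => h.
rewrite -subr_ge0 -sumrN; have -> : \sum_(z <- zs) - slope z y = \sum_(z <- zs) dquot y z.
  by rewrite !big_seq; apply: eq_bigr => z /hz[iz zy _]; rewrite dquot_down.
apply: h.
- move=> d; rewrite inE => /orP[/eqP ->|/hz[? ? ?]]; split=> //; [exact: nesym|by left|by right].
- move=> a b v'; rewrite !inE => /orP[/eqP ->|az] /orP[/eqP ->|bz] // ab ay byy.
  + by exfalso; apply: nyu; exact: berk_le_anti.
  + by exfalso; apply: nyu; exact: berk_le_anti.
  + exact: hb.
- move=> a b; rewrite !inE => /orP[/eqP ->|az] /orP[/eqP ->|bz] // ya yb.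
  + by have := notup _ bz.
  + by have := notup _ az.
  + by have := notup _ az.
- by move=> _; exists u => //; rewrite inE eqxx.
Qed.

Lemma star_gauss zs : branches (gauss_pt k) zs ->
  \sum_(z <- zs) slope z (gauss_pt k) <= c.
Proof.
move=> [uz hz hb]; have iG := inner_gauss.
have notup a : a \in zs -> ~ berk_le (gauss_pt k) a.
  by move=> /hz[_ ay nay] ya; apply: nay; exact: berk_le_anti.
have := @star_core (gauss_pt k) zs iG uz; rewrite eqxx mulr1 => h.
rewrite -subr_ge0 -sumrN; have -> : \sum_(z <- zs) - slope z (gauss_pt k) = \sum_(z <- zs) dquot (gauss_pt k) z.
  by rewrite !big_seq; apply: eq_bigr => z /hz[iz zy _]; rewrite dquot_down.
apply: h => //.
- by move=> d /hz[? ? ?]; split=> //; right.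
- by move=> a b u az bz ab _ _; exact: hb.
- by move=> a b /notup.
Qed.

End Subharmonic.
End Slopes.

(** * Mass below a point and its superadditivity *)

Section Mass.
Variables (R : realType) (k : valuedField R) (C : completedAlgClosure k).
Hypothesis k_complete : vf_complete k.

Local Notation La := (kav C).
Local Notation dst := (@dst R k C).
Local Notation pt := (@pt R k C).
Local Notation rad := (rad C).
Local Notation inner := (@inner R k C).
Implicit Types (w : La) (s t r : R) (x y u v z : berk k) (zs : seq (berk k)).

Lemma chain_comparable x y z : berk_le x y -> berk_le x z -> berk_le y z \/ berk_le z y.
Proof. exact: (chain_total C k_complete). Qed.

(** The join is the smallest disc about [w], of radius at least that of [a], which lies above
    [b]. *)
Lemma berk_joinP a b : inner a -> [/\ berk_le a (berk_join a b),
  berk_le b (berk_join a b) &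
  forall u, berk_le a u -> berk_le b u -> berk_le (berk_join a b) u].
Proof.
move=> [w [s [ws s0 aE]]]; pose r := Num.max s (dst b w).
have wr : nice w r.
  have [w1 /andP[_ s1]] := ws.
  by apply: (nice_mono ws); rewrite ?le_max ?lexx// ge_max s1 dst_le1.
have h : [set z | [/\ berk_le a z, berk_le b z &
    forall u, berk_le a u -> berk_le b u -> berk_le z u]] (pt w r).
  split.
  - by rewrite aE; apply/pt_le_same => //; rewrite le_max lexx.
  - by apply/(le_pt k_complete) => //; rewrite le_max lexx orbT.
  - move=> u au bu; rewrite aE in au; have [wu su uE] := inner_above k_complete ws au.
    rewrite uE; apply/pt_le_same => //; rewrite ge_max su/=.
    by apply/(le_pt k_complete) => //; rewrite -uE.
by rewrite /berk_join; case: xgetP => [y _ //|/(_ (pt w r))[]].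
Qed.

Definition antichain zs := uniq zs /\
  forall a b, a \in zs -> b \in zs -> berk_le a b -> a = b.

Section Subharmonic.
Variables (c : R) (phi : berk k -> \bar R).
Hypotheses (hphi : subharmonic C c phi) (c0 : 0 <= c).

Local Notation slope := (@slope R k C phi).

Lemma slope_ge0 y u : inner y -> berk_le y u -> y <> u -> 0 <= slope y u.
Proof.
move=> iy yu nyu; have := @star_slope _ _ _ k_complete _ _ hphi y [::] u iy.
by rewrite big_nil; apply.
Qed.

(* The total mass of the Laplacian of phi below z. *)
Definition mass z : R := if z == gauss_pt k then c
  else inf [set slope z u | u in [set u | berk_le z u /\ z <> u]].

Let has_inf_slope z : inner z -> z <> gauss_pt k ->
  has_inf [set slope z u | u in [set u | berk_le z u /\ z <> u]].
Proof.
move=> iz zG; split.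
  by exists (slope z (gauss_pt k)), (gauss_pt k) => //; split=> //; exact: le_gauss.
by exists 0 => _ [u [zu nzu] <-]; exact: slope_ge0.
Qed.

Lemma mass_le z u : inner z -> berk_le z u -> z <> u -> mass z <= slope z u.
Proof.
move=> iz zu nzu; rewrite /mass; case: eqP => zG.
  by exfalso; apply: nzu; apply: berk_le_anti => //; rewrite zG; exact: le_gauss.
by apply: ge_inf; [exact: (has_inf_slope iz zG).2|exists u].
Qed.

Lemma branches_mass y zs : inner y -> branches C y zs ->
  \sum_(z <- zs) slope z y <= mass y.
Proof.
move=> iy h; rewrite /mass; case: eqP => yG.
  by rewrite yG; apply: star_gauss => //; rewrite -yG.
apply: lb_le_inf; first exact: (has_inf_slope iy yG).1.
by move=> _ [u [yu nyu] <-]; exact: (star_slope k_complete hphi).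
Qed.

Lemma mass_ge0 y : inner y -> 0 <= mass y.
Proof. by move=> iy; have := @branches_mass y [::] iy; rewrite big_nil; apply. Qed.

Lemma slope_le_mass z y : inner z -> berk_le z y -> z <> y -> slope z y <= mass y.
Proof.
move=> iz zy nzy; have := @branches_mass y [:: z] (inner_up k_complete iz zy).
rewrite big_seq1; apply; split=> //; first by move=> a; rewrite inE => /eqP ->.
by move=> a b u; rewrite !inE => /eqP -> /eqP ->.
Qed.

Lemma mass_mono z y : inner z -> berk_le z y -> mass z <= mass y.
Proof.
move=> iz zy; have [->//|nzy] := pselect (z = y).
by apply: le_trans (mass_le iz zy nzy) _; exact: slope_le_mass.
Qed.

Lemma mass_lec z : inner z -> mass z <= c.
Proof.
move=> iz; have := mass_mono iz (le_gauss z).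
by rewrite {2}/mass eqxx.
Qed.

Lemma mass_lt_slope z (a : R) : inner z -> z <> gauss_pt k -> mass z < a ->
  exists u, [/\ berk_le z u, z <> u &
    forall u', berk_le z u' -> z <> u' -> berk_le u' u -> slope z u' < a].
Proof.
move=> iz zG; rewrite /mass; case: eqP => // _.
move=> /(inf_lt (has_inf_slope iz zG).1)[_ [u [zu nzu] <-] h]; exists u; split=> //.
move=> u' zu' nzu' u'u; apply: le_lt_trans h.
exact: (slope_le_r k_complete hphi).
Qed.

(** By induction on the size: a lowest join [j] of two members replaces all members below it, whose
    masses add up to at most the mass of [j] by the star inequality. *)
Lemma mass_superadditive y zs : inner y -> antichain zs ->
  (forall z, z \in zs -> inner z /\ berk_le z y) -> \sum_(z <- zs) mass z <= mass y.
Proof.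
move=> iy; have [n] := ubnP (size zs); elim: n zs => // n ih zs szn [uz az] hz.
have [[[a b] [/= azs bzs nab]]|none] :=
    pselect (exists ab : berk k * berk k, [/\ ab.1 \in zs, ab.2 \in zs & ab.1 <> ab.2]); last first.
  case: zs uz {az szn ih} hz none => [|z [|z' zs]] uz hz none.
  - by rewrite big_nil mass_ge0.
  - by rewrite big_seq1; have [iz zy] := hz z (mem_head _ _); exact: mass_mono.
  - exfalso; apply: none; exists (z, z'); rewrite !inE !eqxx orbT; split=> //= e.
    by move: uz; rewrite e /= inE eqxx.
pose prs := [seq ab <- [seq (p, q) | p <- zs, q <- zs] | ab.1 != ab.2].
have abp : (a, b) \in prs.
  by rewrite mem_filter /=; apply/andP; split; [apply/eqP|apply/allpairsP; exists (a, b)].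
(* Minimality of the radius of the join forces any two members below [j] to have join exactly [j],
   so they lie in distinct branches there. *)
have [[p q] pq jmin] := seq_argmin (fun ab => rad (berk_join ab.1 ab.2)) abp.
have prsE p' q' : (p', q') \in prs <-> [/\ p' \in zs, q' \in zs & p' <> q'].
  rewrite mem_filter; split.
    by move=> /andP[/eqP ne /allpairsP[[e1 e2] [/= h1 h2 [hp hq]]]]; subst.
  move=> [h1 h2 ne]; apply/andP; split; first exact/eqP.
  by apply/allpairsP; exists (p', q').
have [pz qz npq] := (prsE p q).1 pq.
have [[ip py] [iq qy]] := (hz p pz, hz q qz).
have [pj qj jleast] := berk_joinP q ip.
rewrite /= in jmin; move: (berk_join p q) jmin pj qj jleast => j jmin pj qj jleast.
have ij : inner j := inner_up k_complete ip pj.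
pose I := [seq z <- zs | `[< berk_le z j >]].
pose J := [seq z <- zs | ~~ `[< berk_le z j >]].
have IE z : z \in I <-> z \in zs /\ berk_le z j.
  by rewrite mem_filter; split=> [/andP[/asboolP]|[? ?]] //; apply/andP; split=> //; exact/asboolP.
have JE z : z \in J <-> z \in zs /\ ~ berk_le z j.
  by rewrite mem_filter; split=> [/andP[/asboolPn]|[? ?]] //; apply/andP; split=> //; exact/asboolPn.
have bI : branches C j I.
  split; first exact: filter_uniq.
    move=> z /IE[zz zj]; split=> //; first by have [] := hz z zz.
    move=> e; rewrite -e in pj qj; apply: npq.
    by rewrite (az _ _ pz zz pj) (az _ _ qz zz qj).
  move=> z z' u /IE[zz zj] /IE[zz' zj'] nzz zu zu'.
  have iz : inner z by have [] := hz z zz.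
  have [h1 h2 h3] := berk_joinP z' iz.
  have /jmin /= jr : (z, z') \in prs by apply/prsE.
  have -> : j = berk_join z z'; last exact: h3.
  by apply/esym/(@rad_eq _ _ C k_complete); [exact: h3|apply/eqP; rewrite eq_le jr andbT rad_mono//; exact: h3].
have mI : \sum_(z <- I) mass z <= mass j.
  apply: le_trans (branches_mass ij bI); rewrite big_seq [leRHS]big_seq.
  by apply: ler_sum => z zI; have [_ h _] := bI; have [iz zj nzj] := h z zI; exact: mass_le.
have -> : \sum_(z <- zs) mass z = \sum_(z <- I) mass z + \sum_(z <- J) mass z.
  by rewrite (bigID (fun z => `[< berk_le z j >])) /= !big_filter.
have jJ : j \notin J by apply/negP => /JE[_]; apply; exact: berk_le_refl.
apply: (@le_trans _ _ (\sum_(z <- j :: J) mass z)); first by rewrite big_cons lerD2r.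
apply: ih.
(* At least [p] and [q] are merged into [j], so the antichain gets shorter. *)
- have : (size I + size J = size zs)%N by rewrite !size_filter count_predC.
  have : (1 < size I)%N.
    have : {subset [:: p; q] <= I}.
      by move=> z; rewrite !inE => /orP[/eqP|/eqP] ->; apply/IE.
    by move=> /(uniq_leq_size _); apply; rewrite /= inE andbT; apply/eqP.
  by move: szn => /=; lia.
- split; first by rewrite /= jJ filter_uniq.
  move=> z z'; rewrite !inE => /orP[/eqP ->|/JE[zz nzj]] /orP[/eqP ->|/JE[zz' nzj']] //.
  + move=> jz'; exfalso; apply: nzj'.
    by rewrite -(az _ _ pz zz')//; exact: berk_le_trans jz'.
  + exact: az.
- move=> z; rewrite inE => /orP[/eqP ->|/JE[/hz//]]; split=> //; exact: jleast.
Qed.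

End Subharmonic.
End Mass.

(** * Polynomials with prescribed zeros *)

Section Greedy.
Variables (R : realType) (k : valuedField R) (C : completedAlgClosure k).
Hypothesis k_complete : vf_complete k.

Local Notation La := (kav C).
Local Notation dst := (@dst R k C).
Local Notation pt := (@pt R k C).
Local Notation rad := (rad C).
Local Notation inner := (@inner R k C).
Local Notation mult := (mult C).
Implicit Types (w : La) (s t r : R) (x y u v z : berk k) (zs : seq (berk k)).

Lemma inner_mult_dvd z y : inner z -> berk_le z y -> (mult y %| mult z)%N.
Proof.
move=> [w [s [ws s0 ->]]] zy; have [wr sr ->] := inner_above k_complete ws zy.
exact: mult_dvd.
Qed.

Lemma inner_mult_gt0 z : inner z -> (0 < mult z)%N.
Proof. by move=> [w [s [ws s0 ->]]]; exact: mult_gt0. Qed.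

(* Number of zeros below z of the product of the mpoly w ^ n, (w, n) in D. *)
Definition zeros (D : seq (La * nat)) z : nat :=
  (\sum_(p <- D) (if (dst z p.1 <= rad z)%R then (p.2 * mdeg p.1)%N else 0%N))%N.

Lemma zero_up w z y : dst z w <= rad z -> berk_le z y -> dst y w <= rad y.
Proof.
move=> zw zy; have := dst_above k_complete w zy.
by rewrite le_max => /orP[//|h]; rewrite (le_trans h)// (le_trans zw)// rad_mono.
Qed.

Lemma zero_comparable w z y : dst z w <= rad z -> dst y w <= rad y ->
  inner z -> inner y -> vabs w <= 1 -> berk_le z y \/ berk_le y z.
Proof.
move=> zw yw iz iy w1.
have zE := above_eq k_complete w1 (@berk_le_refl _ _ z) zw.
have yE := above_eq k_complete w1 (@berk_le_refl _ _ y) yw.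
have nz : nice w (rad z) by split=> //; rewrite rad_ge0 rad_le1.
have ny : nice w (rad y) by split=> //; rewrite rad_ge0 rad_le1.
have [h|/ltW h] := leP (rad z) (rad y); [left|right]; rewrite zE yE;
  exact/pt_le_same.
Qed.

Variables (x : berk k) (q : R).
Hypothesis q1 : 1 < q.
Hypothesis tame : forall z, inner z ->
  exists w, [/\ vabs w <= 1, dst z w <= rad z & mdeg w = mult z].
Hypothesis tame_lim : forall (Q : set (berk k)) mu, Q !=set0 ->
  (forall z, Q z -> inner z /\ mult z = mu) ->
  (forall z z', Q z -> Q z' -> berk_le z z' \/ berk_le z' z) ->
  (forall e : R, 0 < e -> exists2 z, Q z & rad z < e) ->
  exists w, [/\ vabs w <= 1, mdeg w = mu & forall z, Q z -> dst z w <= rad z].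

Let Z z := inner z /\ ~ berk_le x z.

Definition divisible (F : berk k -> nat) := forall z, Z z -> (mult z %| F z)%N.

Definition superadditive (F : berk k -> nat) := forall y zs, inner y -> antichain zs ->
  (forall z, z \in zs -> Z z /\ berk_le z y) -> (\sum_(z <- zs) F z <= F y)%N.

Lemma antichain1 z : antichain [:: z].
Proof. by split=> // a b; rewrite !inE => /eqP -> /eqP ->. Qed.

Lemma superadditive_mono F z y : superadditive F -> Z z -> berk_le z y -> (F z <= F y)%N.
Proof.
move=> sF Zz zy; have iy := inner_up k_complete Zz.1 zy.
have := sF y [:: z] iy (antichain1 z); rewrite big_seq1; apply=> a.
by rewrite inE => /eqP ->.
Qed.

Section Step.
Variables (F : berk k -> nat) (z3 : berk k) (d : nat).
Hypotheses (dF : divisible F) (sF : superadditive F) (Z3 : Z z3) (F3 : F z3 = d).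

(** What remains to be served after [d] zeros are placed in [z3]. Values below [z3] are at most [d]
    and are dropped: in [greedy] a positive one equals [d] and is met by these zeros, up to a window
    of radii. *)
Definition reduce z : nat := if `[< berk_le z3 z >] then (F z - d)%N else
  if `[< berk_le z z3 >] then 0%N else F z.

Let reduce_ge z : berk_le z3 z -> reduce z = (F z - d)%N.
Proof. by rewrite /reduce; case: asboolP. Qed.

Let reduce_lt z : ~ berk_le z3 z -> berk_le z z3 -> reduce z = 0%N.
Proof. by rewrite /reduce; case: asboolP => // _; case: asboolP. Qed.

Let reduce_id z : ~ berk_le z3 z -> ~ berk_le z z3 -> reduce z = F z.
Proof. by rewrite /reduce; case: asboolP => // _; case: asboolP. Qed.

Let Fge z : berk_le z3 z -> (d <= F z)%N.
Proof. by move=> h; rewrite -F3; exact: superadditive_mono. Qed.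

Lemma reduce_divisible : divisible reduce.
Proof.
move=> z Zz; rewrite /reduce; case: asboolP => [z3z|_]; last by case: asboolP => // _; exact: dF.
rewrite dvdn_subl ?dF//; first exact: Fge.
by rewrite -F3 (dvdn_trans (inner_mult_dvd Z3.1 z3z))// dF.
Qed.

Lemma reduce_superadditive : superadditive reduce.
Proof.
move=> y zs iy [uz az] hz.
have below z : z \in zs -> berk_le z y by move=> /hz[].
have [z3y|nz3y] := pselect (berk_le z3 y); last first.
  have nge z : z \in zs -> ~ berk_le z3 z.
    by move=> /below zy h; apply: nz3y; exact: berk_le_trans zy.
  have [yz3|nyz3] := pselect (berk_le y z3).
    rewrite big_seq big1// => z zz; apply: reduce_lt; first exact: nge.
    exact: berk_le_trans (below z zz) yz3.
  rewrite (reduce_id nz3y nyz3) (eq_big_seq F); first exact: sF.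
  move=> z zz; apply: reduce_id; first exact: nge.
  by move=> h; have [] := chain_comparable C k_complete h (below z zz).
rewrite (reduce_ge z3y).
have [[z zz z3z]|none] := pselect (exists2 z, z \in zs & berk_le z3 z).
  rewrite (big_rem z)//= reduce_ge// (eq_big_seq F); last first.
    move=> z' ; rewrite mem_rem_uniq// inE => /andP[/eqP nz z'z].
    apply: reduce_id => h; apply: nz.
      have [zz'|zz'] := chain_comparable C k_complete z3z h; first exact/esym/az.
      exact: az.
    by apply: az => //; exact: berk_le_trans z3z.
  have := sF iy (conj uz az) hz; rewrite (big_rem z)//=.
  have := Fge z3z; move: (F z) (F y) (\sum_(_ <- _) _)%N => a b e; lia.
(* The members of the antichain below [z3] are traded for [z3] itself, whose value [d] is what
   [reduce] subtracts at [y]. *)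
pose I := [seq z <- zs | ~~ `[< berk_le z z3 >]].
have IE z : z \in I <-> z \in zs /\ ~ berk_le z z3.
  by rewrite mem_filter; split=> [/andP[/asboolPn]|[? ?]] //; apply/andP; split=> //; exact/asboolPn.
have nI : z3 \notin I by apply/negP => /IE[_]; apply; exact: berk_le_refl.
have -> : (\sum_(z <- zs) reduce z = \sum_(z <- I) F z)%N.
  rewrite /I big_filter [RHS]big_mkcond; apply: eq_big_seq => z zz.
  have nge : ~ berk_le z3 z by move=> h; apply: none; exists z.
  by case: asboolP => h /=; [rewrite reduce_lt|rewrite reduce_id].
have := sF (zs := z3 :: I) iy; rewrite big_cons F3 => h.
rewrite leq_subRL ?Fge//; apply: h.
  split; first by rewrite /= nI filter_uniq.
  move=> a b; rewrite !inE => /orP[/eqP ->|/IE[aa nha]] /orP[/eqP ->|/IE[bb nhb]] //.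
  - by move=> h; exfalso; apply: none; exists b.
  - exact: az.
by move=> a; rewrite inE => /orP[/eqP ->|/IE[/hz]].
Qed.

End Step.

(** [D] lists centres with exponents, [rs] the windows of radii in which the zeros may miss a disc.
    Each round lowers [F] at x_G by d >= 1 and opens at most one window, which bounds the number of
    windows. *)
Lemma greedy (F : berk k -> nat) : divisible F -> superadditive F ->
  exists (D : seq (La * nat)) (rs : seq R),
  [/\ (size rs <= F (gauss_pt k))%N,
      forall r, r \in rs -> 0 < r,
      forall p, p \in D -> 0 < dst x p.1,
      forall z, Z z -> (F z <= zeros D z)%N \/
        exists2 r, r \in rs & r <= rad z < r * q &
      forall u, inner u -> berk_le x u -> (zeros D u <= F u)%N].
Proof.
have [n] := ubnP (F (gauss_pt k)); elim: n F => // n ih F Fn dF sF.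
have [[z0 [Z0 F0]]|none] := pselect (exists z, Z z /\ (0 < F z)%N); last first.
  exists [::], [::]; split=> // z Zz; last by rewrite /zeros big_nil.
  by left; rewrite leqNgt; apply/negP => h; apply: none; exists z; rewrite (leq_trans _ h).
(* The least positive value off the path: inside a disc of value [d], every disc has value [d] or
   0. *)
have exd : exists d, `[< exists z, [/\ Z z, (0 < F z)%N & F z = d] >].
  by exists (F z0); apply/asboolP; exists z0.
case: (ex_minnP exd) => d /asboolP[z1 [Z1 F1 Fd]] dmin.
have d0 : (0 < d)%N by rewrite -Fd.
have Fmin z : Z z -> (0 < F z)%N -> (d <= F z)%N.
  by move=> Zz Fz; apply: dmin; apply/asboolP; exists z.
(* Multiplicities of discs of value [d] divide [d], hence are bounded. Below a disc of maximal
   multiplicity they are constant, since they can only grow downwards. *)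
have exm : exists m, `[< exists z, [/\ Z z, F z = d, berk_le z z1 & mult z = m] >].
  by exists (mult z1); apply/asboolP; exists z1; split=> //; exact: berk_le_refl.
have bm m : `[< exists z, [/\ Z z, F z = d, berk_le z z1 & mult z = m] >] -> (m <= d)%N.
  by move=> /asboolP[z [Zz zd _ <-]]; rewrite dvdn_leq// -zd dF.
case: (ex_maxnP exm bm) => m /asboolP[z2 [Z2 F2 z21 m2]] mmax.
pose Q : set (berk k) := [set z | [/\ Z z, F z = d & berk_le z z2]].
have Q2 : Q z2 by split=> //; exact: berk_le_refl.
have Qm z : Q z -> inner z /\ mult z = m.
  move=> [Zz Fz zz2]; split; first by case: Zz.
  apply/eqP; rewrite eqn_leq; apply/andP; split.
    by apply: mmax; apply/asboolP; exists z; split=> //; exact: berk_le_trans z21.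
  by rewrite -m2 dvdn_leq ?inner_mult_dvd ?inner_mult_gt0//; case: Zz.
(* Two incomparable members would give F z2 >= 2 d by superadditivity. *)
have Qtot z z' : Q z -> Q z' -> berk_le z z' \/ berk_le z' z.
  move=> [Zz Fz zz2] [Zz' Fz' zz2']; apply: contrapT => /not_orP[h1 h2].
  have nzz : z <> z' by move=> e; apply: h1; rewrite e; exact: berk_le_refl.
  have := sF z2 [:: z; z'] Z2.1; rewrite !big_cons big_nil Fz Fz' F2 => h.
  suff : (d + (d + 0) <= d)%N by lia.
  apply: h.
    split; first by rewrite /= inE andbT; exact/eqP.
    by move=> a b; rewrite !inE => /orP[/eqP ->|/eqP ->] /orP[/eqP ->|/eqP ->].
  by move=> a; rewrite !inE => /orP[/eqP ->|/eqP ->].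
have [rs0 [z3 [w [Q3 rs0s rs0p [w1 w3 mw] Qw]]]] : exists (rs0 : seq R) z3 w,
    [/\ Q z3, (size rs0 <= 1)%N, forall r, r \in rs0 -> 0 < r,
      [/\ vabs w <= 1, dst z3 w <= rad z3 & mdeg w = m] &
      forall z, Q z -> berk_le z z3 ->
        dst z w <= rad z \/ exists2 r, r \in rs0 & r <= rad z < r * q].
  have iQ : has_inf [set rad z | z in Q].
    split; first by exists (rad z2), z2.
    by exists 0 => _ [z _ <-]; exact: rad_ge0.
  pose rho := inf [set rad z | z in Q].
  have rhole z : Q z -> rho <= rad z by move=> Qz; apply: ge_inf; [exact: iQ.2|exists z].
  have rho0 : 0 <= rho by apply: lb_le_inf; [exact: iQ.1|move=> _ [z _ <-]; exact: rad_ge0].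
  have [rho_gt0|rho_le0] := ltP 0 rho.
    (* The infimum of the radii may not be attained in [Q]. A member within the factor [q] of it is
       chosen; the members below it have their radii in the window. *)
    have : rho < rho * q by rewrite ltr_pMr.
    move=> /(inf_lt iQ.1)[_ [z3 Q3 <-] z3q].
    have [w [w1 w3 mw]] := tame (Qm _ Q3).1.
    exists [:: rho], z3, w; split=> //; first by move=> r; rewrite inE => /eqP ->.
      by rewrite mw; split=> //; exact: (Qm _ Q3).2.
    move=> z Qz zz3; right; exists rho; rewrite ?inE// rhole//=.
    by apply: le_lt_trans z3q; exact: rad_mono.
  (* If the radii tend to 0, one algebraic point of degree [m] lies in all members of [Q], and no
     window is opened. *)
  have [|w [w1 mw Qw]] := tame_lim (ex_intro _ z2 Q2) Qm Qtot.
    move=> e e0; have : rho < e by exact: le_lt_trans e0.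
    by move=> /(inf_lt iQ.1)[_ [z Qz <-] ze]; exists z.
  exists [::], z2, w; split=> //; first by split=> //; exact: Qw.
  by move=> z Qz _; left; exact: Qw.
have [Z3 F3 z32] := Q3.
have md : (m %| d)%N by rewrite -F3 -(Qm _ Q3).2 dF.
have rG : reduce F z3 d (gauss_pt k) = (F (gauss_pt k) - d)%N.
  by rewrite /reduce; case: asboolP => // -[]; exact: le_gauss.
have dG : (d <= F (gauss_pt k))%N.
  by rewrite -F3; apply: superadditive_mono => //; exact: le_gauss.
have [|D [rs [rss rsp Dx DZ Du]]] := ih _ _ (reduce_divisible dF sF Z3 F3)
    (reduce_superadditive sF Z3 F3).
  by rewrite rG; lia.
(* The exponent d / m of a polynomial of degree exactly [m] produces exactly [d] zeros. *)
have zerosE z : zeros ((w, (d %/ m)%N) :: D) z =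
    ((if (dst z w <= rad z)%R then d else 0) + zeros D z)%N.
  by rewrite /zeros big_cons /= mw divnK.
(* The disc [z3] contains [w] and is not above [x], so the new factor does not vanish at [x]. *)
have wx : 0 < dst x w.
  rewrite lt_def dst_ge0 andbT; apply/eqP => xw0; apply: Z3.2.
  have nz : nice w (rad z3) by split=> //; rewrite rad_ge0 rad_le1.
  rewrite (above_eq k_complete w1 (@berk_le_refl _ _ z3) w3).
  by apply/(le_pt k_complete) => //; rewrite xw0 rad_ge0.
exists ((w, (d %/ m)%N) :: D), (rs0 ++ rs); split.
- by rewrite size_cat; move: rss; rewrite rG; lia.
- by move=> r; rewrite mem_cat => /orP[/rs0p|/rsp].
- by move=> p; rewrite inE => /orP[/eqP ->|/Dx].
- move=> z Zz; rewrite zerosE.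
  have [z3z|nz3z] := pselect (berk_le z3 z).
    have := DZ z Zz; rewrite /reduce; case: asboolP => // _ -[h|[r rrs rz]].
      by left; rewrite (zero_up w3 z3z); lia.
    by right; exists r => //; rewrite mem_cat rrs orbT.
  have [zz3|nzz3] := pselect (berk_le z z3); last first.
    have := DZ z Zz; rewrite /reduce; case: asboolP => // _; case: asboolP => // _.
    move=> [h|[r rrs rz]]; first by left; apply: leq_trans h _; exact: leq_addl.
    by right; exists r => //; rewrite mem_cat rrs orbT.
  have Fz : (F z <= d)%N by rewrite -F3; exact: superadditive_mono.
  have [->|Fz0] := posnP (F z); first by left.
  have Qz : Q z.
    split=> //; last exact: berk_le_trans z32.
    by apply/eqP; rewrite eqn_leq Fz Fmin.
  have [h|[r rrs rz]] := Qw z Qz zz3.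
    by left; rewrite h; exact: leq_trans (leq_addr _ _).
  by right; exists r => //; rewrite mem_cat rrs.
- move=> u iu xu; rewrite zerosE.
  have nuz : ~ berk_le u z3 by move=> h; apply: Z3.2; exact: berk_le_trans h.
  have := Du u iu xu; rewrite /reduce; case: asboolP => z3u.
    rewrite (zero_up w3 z3u) => h.
    have : (d <= F u)%N by rewrite -F3; exact: superadditive_mono.
    by move: h; lia.
  case: asboolP => // _ h; case: ifP => // uw.
  by have [] := zero_comparable uw w3 iu Z3.1 w1.
Qed.

End Greedy.

(** * Points of degree equal to the multiplicity *)

Section Tame.
Variables (R : realType) (k : valuedField R) (C : completedAlgClosure k).
Hypothesis k_complete : vf_complete k.

Local Notation La := (kav C).
Local Notation "p ^e" := (map_poly (emb C) p) (at level 2, format "p ^e").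
Local Notation dst := (@dst R k C).
Local Notation pt := (@pt R k C).
Local Notation rad := (rad C).
Local Notation inner := (@inner R k C).
Local Notation mult := (mult C).
Implicit Types (w v e : La) (s t r : R) (x y u z : berk k) (F D : {poly k}).

Lemma dst_rad_vabs x w : dst x w <= rad x -> vabs w <= 1.
Proof.
move=> h; rewrite leNgt; apply/negP => w1; move: h.
by rewrite dst_big// leNgt (le_lt_trans (rad_le1 C k_complete x)).
Qed.

Lemma rad_eq_pt x w : dst x w <= rad x -> nice w (rad x) /\ x = pt w (rad x).
Proof.
move=> h; have w1 := dst_rad_vabs h; split; first by split=> //; rewrite rad_ge0 rad_le1.
by apply: above_eq => //; exact: berk_le_refl.
Qed.

Lemma mdeg_mult_inner x w : inner x -> dst x w <= rad x ->
  mdeg w = (mult x * nu w (rad x))%N.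
Proof.
move=> ix h; have [nw xE] := rad_eq_pt h.
by rewrite [X in mult X]xE; apply: mdeg_mult => //; exact: inner_rad.
Qed.

Lemma poly_pt_disc w s F : nice w s -> poly_pt (pt w s) F = disc_norm w s F^e.
Proof.
by move=> ws; have [h1 [h2 ->]] := ptE ws; rewrite restr_poly alg_disc_pt disc_norm_toK.
Qed.

(** A minimal polynomial with no root in the disc z0 is at constant distance from all points of the
    disc. *)
Lemma poly_pt_const z0 z F : berk_le z z0 ->
  (forall v, root F^e v -> rad z0 < dst z0 v) -> poly_pt z F = poly_pt z0 F.
Proof.
move=> zz0; have [n] := ubnP (size F); elim: n F => // n ih F Fn hF.
have [F1|F1] := leqP (size F) 1.
  have /size1_polyC -> := F1.
  by rewrite !(sptC (poly_pt_seminorm _)).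
have [v vF] : exists v, root F^e v.
  by apply/closed_rootP; rewrite size_map_poly neq_ltn F1 orbT.
have : mpoly v %| F by rewrite -horner_emb_eq0; exact: vF.
move=> /dvdpP[G GE]; rewrite GE !(sptM (poly_pt_seminorm _)); congr (_ * _).
  apply: ih => [|a aG]; last by apply: hF; rewrite GE rmorphM rootM aG.
  have F0 : F != 0 by rewrite -size_poly_gt0 (ltn_trans _ F1).
  have G0 : G != 0 by move: F0; rewrite GE mulf_eq0 => /norP[].
  move: Fn (mdeg_gt0 v); rewrite GE size_mul ?mpoly_neq0// size_mpoly.
  move: (size G) (mdeg v) => a b; lia.
rewrite !(mpoly_dst k_complete); congr Lam; apply/eqP; rewrite eq_le.
rewrite (berk_le_dst C k_complete _ _).1//=.
have := dst_above k_complete v zz0; rewrite le_max => /orP[|//].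
by rewrite leNgt hF.
Qed.

Lemma wnorm1_map F : wnorm 1 F^e = wnorm 1 F.
Proof.
apply/eqP; rewrite eq_le; apply/andP; split.
  have [i ->] := wnorm_attained F^e (@ler01 R).
  by rewrite coef_map vabs_emb; exact: wnorm_ub.
have [i ->] := wnorm_attained F (@ler01 R).
by rewrite -(vabs_emb C) -coef_map; exact: wnorm_ub.
Qed.

(** Comparing the Taylor coefficients at a centre for the radii 1 and [rad z]: on polynomials of
    bounded degree the point z is equivalent to the Gauss norm. *)
Lemma wnorm1_le_poly_pt z F : inner z -> wnorm 1 F * rad z ^+ size F <= poly_pt z F.
Proof.
move=> iz; have [w [s [ws s0 zE]]] := iz.
have rE : rad z = s by rewrite zE rad_pt.
rewrite rE zE poly_pt_disc//.
have -> : wnorm 1 F = disc_norm w 1 F^e.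
  rewrite (@disc_norm_recenter _ _ w 0); last by rewrite subr0; case: ws.
  rewrite /disc_norm polyC0 addr0 comp_polyXr.
  by rewrite wnorm1_map.
rewrite /disc_norm; have [i ->] := wnorm_attained (F^e \Po ('X + w%:P)) (@ler01 R).
rewrite expr1n mulr1.
have [iF|Fi] := leqP (size F) i.
  rewrite nth_default ?vabs0 ?mul0r ?wnorm_ge0//.
  by rewrite size_comp_poly2 ?size_XaddC// size_map_poly.
apply: le_trans (wnorm_ub _ i (ltW s0)).
rewrite ler_wpM2l ?vabs_ge0// ler_wiXn2l ?(ltW s0) ?(ltnW Fi)//.
by case: ws => _ /andP[].
Qed.

Section Limit.
Hypothesis tame : forall z, inner z ->
  exists w, [/\ vabs w <= 1, dst z w <= rad z & mdeg w = mult z].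

(** The minimal polynomials of centres of degree [mu] of smaller and smaller members of [Q] converge
    coefficientwise; some root of the limit lies in every member of [Q]. *)
Lemma tame_limit (Q : set (berk k)) mu : Q !=set0 ->
  (forall z, Q z -> inner z /\ mult z = mu) ->
  (forall z z', Q z -> Q z' -> berk_le z z' \/ berk_le z' z) ->
  (forall e : R, 0 < e -> exists2 z, Q z & rad z < e) ->
  exists w, [/\ vabs w <= 1, mdeg w = mu & forall z, Q z -> dst z w <= rad z].
Proof.
move=> [z0 Q0] Qm Qtot Qsmall.
have [i0 m0] := Qm z0 Q0; have r0 := inner_rad k_complete i0.
have mu_gt0 : (0 < mu)%N by rewrite -m0 inner_mult_gt0.
have mdeg_ge z v : Q z -> dst z v <= rad z -> (mu <= mdeg v)%N.
  move=> /Qm[iz <-] h; rewrite (mdeg_mult_inner iz h) leq_pmulr//.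
  by rewrite nu_gt0// rad_ge0.
have /choice[zz hzz] : forall n : nat, exists z, Q z /\ rad z < n.+1%:R^-1.
  by move=> n; have [|z Qz zn] := Qsmall (n.+1%:R^-1); [rewrite invr_gt0|exists z].
have Qzz n : Q (zz n) by case: (hzz n).
have /choice[ww hww] : forall n, exists w, [/\ dst (zz n) w <= rad (zz n) & mdeg w = mu].
  move=> n; have [in_ mn] := Qm _ (Qzz n).
  by have [w [_ h1 h2]] := tame in_; exists w; rewrite h2 mn.
pose P n := mpoly (ww n).
have szP n : size (P n) = mu.+1 by rewrite size_mpoly (hww n).2.
(* One factor of the minimal polynomial is the radius and the other factors are at most 1. *)
have P_small n z : Q z -> berk_le (zz n) z -> poly_pt z (P n) <= rad z.
  move=> Qz nz; have h := zero_up k_complete (hww n).1 nz.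
  have [nw zE] := rad_eq_pt h; rewrite mpoly_dst//.
  have -> : dst z (ww n) = rad z by apply/eqP; rewrite eq_le h rad_le_dst.
  have [w1 /andP[_ r1]] := nw.
  rewrite Lam_rem ?rad_ge0// ler_piMr ?rad_ge0// big_seq prodr_ile1// => a /mem_rem ac.
  rewrite le_max rad_ge0//= ge_max r1/= (le_trans (vabsB_max _ _))//.
  by rewrite ge_max w1 (vabs_conj k_complete ac).
have small_sub m n D : D = P m - P n -> wnorm 1 D * rad z0 ^+ mu <= poly_pt z0 D.
  move=> DE; have sD : (size D <= mu)%N.
    apply/leq_sizeP => j; rewrite leq_eqVlt DE coefB => /orP[/eqP <-|mj].
      have lc i : (P i)`_mu = 1.
        by have /monicP := mpoly_monic (ww i); rewrite /lead_coef -/(P i) szP.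
      by rewrite !lc subrr.
    by rewrite !nth_default ?szP ?subrr.
  apply: le_trans (wnorm1_le_poly_pt D i0).
  by rewrite ler_wpM2l ?wnorm_ge0// ler_wiXn2l ?rad_ge0 ?rad_le1.
(* A root in the disc z0 has degree at least [mu], too much for [D]. So |D| is constant below z0 and
   can be estimated on a much smaller disc of [Q]. *)
have root_far D : D != 0 -> (size D <= mu)%N -> forall v, root D^e v -> rad z0 < dst z0 v.
  move=> D0 sD v vD; rewrite ltNge; apply/negP => /(mdeg_ge _ _ Q0).
  have := mpoly_min D0 vD; rewrite size_mpoly; lia.
have cau (d : R) : 0 < d -> exists N, forall m n, (N <= m)%N -> (N <= n)%N ->
    wnorm 1 (P m - P n) < d.
  move=> d0; have : 0 < Num.min (d * rad z0 ^+ mu) (rad z0).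
    by rewrite lt_min mulr_gt0 ?exprn_gt0.
  move=> /inv_nat_small[N hN]; exists N => m n Nm Nn.
  have rn i : (N <= i)%N -> rad (zz i) < d * rad z0 ^+ mu /\ rad (zz i) < rad z0.
    by move=> /hN; rewrite lt_min => /andP[h1 h2]; split; exact: lt_trans (hzz i).2 _.
  have [D0|D0] := eqVneq (P m - P n) 0; first by rewrite D0 -[0]/(0%:P) wnormC vabs0.
  have [z [Qz mz nz [zd z0r]]] : exists z, [/\ Q z, berk_le (zz m) z, berk_le (zz n) z &
      rad z < d * rad z0 ^+ mu /\ rad z < rad z0].
    have [mn|nm] := Qtot _ _ (Qzz m) (Qzz n).
      by exists (zz n); split=> //; exact: rn.
    by exists (zz m); split=> //; exact: rn.
  have zz0 : berk_le z z0.
    have [//|z0z] := Qtot z z0 Qz Q0.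
    by have := rad_mono C k_complete z0z; rewrite leNgt z0r.
  rewrite -(ltr_pM2r (exprn_gt0 mu r0)); apply: le_lt_trans zd.
  apply: le_trans (small_sub m n _ erefl) _; rewrite -(poly_pt_const zz0).
    by apply: le_trans (sptB (poly_pt_seminorm _) _ _) _; rewrite ge_max !P_small.
  apply: root_far => //; apply/leq_sizeP => j; rewrite leq_eqVlt coefB => /orP[/eqP <-|mj].
    have lc i : (P i)`_mu = 1.
      by have /monicP := mpoly_monic (ww i); rewrite /lead_coef -/(P i) szP.
    by rewrite !lc subrr.
  by rewrite !nth_default ?szP ?subrr.
have /choice[l hl] : forall i, exists l : k, forall e : R, 0 < e ->
    exists N, forall n, (N <= n)%N -> vabs ((P n)`_i - l) < e.
  move=> i; apply: complete_lim => // e /cau[N hN]; exists N => m n Nm Nn.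
  apply: le_lt_trans (hN m n Nm Nn).
  by have := wnorm_ub (P m - P n) i (@ler01 R); rewrite coefB expr1n mulr1.
pose G := \poly_(i < mu.+1) (if (i == mu)%N then 1 else l i).
have Gmu : G`_mu = 1 by rewrite coef_poly ltnSn eqxx.
have sG : size G = mu.+1 by rewrite size_poly_eq//= eqxx oner_eq0.
have G0 : G != 0 by rewrite -size_poly_gt0 sG.
have Glim (d : R) : 0 < d -> exists N, forall n, (N <= n)%N -> wnorm 1 (P n - G) <= d.
  move=> d0; have /choice[NN hNN] := fun i => hl i d d0.
  exists (\max_(i < mu) NN i)%N => n Nn; apply: wnorm_le; first exact: ltW.
  move=> i; rewrite expr1n mulr1 coefB coef_poly ltnS.
  have [imu|mui|->] := ltngtP i mu; last 1 first.
  - have /monicP := mpoly_monic (ww n); rewrite /lead_coef -/(P n) szP /= => ->.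
    by rewrite subrr vabs0 ltW.
  - apply/ltW/hNN; apply: leq_trans Nn.
    exact: (leq_bigmax (Ordinal imu)).
  - by rewrite nth_default ?szP// subrr vabs0 ltW.
have [rG GE] := closed_field_poly_normal G^e.
have rootsG v : root G^e v -> v \in rG.
  rewrite GE rootZ ?root_prod_XsubC// lead_coef_eq0 (map_emb_eq0 C).
  exact: G0.
have [e [eG hG]] : exists e, root G^e e /\ forall z, Q z -> dst z e <= rad z.
  apply: contrapT => none.
  have none' e : root G^e e -> exists z, Q z /\ rad z < dst z e.
    move=> eG; apply: contrapT => h; apply: none; exists e; split=> // z Qz.
    by rewrite leNgt; apply/negP => h'; apply: h; exists z.
  have [z1 [Q1 hz1]] : exists z1, Q z1 /\ forall e, e \in rG -> root G^e e -> rad z1 < dst z1 e.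
    elim: (rG) => [|a r [z1 [Q1 ih]]]; first by exists z0.
    have [ra|nra] := pselect (root G^e a); last first.
      by exists z1; split=> // e; rewrite inE => /orP[/eqP ->//|]; exact: ih.
    have [z2 [Q2 h2]] := none' a ra.
    have [z3 [Q3 z31 z32]] : exists z3, [/\ Q z3, berk_le z3 z1 & berk_le z3 z2].
      have [h|h] := Qtot _ _ Q1 Q2; [exists z1|exists z2]; split=> //; exact: berk_le_refl.
    exists z3; split=> // e; rewrite inE => /orP[/eqP ->|er] eG; rewrite ltNge; apply/negP.
      by move=> /zero_up-/(_ k_complete _ z32); rewrite leNgt h2.
    by move=> /zero_up-/(_ k_complete _ z31); rewrite leNgt ih.
  have i1 := (Qm _ Q1).1; have r1 := inner_rad k_complete i1.
  (* If [G] had no root in z1, its value would be constant below z1, hence at least this bound; but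
     the values of [G] tend to 0 along the chain. *)
  have lower : rad z1 ^+ mu.+1 <= poly_pt z1 G.
    apply: le_trans (wnorm1_le_poly_pt G i1); rewrite sG ler_peMl ?exprn_ge0 ?rad_ge0//.
    by have := wnorm_ub G mu (@ler01 R); rewrite Gmu vabs1 expr1n mulr1.
  have e0 : 0 < rad z1 ^+ mu.+1 / 2 by rewrite divr_gt0 ?exprn_gt0.
  have : 0 < Num.min (rad z1 ^+ mu.+1 / 2) (rad z1) by rewrite lt_min e0.
  move=> /inv_nat_small[N1 hN1]; have [N2 hN2] := Glim _ e0.
  pose n := maxn N1 N2.
  have := hN1 n (leq_maxl _ _); rewrite lt_min => /andP[n1 n2].
  have nz1 : berk_le (zz n) z1.
    have [//|h] := Qtot _ _ (Qzz n) Q1.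
    have := rad_mono C k_complete h; rewrite leNgt (lt_trans (hzz n).2)//.
  have cst := poly_pt_const nz1 (fun v vG => hz1 v (rootsG v vG) vG).
  have : poly_pt (zz n) G <= rad z1 ^+ mu.+1 / 2.
    have -> : G = P n - (P n - G) by rewrite opprB addrC subrK.
    apply: le_trans (sptB (poly_pt_seminorm _) _ _) _; rewrite ge_max; apply/andP; split.
      apply: le_trans (P_small n _ (Qzz n) (@berk_le_refl _ _ _)) _.
      exact/ltW/(lt_trans (hzz n).2).
    apply: le_trans (hN2 n (leq_maxr _ _)).
    by apply: spt_le_wnorm; [exact: poly_pt_seminorm|exact: poly_ptX].
  rewrite cst => /(le_trans lower); rewrite leNgt => /negP; apply.
  by rewrite ltr_pdivrMr// ltr_pMr ?exprn_gt0// ltr1n.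
exists e; split=> //; first exact: dst_rad_vabs (hG _ Q0).
apply/eqP; rewrite eqn_leq (mdeg_ge z0 e Q0 (hG _ Q0)) andbT.
by have := mpoly_min G0 eG; rewrite size_mpoly sG ltnS.
Qed.

End Limit.

Lemma mult_nu1 z w : inner z -> dst z w <= rad z -> nu w (rad z) = 1%N ->
  exists w, [/\ vabs w <= 1, dst z w <= rad z & mdeg w = mult z].
Proof.
move=> iz zw nu1; exists w; split=> //; first exact: dst_rad_vabs zw.
by rewrite (mdeg_mult_inner iz zw) nu1 muln1.
Qed.

Lemma inner_center z : inner z -> exists2 w, vabs w <= 1 & dst z w <= rad z.
Proof.
move=> [w [s [ws s0 ->]]]; exists w; first by case: ws.
by rewrite dst_pt// del_self// rad_pt// max_l// ltW.
Qed.

Lemma mdeg1_tame z w : inner z -> dst z w <= rad z -> (mdeg w <= 1)%N ->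
  exists w, [/\ vabs w <= 1, dst z w <= rad z & mdeg w = mult z].
Proof.
move=> iz zw dw; exists w; split=> //; first exact: dst_rad_vabs zw.
have := mdeg_mult_inner iz zw; have := inner_mult_gt0 k_complete iz.
have : (0 < nu w (rad z))%N by rewrite nu_gt0// rad_ge0.
move: (mult z) (nu _ _) (mdeg w) dw => a b c; nia.
Qed.

Lemma mdeg_le1 (a : k) : (mdeg (emb C a) <= 1)%N.
Proof.
have := @mpoly_min R k C (emb C a) ('X - a%:P) (negbT (polyXsubC_eq0 a)).
by rewrite size_XsubC size_mpoly ltnS; apply; rewrite rmorphB /= map_polyX map_polyC root_XsubC.
Qed.

Lemma closed_tame z : GRing.closed_field_axiom k -> inner z ->
  exists w, [/\ vabs w <= 1, dst z w <= rad z & mdeg w = mult z].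
Proof.
move=> kcl iz; have [w w1 zw] := inner_center iz; apply: (mdeg1_tame iz zw).
have [a aE] := kcl (mdeg w) (fun i => - (mpoly w)`_i) (mdeg_gt0 w).
have ra : root (mpoly w) a.
  apply/rootP; rewrite horner_coef size_mpoly big_ord_recr /= aE.
  have /monicP := mpoly_monic w; rewrite /lead_coef size_mpoly /= => ->.
  rewrite mul1r -big_split /= big1// => i _.
  by rewrite mulNr subrr.
have : emb C a \in conjs w by rewrite mem_conjs rmorph_root.
move=> /mpoly_conj e; have := mdeg_le1 a.
by rewrite /mdeg e.
Qed.

Section TriviallyValued.
Hypotheses (triv : trivially_valued k) (perf : perfect_field k).

(** If |a| > 1, the Gauss norm of the minimal polynomial of [a] would be a positive power of |a|,
    while its coefficients have absolute value at most 1. *)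
Lemma trivial_vabs v : v != 0 -> vabs v = 1.
Proof.
have le1 a : vabs (a : La) <= 1.
  have := wnorm1_map (mpoly a); rewrite mpoly_prod (spt_prod (wnorm_pt La (@ler01 R))).
  have kle1 (b : k) : vabs b <= 1.
    by have [->|/triv ->//] := eqVneq b 0; rewrite vabs0 ler01.
  have : wnorm 1 (mpoly a) <= 1.
    by apply: wnorm_le => // i; rewrite expr1n mulr1.
  move=> h1 h2; move: h1; rewrite -h2 leNgt; apply: contraNle => a1.
  rewrite big_seq (eq_bigr (fun=> vabs a)) => [|z za]; last first.
    by rewrite wnormX_sub// (vabs_conj k_complete za) max_r// ltW.
  rewrite -big_seq big_const_seq count_predT size_conjs iter_mulr_1.
  by rewrite exprn_egt1// -lt0n mdeg_gt0.
move=> v0; apply/eqP; rewrite eq_le le1/=.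
by have := le1 v^-1; rewrite vabsV invf_le1// vabs_gt0.
Qed.

(** A double root is a root of the derivative, which then vanishes by minimality. The minimal
    polynomial is thus a polynomial in X^p, and over a perfect field it is a p-th power of a smaller
    one with the same root. *)
Lemma perfect_separable w : count_mem w (conjs w) = 1%N.
Proof.
have : (0 < count_mem w (conjs w))%N by rewrite -has_count has_pred1 conjs_self.
case E : (count_mem w (conjs w)) => [|[|n]]// _; exfalso.
have P'0 : (mpoly w)^`() = 0.
  apply/eqP; apply: contraT => P'n0.
  have : root ((mpoly w)^`())^e w.
    have pw : perm_eq (conjs w) (w :: rem w (conjs w)) by exact: perm_to_rem (conjs_self w).
    have w2 : w \in rem w (conjs w).
      rewrite -has_pred1 has_count; have := permP pw (pred1 w).
      by rewrite E /= eqxx add1n => -[<-].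
    have pw2 := perm_to_rem w2.
    rewrite -deriv_map mpoly_prod (perm_big _ pw) /= big_cons (perm_big _ pw2) /= big_cons.
    apply/rootP; rewrite derivM hornerD !hornerM !hornerXsubC subrr.
    by rewrite !mul0r mulr0 addr0.
  move=> /(mpoly_min P'n0); rewrite leqNgt (leq_trans (lt_size_deriv (mpoly_neq0 w)))//.
have n0 : (mdeg w)%:R = 0 :> k.
  have := congr1 (fun F : {poly k} => F`_(mdeg w).-1) P'0.
  rewrite coef_deriv coef0 prednK ?mdeg_gt0//.
  by have /monicP := mpoly_monic w; rewrite /lead_coef size_mpoly /= => ->.
have [p pchark] := natf0_pchar (mdeg_gt0 w) (introT eqP n0).
have ppr := pcharf_prime pchark.
have /choice[b hb] : forall i, exists b, b ^+ p = (mpoly w)`_(i * p)%N.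
  by move=> i; exact: perf.
pose G := \sum_(i < size (mpoly w)) b i *: 'X^i.
have GE : G ^+ p = mpoly w.
  have pp : p \in [pchar {poly k}] by rewrite pchar_poly.
  have -> : G ^+ p = \sum_(i < size (mpoly w)) (b i *: 'X^i) ^+ p.
    rewrite -(pFrobenius_autE pp) /G rmorph_sum.
    by apply: eq_bigr => i _ /=; rewrite pFrobenius_autE.
  apply/polyP => j; rewrite coef_sum.
  under eq_bigr => i _ do rewrite exprZn -exprM hb coefZ coefXn.
  have [pj|npj] := boolP (p %| j)%N; last first.
    have -> : (mpoly w)`_j = 0.
      case: j npj => [|j] npj; first by rewrite dvdn0 in npj.
      have := congr1 (fun F : {poly k} => F`_j) P'0.
      rewrite coef_deriv coef0 -mulr_natr => /eqP; rewrite mulf_eq0 => /orP[/eqP//|].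
      by rewrite -(dvdn_pcharf pchark) (negPf npj).
    rewrite big1// => i _; case: eqP => [ji|]; last by rewrite mulr0.
    by rewrite ji dvdn_mull in npj.
  have jE : j = ((j %/ p) * p)%N by rewrite divnK.
  have [jl|jl] := ltnP (j %/ p) (size (mpoly w)).
    rewrite (bigD1 (Ordinal jl))//= -jE eqxx mulr1 big1 ?addr0// => i.
    rewrite -val_eqE /= => ij; case: eqP => [ji|]; last by rewrite mulr0.
    by rewrite ji mulnK ?prime_gt0// eqxx in ij.
  rewrite nth_default; last by apply: leq_trans jl _; exact: leq_div.
  rewrite big1// => i _; case: eqP => [ji|]; last by rewrite mulr0.
  by move: jl; rewrite ji mulnK ?prime_gt0// leqNgt ltn_ord.
have Gw : root G^e w.
  have := mpoly_root w; rewrite -GE rmorphXn /= /root horner_exp expf_eq0.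
  by move=> /andP[].
have G0 : G != 0.
  apply: contra_neq (mpoly_neq0 w) => G0; rewrite -GE G0 expr0n.
  by case: (p) (prime_gt0 ppr).
have := mpoly_min G0 Gw; rewrite leqNgt => /negP; apply.
have := size_exp G p; rewrite GE size_mpoly /= => dE.
rewrite -(prednK (_ : 0 < size G)%N) ?size_poly_gt0// ltnS dE.
rewrite -[X in (X < _)%N]muln1 ltn_mul2l prime_gt1// andbT.
by have := mdeg_gt0 w; rewrite dE muln_gt0 => /andP[].
Qed.

(** Distinct conjugates are at distance 1, so a disc of radius less than 1 contains just one; a disc
    of radius 1 is centred at 0. *)
Lemma trivial_tame z : inner z ->
  exists w, [/\ vabs w <= 1, dst z w <= rad z & mdeg w = mult z].
Proof.
move=> iz; have [r1|r1] := ltP (rad z) 1; last first.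
  have z0 : dst z 0 <= rad z.
    by apply: le_trans r1; apply: dst_le1 => //; rewrite vabs0 ler01.
  by apply: (mdeg1_tame iz z0); rewrite -(rmorph0 (emb C)); exact: mdeg_le1.
have [w w1 zw] := inner_center iz; apply: (mult_nu1 iz zw).
rewrite -(perfect_separable w) /nu; apply: eq_count => a /=.
apply/idP/eqP => [h|->]; last by rewrite subrr vabs0 rad_ge0.
apply/eqP; rewrite eq_sym -subr_eq0; apply: contraT => /trivial_vabs e.
by move: h; rewrite e leNgt r1.
Qed.

End TriviallyValued.

Section ResidueChar0.
Hypothesis res0 : residue_char0 k.

Lemma vabs_natr n : (0 < n)%N -> vabs (n%:R : La) = 1.
Proof.
move=> n0; rewrite -(rmorph_nat (emb C)) vabs_emb; apply/eqP.
by rewrite eq_le vabs_nat leNgt; apply/negP; exact: res0.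
Qed.

(* In residue characteristic 0 differentiation divides the norm on a disc
   centred at a root by the radius. *)
Lemma wnorm_deriv t (H : {poly La}) : 0 <= t -> H`_0 = 0 ->
  wnorm t H = t * wnorm t H^`().
Proof.
move=> t0 H0; apply/eqP; rewrite eq_le; apply/andP; split.
  apply: wnorm_le => [|[|i]]; first by rewrite mulr_ge0 ?wnorm_ge0.
    by rewrite H0 vabs0 mul0r mulr_ge0 ?wnorm_ge0.
  have := wnorm_ub H^`() i t0; rewrite coef_deriv -mulr_natr vabsM vabs_natr// mulr1 => h.
  by rewrite exprS mulrCA ler_wpM2l.
have [i ->] := wnorm_attained H^`() t0.
rewrite coef_deriv -mulr_natr vabsM vabs_natr// mulr1 mulrCA -exprS.
exact: wnorm_ub.
Qed.

(** A centre [w] of least degree works: its minimal polynomial grows linearly in the radius just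
    beyond the disc, so the disc contains no other conjugate. *)
Lemma residue_char0_tame z : inner z ->
  exists w, [/\ vabs w <= 1, dst z w <= rad z & mdeg w = mult z].
Proof.
move=> iz; have s0 := inner_rad k_complete iz; set s := rad z in s0.
have exw : exists n, `[< exists w, dst z w <= s /\ mdeg w = n >].
  by have [w _ zw] := inner_center iz; exists (mdeg w); apply/asboolP; exists w.
case: (ex_minnP exw) => n /asboolP[w [zw wn]] nmin.
apply: (mult_nu1 iz zw); rewrite -/s; apply/eqP; rewrite eqn_leq nu_gt0 ?(ltW s0)// andbT.
rewrite leqNgt; apply/negP => nu2.
have [nw zE] := rad_eq_pt zw; rewrite -/s in nw zE.
set P := mpoly w; have P'0 : P^`() != 0.
  have sP : size P = n.+1 by rewrite size_mpoly wn.
  have n0 : (0 < n)%N by rewrite -wn mdeg_gt0.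
  apply: contraTneq n0 => P'0; rewrite -leqNgt leqNgt; apply/negP => n0.
  have := congr1 (fun F : {poly k} => F`_n.-1) P'0.
  rewrite coef_deriv coef0 prednK// => h.
  have /monicP := mpoly_monic w; rewrite /lead_coef -/P sP /= => lc; rewrite lc in h.
  have := vabs_natr n0; rewrite -(rmorph_nat (emb C)) h rmorph0 vabs0 => /esym/eqP.
  by rewrite oner_eq0.
(* A root of P' in the disc would have smaller degree than [w]. *)
have far a : root (P^`())^e a -> s < vabs (w - a).
  move=> ra; rewrite ltNge; apply/negP => wa.
  have za : dst z a <= s.
    rewrite zE dst_pt// ge_max lexx /= delC//.
    apply: le_trans (del_le _ (conjs_self _)) _ => //.
    by rewrite vabs_distC.
  have /nmin : `[< exists v, dst z v <= s /\ mdeg v = mdeg a >] by apply/asboolP; exists a.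
  have := mpoly_min P'0 ra; rewrite size_mpoly => h1 h2.
  have := lt_size_deriv (mpoly_neq0 w); rewrite -/P size_mpoly wn; lia.
have [rP PE] := closed_field_poly_normal (P^`())^e.
have lc0 : lead_coef (P^`())^e != 0 by rewrite lead_coef_eq0 (map_emb_eq0 C).
have s1 : s < s + 1 by rewrite ltrDl.
have [t [st t1 gap]] := gap_above
  ([seq vabs (w - a) | a <- conjs w] ++ [seq vabs (w - a) | a <- rP]) s1.
have t0 := lt_trans s0 st.
(* The roots of P' are at distance at least [t] from [w], so the norm of P' is constant on these
   radii, and by [wnorm_deriv] that of P is linear. *)
have N_at r : s <= r -> r <= t -> Lam w r = r * (vabs (lead_coef (P^`())^e) *
    \prod_(a <- rP) vabs (w - a)).
  move=> sr rt; have r0 : 0 <= r by rewrite (le_trans (ltW s0)).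
  rewrite -(disc_norm_mpoly w r0) /disc_norm -/P.
  have H0 : (P^e \Po ('X + w%:P))`_0 = 0.
    rewrite -horner_coef0 horner_comp_XaddC add0r; apply/rootP; exact: mpoly_root.
  rewrite (wnorm_deriv r0 H0) deriv_comp derivD derivX derivC addr0 mulr1 deriv_map.
  congr (_ * _); rewrite {1}PE -/(disc_norm w r _) -mul_polyC.
  have hN := disc_norm_pt w r0; rewrite (sptM hN) (sptC hN) (spt_prod hN).
  congr (_ * _); rewrite big_seq [RHS]big_seq; apply: eq_bigr => a ar.
  rewrite disc_normX_sub// max_r//; apply: le_trans rt _.
  have sa : s < vabs (w - a).
    apply: far; rewrite PE rootZ// root_prod_XsubC.
    exact: ar.
  have [|h|//] := gap (vabs (w - a)); first by rewrite mem_cat; apply/orP; right; apply/mapP; exists a.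
  by move: sa; rewrite ltNge h.
have Ns := N_at s (lexx _) (ltW st); have Nt := N_at t (ltW st) (lexx _).
move: Ns Nt; move: (vabs _ * \prod_(a <- rP) _) => N Ns Nt.
have N0 : 0 < N by have := Lam_gt0 w s0; rewrite Ns pmulr_rgt0.
have scale : Lam w t = (t / s) ^+ nu w s * Lam w s.
  have := @prod_max_scale R [seq vabs (w - a) | a <- conjs w] s t s0 (ltW st).
  rewrite !big_map count_map; apply => a ac.
  by apply: gap; rewrite mem_cat ac.
have q1 : 1 < t / s by rewrite ltr_pdivlMr// mul1r.
(* The growth exponent of |P| to the right of [s] is both [nu w s] and 1. *)
have : (t / s) ^+ nu w s = t / s.
  apply: (@mulIf _ (s * N)); first by rewrite mulf_neq0 ?gt_eqF.
  by rewrite -{1}Ns -scale Nt mulrA divfK ?gt_eqF.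
move=> /eqP; rewrite gt_eqF// -[X in X < _]expr1.
by rewrite ltr_eXn2l.
Qed.

End ResidueChar0.

Lemma tame_point : (GRing.closed_field_axiom k \/
   (trivially_valued k /\ perfect_field k) \/
   (spherically_complete k /\ residue_char0 k)) -> forall z, inner z ->
  exists w, [/\ vabs w <= 1, dst z w <= rad z & mdeg w = mult z].
Proof.
move=> [kcl|[[tr pf]|[_ res0]]] z iz; first exact: closed_tame.
  exact: trivial_tame.
exact: residue_char0_tame.
Qed.

End Tame.

(** The supremum of the times satisfying the inequality satisfies it, as [G] is left continuous and
    [E] can only jump upwards; the step hypothesis forces it to be [b]. *)
Lemma real_induction (R : realType) (G E : R -> R) (a b : R) : a <= b ->
  (forall v, a < v <= b -> G t @[t --> v^'-] --> G v) ->
  {homo E : s t / s <= t} ->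
  (forall v, a <= v < b -> exists2 u, v < u <= b & G v + E v <= G u + E u) ->
  G a + E a <= G b + E b.
Proof.
move=> ab cG mE step.
pose S := [set t | a <= t <= b /\ G a + E a <= G t + E t].
have Sa : S a by split; rewrite ?lexx ?ab.
have hS : has_sup S by split; [exists a|exists b => t [/andP[]]].
set m := sup S.
have am : a <= m by apply: sup_upper_bound.
have mb : m <= b by apply: ge_sup; [exists a|move=> t [/andP[]]].
have Sm : S m.
  split; first by rewrite am mb.
  have [<-//|nam] := eqVneq a m.
  have {}am : a < m by rewrite lt_neqAle nam am.
  rewrite -lerBlDr leNgt; apply/negP => lt.
  have := cG m; rewrite am mb => /(_ isT).
  move=> /cvgrPdist_lt; set d := G a + E a - E m - G m.
  have d0 : 0 < d by rewrite subr_gt0.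
  move=> /(_ d d0) near_m.
  have : \forall t \near m^'-, ~ S t.
    near=> t; move=> [_].
    have tm : t < m by near: t; exact: nbhs_left_lt.
    have : `|G m - G t| < d by near: t.
    rewrite ltr_norml => /andP[h _]; have := mE _ _ (ltW tm); rewrite /d in h; lra.
  move=> [e /= e0 he].
  have [t St tm] := sup_adherent e0 hS; rewrite -/m in tm.
  have tlem : t <= m by apply: sup_upper_bound.
  have [tE|ntm] := eqVneq t m.
    by case: St => _; rewrite tE => h; move: lt; rewrite ltNge lerBlDr h.
  apply: (he t) => //=; last by rewrite lt_neqAle ntm.
  by rewrite /ball/= ger0_norm ?subr_ge0// ltrBlDl -ltrBlDr.
have [mE'|nmb] := eqVneq m b; first by case: Sm => _; rewrite mE'.
have [|u /andP[mu ub] h] := step m; first by rewrite am lt_neqAle nmb mb.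
have : S u.
  by split; [rewrite ub (le_trans am (ltW mu))|case: Sm => _ /le_trans; apply].
by move=> /(sup_upper_bound hS); rewrite -/m leNgt mu.
Unshelve. all: by end_near. Qed.

(** * Variation of log |F| along paths *)

Section Optimal.
Variables (R : realType) (k : valuedField R) (C : completedAlgClosure k).
Hypothesis k_complete : vf_complete k.

Local Notation La := (kav C).
Local Notation dst := (@dst R k C).
Local Notation pt := (@pt R k C).
Local Notation rad := (rad C).
Local Notation inner := (@inner R k C).
Local Notation mult := (mult C).
Local Notation al := (@al R k C).
Implicit Types (w : La) (s t r : R) (x y u v z : berk k) (zs : seq (berk k)).

Lemma poly_pt_left w s (F : {poly k}) : nice w s -> 0 < s ->
  poly_pt (pt w t) F @[t --> s^'-] --> poly_pt (pt w s) F.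
Proof.
move=> ws s0; apply: (@poly_pt_cvg _ _ C k_complete ((pt w) @ s^'-)) => v.
rewrite -fmap_comp dst_pt//.
have nr : \forall t \near s^'-, nice w t.
  near=> t; have t0 : 0 < t by near: t; exact: nbhs_left_gt.
  have ts : t < s by near: t; exact: nbhs_left_lt.
  by case: ws => w1 /andP[_ s1]; split=> //; rewrite ltW//= ltW// (lt_le_trans ts).
apply: (@cvg_trans _ ((fun t => Num.max t (del w v)) @ s^'-)).
  by apply: near_eq_cvg; apply: filterS nr => t wt /=; rewrite dst_pt.
apply/cvgrPdist_le => e e0.
have /cvgrPdist_le/(_ _ e0) : t @[t --> s^'-] --> s by apply: cvg_at_left_filter; exact: cvg_id.
by apply: filterS => t; exact: le_trans (dist_max2 _ _ _).
Unshelve. all: by end_near. Qed.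

(** Until the next distance from [w] to a conjugate, [nu w s] factors of [Lam] grow, and [nu] over
    the degree is the inverse of the multiplicity. [A] lists further radii not to be crossed. *)
Lemma al_step w s (A : seq R) : nice w s -> 0 < s -> s < 1 -> exists2 t1, s < t1 <= 1 &
  (forall a, a \in A -> a <= s \/ t1 <= a) /\ forall r, s < r <= t1 ->
  al (pt w s) - al (pt w r) = ln (r / s) / (mult (pt w s))%:R.
Proof.
move=> ws s0 s1; have [t1 [st t11 gap]] := gap_above ([seq vabs (w - a) | a <- conjs w] ++ A) s1.
exists t1; first by rewrite st.
split=> [a aA|r /andP[su ut]].
  by apply: gap; rewrite mem_cat aA orbT.
have wu : nice w r by apply: (nice_mono ws (ltW su)); exact: le_trans t11.
have u0 := lt_trans s0 su.
rewrite !al_pt// opprK addrC.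
have := @prod_max_scale R [seq vabs (w - a) | a <- conjs w] s r s0 (ltW su).
rewrite !big_map count_map => scale.
have {}scale : Lam w r = (r / s) ^+ nu w s * Lam w s.
  apply: scale => a ac; have [|h|h] := gap a; first by rewrite mem_cat ac.
    by left.
  by right; exact: le_trans h.
rewrite scale lnM ?posrE ?Lam_gt0 ?exprn_gt0 ?divr_gt0// lnXn ?divr_gt0//.
rewrite mulrDl addrK (mdeg_mult k_complete s0 ws) natrM invfM -[ln _ *+ _]mulr_natr.
rewrite mulrACA mulrA mulfK//.
by rewrite pnatr_eq0 -lt0n nu_gt0// ltW.
Qed.

Variable D : seq (La * nat).

Definition zpoly : {poly k} := \prod_(p <- D) mpoly p.1 ^+ p.2.

Lemma poly_pt_zpoly y : poly_pt y zpoly = \prod_(p <- D) Lam p.1 (dst y p.1) ^+ p.2.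
Proof.
rewrite /zpoly (spt_prod (poly_pt_seminorm y)); apply: eq_bigr => p _.
by rewrite (sptX (poly_pt_seminorm y)) mpoly_dst.
Qed.

Lemma zpoly_gt0 y : (forall p, p \in D -> 0 < dst y p.1) -> 0 < poly_pt y zpoly.
Proof.
move=> h; rewrite poly_pt_zpoly big_seq; apply: prodr_gt0 => p pD.
by rewrite exprn_gt0// Lam_gt0// h.
Qed.

Lemma ln_zpoly y : (forall p, p \in D -> 0 < dst y p.1) ->
  ln (poly_pt y zpoly) = \sum_(p <- D) p.2%:R * ln (Lam p.1 (dst y p.1)).
Proof.
rewrite poly_pt_zpoly; elim: D => [|p r ih] h; first by rewrite !big_nil ln1.
have hr q : q \in r -> 0 < dst y q.1 by move=> qr; apply: h; rewrite inE qr orbT.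
have p0 : 0 < Lam p.1 (dst y p.1) by rewrite Lam_gt0// h// mem_head.
rewrite !big_cons -ih// lnM ?posrE ?exprn_gt0//; last first.
  by rewrite big_seq; apply: prodr_gt0 => q qr; rewrite exprn_gt0// Lam_gt0// hr.
by rewrite lnXn// mulr_natl.
Qed.

Lemma inner_dst_gt0 z w : inner z -> 0 < dst z w.
Proof. by move=> /(inner_rad k_complete) /lt_le_trans; apply; exact: rad_le_dst. Qed.

Local Notation lf y := (ln (poly_pt y zpoly)).

Let term_diff z u w : inner z -> berk_le z u -> dst z w <= rad z ->
  ln (Lam w (dst u w)) - ln (Lam w (dst z w)) = (mdeg w)%:R * (al z - al u).
Proof.
move=> iz zu zw; have iu := inner_up k_complete iz zu.
have uw := zero_up k_complete zw zu.
have [nz zE] := rad_eq_pt k_complete zw; have [nu uE] := rad_eq_pt k_complete uw.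
have -> : dst z w = rad z by apply/eqP; rewrite eq_le zw rad_le_dst.
have -> : dst u w = rad u by apply/eqP; rewrite eq_le uw rad_le_dst.
have alz : al z = - (ln (Lam w (rad z)) / (mdeg w)%:R).
  rewrite {1}zE; exact (al_pt k_complete nz (inner_rad k_complete iz)).
have alu : al u = - (ln (Lam w (rad u)) / (mdeg w)%:R).
  rewrite {1}uE; exact (al_pt k_complete nu (inner_rad k_complete iu)).
rewrite alz alu; move: (ln (Lam w (rad u))) (ln (Lam w (rad z))) => a b.
have d0 : (mdeg w)%:R != 0 :> R by rewrite pnatr_eq0 -lt0n mdeg_gt0.
by rewrite opprK [- _ + _]addrC -mulrBl mulrC divfK.
Qed.

Let zeros_sum z (d : R) : (zeros D z)%:R * d =
  \sum_(p <- D) (if dst z p.1 <= rad z then p.2%:R * ((mdeg p.1)%:R * d) else 0).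
Proof.
rewrite /zeros natr_sum mulr_suml; apply: eq_bigr => p _.
by case: ifP => _; rewrite ?mul0r// natrM mulrA.
Qed.

Let lf_sub z u : inner z -> berk_le z u -> lf u - lf z =
  \sum_(p <- D) p.2%:R * (ln (Lam p.1 (dst u p.1)) - ln (Lam p.1 (dst z p.1))).
Proof.
move=> iz zu; have iu := inner_up k_complete iz zu.
rewrite !ln_zpoly; [|by move=> p _; exact: inner_dst_gt0..].
by rewrite -sumrB; apply: eq_bigr => p _; rewrite mulrBr.
Qed.

(** Factors with a zero in the disc z contribute their degree times the change of [al]; the other
    factors do not decrease upwards. *)
Lemma lf_ge z u : inner z -> berk_le z u ->
  (zeros D z)%:R * (al z - al u) <= lf u - lf z.
Proof.
move=> iz zu; rewrite lf_sub// zeros_sum; apply: ler_sum => p _.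
case: ifP => [zw|_]; first by rewrite term_diff.
rewrite mulr_ge0// subr_ge0 ler_ln ?posrE ?Lam_gt0 ?inner_dst_gt0//.
  by rewrite Lam_le ?dst_ge0//; exact: (berk_le_dst C k_complete _ _).1.
exact: inner_up zu.
Qed.

Lemma lf_eq z u : inner z -> berk_le z u ->
  (forall p, p \in D -> dst z p.1 <= rad z \/ dst u p.1 = dst z p.1) ->
  lf u - lf z = (zeros D z)%:R * (al z - al u).
Proof.
move=> iz zu h; rewrite lf_sub// zeros_sum; apply: eq_big_seq => p pD.
case: ifP => [zw|zw]; first by rewrite term_diff.
by have [|->] := h p pD; [rewrite zw|rewrite subrr mulr0].
Qed.

End Optimal.

(** * Optimal polynomials *)

Section Quantize.
Variables (R : realType) (k : valuedField R) (C : completedAlgClosure k).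
Hypothesis k_complete : vf_complete k.

Local Notation La := (kav C).
Local Notation dst := (@dst R k C).
Local Notation pt := (@pt R k C).
Local Notation rad := (rad C).
Local Notation inner := (@inner R k C).
Local Notation mult := (mult C).
Local Notation al := (@al R k C).
Implicit Types (w : La) (s t r : R) (y u v z : berk k) (zs : seq (berk k)).

Variables (c : R) (phi : berk k -> \bar R).
Hypotheses (hphi : subharmonic C c phi) (c0 : 0 < c).
Variables (kappa : R) (x : berk k).
Hypothesis kappa0 : 0 < kappa.

Local Notation slope := (@slope R k C phi).
Local Notation mass := (@mass R k C c phi).
Local Notation g := (fun u => fine (phi u)).

(* Off the path from x up, the mass of kappa phi rounded down to a multiple of
   the multiplicity. *)
Definition quant u : nat := if `[< berk_le x u >] then Num.truncn (kappa * mass u)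
  else (mult u * Num.truncn (kappa * mass u / (mult u)%:R))%N.

Let kmass_ge0 u : inner u -> 0 <= kappa * mass u.
Proof. by move=> iu; rewrite mulr_ge0 ?(ltW kappa0)//; apply: (mass_ge0 k_complete hphi) => //. Qed.

Lemma quant_le u : inner u -> (quant u)%:R <= kappa * mass u.
Proof.
move=> iu; have m0 := inner_mult_gt0 k_complete iu; rewrite /quant; case: asboolP => _.
  by rewrite truncn_le// kmass_ge0.
rewrite natrM mulrC -ler_pdivlMr ?ltr0n// truncn_le//.
by rewrite divr_ge0// kmass_ge0.
Qed.

Lemma quant_gt u : inner u -> ~ berk_le x u -> kappa * mass u < (quant u + mult u)%:R.
Proof.
move=> iu nxu; have m0 := inner_mult_gt0 k_complete iu; rewrite /quant; case: asboolP => // _.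
rewrite -mulnSr natrM [_%:R * _]mulrC -ltr_pdivrMr ?ltr0n//.
have /truncn_itv/andP[_] : 0 <= kappa * mass u / (mult u)%:R by rewrite divr_ge0 ?kmass_ge0.
by [].
Qed.

Lemma quant_divisible : divisible C x quant.
Proof. by move=> z [iz nxz]; rewrite /quant; case: asboolP => // _; exact: dvdn_mulr. Qed.

(** The sum of the rounded values is an integer at most kappa times the mass at [y]; off the path it
    is moreover a multiple of the multiplicity at [y]. Rounding at [y] therefore keeps it. *)
Lemma quant_superadditive : superadditive C x quant.
Proof.
move=> y zs iy az hz.
have le : (\sum_(z <- zs) quant z)%:R <= kappa * mass y.
  apply: (@le_trans _ _ (\sum_(z <- zs) kappa * mass z)).
    rewrite natr_sum big_seq [leRHS]big_seq; apply: ler_sum => z /hz[[iz _] _].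
    exact: quant_le.
  rewrite -mulr_sumr ler_wpM2l ?(ltW kappa0)//.
  by apply: (mass_superadditive k_complete hphi (ltW c0) iy az) => z /hz[[iz _] zy].
rewrite {2}/quant; case: asboolP => xy.
  by rewrite truncn_ge_nat// kmass_ge0.
have m0 := inner_mult_gt0 k_complete iy.
have /dvdnP[q qE] : (mult y %| \sum_(z <- zs) quant z)%N.
  rewrite big_seq; apply: dvdn_sum => z /hz[Zz zy].
  apply: dvdn_trans (quant_divisible Zz).
  by apply: inner_mult_dvd zy => //; case: Zz.
rewrite qE mulnC leq_mul2l; apply/orP; right.
rewrite truncn_ge_nat ?divr_ge0 ?kmass_ge0// ler_pdivlMr ?ltr0n//.
by rewrite -natrM -qE.
Qed.

End Quantize.

(** * The bound on log |F| - kappa phi - A_X *)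

Section Optimal.
Variables (R : realType) (k : valuedField R) (C : completedAlgClosure k).
Hypothesis k_complete : vf_complete k.
Hypothesis k_tame : GRing.closed_field_axiom k \/
   (trivially_valued k /\ perfect_field k) \/
   (spherically_complete k /\ residue_char0 k).

Local Notation La := (kav C).
Local Notation dst := (@dst R k C).
Local Notation pt := (@pt R k C).
Local Notation rad := (rad C).
Local Notation inner := (@inner R k C).
Local Notation mult := (mult C).
Local Notation al := (@al R k C).
Implicit Types (w : La) (s t r v : R) (y u z : berk k).

Variables (c : R) (phi : berk k -> \bar R).
Hypotheses (hphi : subharmonic C c phi) (c0 : 0 < c).

Local Notation slope := (@slope R k C phi).
Local Notation mass := (@mass R k C c phi).
Local Notation g := (fun u => fine (phi u)).

Section Divisor.
Variables (kappa eta : R) (x : berk k) (D : seq (La * nat)) (rs : seq R) (q : R).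
Hypotheses (kappa0 : 0 < kappa) (q1 : 1 < q).
Hypothesis rs_gt0 : forall r, r \in rs -> 0 < r.
Hypothesis D_gt0 : forall p, p \in D -> 0 < dst x p.1.
Hypothesis D_off : forall z, inner z -> ~ berk_le x z ->
  kappa * mass z < (zeros D z + mult z)%:R \/ exists2 r, r \in rs & r <= rad z < r * q.
Hypothesis D_on : forall u, inner u -> berk_le x u -> (zeros D u)%:R <= kappa * mass u.
Hypothesis eta_ge : (size rs)%:R * (kappa * c * ln q) <= eta.

Local Notation lf y := (ln (poly_pt y (zpoly D))).

Let inner_nice w s : nice w s -> 0 < s -> inner (pt w s). Proof. by move=> *; exists w, s. Qed.

Let ltr_slope z u a : inner z -> berk_le z u -> z <> u ->
  (slope z u <= a) = (g u - g z <= a * (al z - al u)).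
Proof.
move=> iz zu nzu; rewrite slopeE ler_pdivrMr// subr_gt0.
exact: al_lt.
Qed.

Let same_pt w s t : nice w s -> nice w t -> s < t -> pt w s <> pt w t.
Proof.
move=> ws wt st e; have := rad_pt k_complete ws; rewrite e (rad_pt k_complete wt) => e'.
by rewrite e' ltxx in st.
Qed.

(** On the path the number of zeros is at most kappa times the mass, and the mass is at most each
    upward slope: kappa phi gains at least as much as log |F|. *)
Lemma below_path w a b : nice w a -> nice w b -> 0 < a -> a <= b -> berk_le x (pt w a) ->
  lf (pt w b) - kappa * g (pt w b) <= lf (pt w a) - kappa * g (pt w a).
Proof.
move=> wa wb a0 ab xa.
suff : (kappa * g (pt w a) - lf (pt w a)) + 0 <= (kappa * g (pt w b) - lf (pt w b)) + 0.
  by rewrite !addr0; move: (lf _) (lf _) (g _) (g _) => *; lra.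
have between v : a <= v -> v <= b -> nice w v.
  by move=> av vb; apply: (nice_mono wa av); case: wb => _ /andP[_]; exact: le_trans.
apply: (@real_induction R (fun t => kappa * g (pt w t) - lf (pt w t)) (fun=> 0)) => //.
  move=> v /andP[av vb]; have wv := between v (ltW av) vb; have v0 := lt_trans a0 av.
  apply: cvgB; first by apply: cvgM; [exact: cvg_cst|exact: g_left hphi _ _ wv v0].
  apply: (@continuous_cvg _ _ _ _ _ _ (@ln R)); last exact: poly_pt_left.
  by apply: continuous_ln; apply: zpoly_gt0 => // p _; apply: inner_dst_gt0 => //; exact: inner_nice.
move=> v /andP[av vb]; have wv := between v av (ltW vb); have v0 := lt_le_trans a0 av.
have v1 : v < 1 by apply: lt_le_trans vb _; case: wb => _ /andP[].
(* Before [t1] no zero of F is met, so log |F| has there the constant slope [zeros]. *)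
have [t1 /andP[vt1 t11] [gap alt]] := al_step k_complete [seq del w p.1 | p <- D] wv v0 v1.
pose u := Num.min t1 b.
have vu : v < u by rewrite lt_min vt1.
have ub : u <= b by rewrite ge_min lexx orbT.
have ut : u <= t1 by rewrite ge_min lexx.
have wu := between u (le_trans av (ltW vu)) ub.
exists u; first by rewrite vu.
have iv := inner_nice wv v0.
have zu : berk_le (pt w v) (pt w u) by apply/pt_le_same => //; exact: ltW.
have nzu := same_pt wv wu vu.
have xv : berk_le x (pt w v) by apply: berk_le_trans xa _; apply/pt_le_same.
have lfE : lf (pt w u) - lf (pt w v) = (zeros D (pt w v))%:R * (al (pt w v) - al (pt w u)).
  apply: lf_eq => // p pD; rewrite rad_pt// !dst_pt//.
  have [|h|h] := gap (del w p.1); first by apply/mapP; exists p.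
    by left; rewrite ge_max lexx.
  by right; rewrite !max_r// ?(le_trans _ h)// ltW.
have d0 : 0 < al (pt w v) - al (pt w u) by rewrite subr_gt0; exact: al_lt.
have h1 := D_on iv xv.
have h2 := mass_le k_complete hphi iv zu nzu.
move: h2; rewrite slopeE ler_pdivlMr// => h2.
rewrite !addr0; move: lfE h1 h2 d0.
move: (lf (pt w u)) (lf (pt w v)) (g (pt w u)) (g (pt w v)) (mass (pt w v)) => l1 l2 g1 g2 M.
move: (zeros _ _)%:R (al (pt w v) - al (pt w u)) => N d h3 h1 h2 d0.
have : N * d <= kappa * M * d by rewrite ler_pM2r.
have : kappa * (M * d) <= kappa * (g1 - g2) by rewrite ler_pM2l.
nra.
Qed.

(* Over [r, r q] the potential may drop; this term, of size at most eta, makes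
   up for it. *)
Let slack t := \sum_(r <- rs) kappa * c * Num.max 0 (Num.min (ln (t / r)) (ln q)).

Let lnq0 : 0 < ln q. Proof. by rewrite ln_gt0. Qed.

Let slack_bound t : 0 <= slack t <= eta.
Proof.
apply/andP; split.
  by apply: sumr_ge0 => r _; rewrite !mulr_ge0 ?(ltW c0) ?(ltW kappa0)// le_max lexx.
apply: le_trans eta_ge; rewrite -sum1_size natr_sum mulr_suml; apply: ler_sum => r _.
rewrite mul1r ler_wpM2l ?mulr_ge0 ?(ltW c0) ?(ltW kappa0)//.
by rewrite ge_max (ltW lnq0) ge_min lexx orbT.
Qed.

Let slack_term s t r : 0 < r -> 0 < s -> s <= t ->
  Num.max 0 (Num.min (ln (s / r)) (ln q)) <= Num.max 0 (Num.min (ln (t / r)) (ln q)).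
Proof.
move=> r0 s0 st; have : ln (s / r) <= ln (t / r).
  rewrite ler_ln ?posrE ?(divr_gt0 s0 r0) ?(divr_gt0 (lt_le_trans s0 st) r0)//.
  by rewrite ler_pM2r ?invr_gt0.
move: (ln _) (ln (t / r)) (ln q) => a b d ab.
by rewrite ge_max !le_max lexx/= orbC le_min !ge_min ab lexx orbT.
Qed.

Let slack_mono s t : 0 < s -> s <= t -> slack s <= slack t.
Proof.
move=> s0 st; rewrite /slack big_seq [leRHS]big_seq; apply: ler_sum => r /rs_gt0 r0.
by rewrite ler_wpM2l ?mulr_ge0 ?(ltW c0) ?(ltW kappa0)// slack_term.
Qed.

Let slack_step s t r : r \in rs -> 0 < s -> r <= s -> s <= t -> t <= r * q ->
  kappa * c * ln (t / s) <= slack t - slack s.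
Proof.
move=> rrs s0 rs_ st tq; have r0 := rs_gt0 rrs; have t0 := lt_le_trans s0 st.
have kc0 : 0 <= kappa * c by rewrite mulr_ge0 ?ltW.
rewrite /slack !(big_rem r rrs) /= opprD addrACA.
have E (u : R) : r <= u -> u <= r * q -> Num.max 0 (Num.min (ln (u / r)) (ln q)) = ln u - ln r.
  move=> ru uq; have u0 := lt_le_trans r0 ru.
  rewrite (min_idPl _); last first.
    by rewrite ler_ln ?posrE ?divr_gt0 ?(lt_trans _ q1)// ler_pdivrMr// mulrC.
  rewrite -ln_div ?posrE// (max_idPr _)//.
  by rewrite ln_ge0// ler_pdivlMr// mul1r.
rewrite (E t) ?(le_trans rs_ st)// (E s)// ?(le_trans st)//.
rewrite -mulrBr ln_div ?posrE//.
have -> : ln t - ln r - (ln s - ln r) = ln t - ln s by ring.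
rewrite lerDl subr_ge0 big_seq [leRHS]big_seq; apply: ler_sum => r' /mem_rem /rs_gt0 r'0.
by rewrite ler_wpM2l// slack_term.
Qed.

(** Off the path, log |F| plus the log of the radius has slope at least [zeros + mult], more than
    kappa times the mass except on the windows, where [slack] is added. *)
Lemma above_path w a b : nice w a -> nice w b -> 0 < a -> a <= b -> b <= dst x w ->
  lf (pt w a) - kappa * g (pt w a) + ln a <= lf (pt w b) - kappa * g (pt w b) + ln b + eta.
Proof.
move=> wa wb a0 ab bx.
(* The value 0 to the left of [a] makes [E] monotone on the whole line, as [real_induction]
   requires. *)
pose E t := if a <= t then slack t else 0.
suff : (lf (pt w a) - kappa * g (pt w a) + ln a) + E a <=
    (lf (pt w b) - kappa * g (pt w b) + ln b) + E b.
  have /andP[h1 _] := slack_bound a; have /andP[_ h2] := slack_bound b.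
  rewrite /E lexx ab; move: (slack a) (slack b) h1 h2.
  by move: (lf _) (lf _) (g _) (g _) (ln a) (ln b) => *; lra.
have between v : a <= v -> v <= b -> nice w v.
  by move=> av vb; apply: (nice_mono wa av); case: wb => _ /andP[_]; exact: le_trans.
apply: (@real_induction R (fun t => lf (pt w t) - kappa * g (pt w t) + ln t) E) => //.
- move=> v /andP[av vb]; have wv := between v (ltW av) vb; have v0 := lt_trans a0 av.
  apply: cvgD; last first.
    apply: (@continuous_cvg _ _ _ _ _ _ (@ln R)); first exact: continuous_ln.
    by apply: cvg_at_left_filter; exact: cvg_id.
  apply: cvgB; last by apply: cvgM; [exact: cvg_cst|exact: g_left hphi _ _ wv v0].
  apply: (@continuous_cvg _ _ _ _ _ _ (@ln R)); last exact: poly_pt_left.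
  by apply: continuous_ln; apply: zpoly_gt0 => // p _; apply: inner_dst_gt0 => //; exact: inner_nice.
- move=> s t st; rewrite /E; have [as_|sa] := leP a s.
    by rewrite (le_trans as_ st) slack_mono// (lt_le_trans a0).
  by case: ifP => // _; case/andP: (slack_bound t).
move=> v /andP[av vb]; have wv := between v av (ltW vb); have v0 := lt_le_trans a0 av.
have v1 : v < 1 by apply: lt_le_trans vb _; case: wb => _ /andP[].
have [t1 /andP[vt1 t11] [_ alt]] := al_step k_complete [::] wv v0 v1.
have iv := inner_nice wv v0; have m0 := inner_mult_gt0 k_complete iv.
have nxv : ~ berk_le x (pt w v).
  by move=> /(le_pt k_complete _ wv); rewrite leNgt (lt_le_trans vb).
have vG : pt w v <> gauss_pt k.
  by move=> e; apply: nxv; rewrite e; exact: le_gauss.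
have upto (u : R) : v < u -> u <= Num.min t1 b -> [/\ nice w u, berk_le (pt w v) (pt w u),
    pt w v <> pt w u & al (pt w v) - al (pt w u) = ln (u / v) / (mult (pt w v))%:R].
  move=> vu; rewrite le_min => /andP[ut ub]; have wu := between u (le_trans av (ltW vu)) ub.
  split=> //; [by apply/pt_le_same => //; exact: ltW|exact: same_pt|].
  by apply: alt; rewrite vu.
have lnuv (u : R) : v < u -> 0 < ln (u / v) by move=> vu; rewrite ln_gt0// ltr_pdivlMr// mul1r.
have eE (u : R) : v <= u -> E u = slack u by move=> vu; rewrite /E (le_trans av vu).
have [small|[r rrs /andP[]]] := D_off iv nxv; last first.
  (* In a window the slope of phi is only known to be at most [c]; [slack] grows by kappa c log (u /
     v), which covers it. *)
  rewrite rad_pt// => rv vrq; pose u := Num.min (Num.min t1 b) (r * q).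
  have vu : v < u by rewrite !lt_min vt1 vb vrq.
  have [ut ur] : u <= Num.min t1 b /\ u <= r * q by split; rewrite /u ge_min lexx ?orbT.
  exists u; first by rewrite vu/= (le_trans ut)// ge_min lexx orbT.
  have [wu zu nzu alE] := upto u vu ut.
  have h1 := lf_ge k_complete D iv zu.
  have iu := inner_up k_complete iv zu.
  have h2 := slope_le_mass k_complete hphi iv zu nzu.
  have h3 := mass_lec k_complete hphi iu.
  have := le_trans h2 h3; rewrite (ltr_slope _ iv zu nzu) => h4.
  have h5 := slack_step rrs v0 rv (ltW vu) ur.
  rewrite !eE ?(ltW vu)//; have u0 := lt_trans v0 vu.
  have h6 := lnuv u vu.
  have h7 : al (pt w v) - al (pt w u) <= ln (u / v).
    by rewrite alE ler_pdivrMr ?ltr0n// ler_peMr ?(ltW h6)// ler1n.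
  have h8 : 0 <= al (pt w v) - al (pt w u) by rewrite subr_ge0 al_le.
  have h9 : ln u - ln v = ln (u / v) by rewrite ln_div.
  have h10 : 0 <= (zeros D (pt w v))%:R * (al (pt w v) - al (pt w u)) by rewrite mulr_ge0.
  have h11 : kappa * (g (pt w u) - g (pt w v)) <= kappa * c * ln (u / v).
    rewrite -mulrA ler_pM2l// (le_trans h4)// ler_wpM2l ?(ltW c0)//.
  move: h1 h5 h6 h9 h10 h11; clear.
  move: (lf (pt w u)) (lf (pt w v)) (g (pt w u)) (g (pt w v)) (slack u) (slack v)
    (ln (u / v)) (ln u) (ln v) (_ * (_ - _)) => *; lra.
(* The mass is an infimum of slopes, so over short steps the slope of phi also stays below this
   bound. *)
have : mass (pt w v) < (zeros D (pt w v) + mult (pt w v))%:R / kappa.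
  by rewrite ltr_pdivlMr// mulrC.
move=> /(mass_lt_slope k_complete hphi iv vG)[u1 [vu1 nvu1 hu1]].
have [wu1 ru1 u1E] := inner_above k_complete wv vu1.
have vr1 : v < rad u1.
  rewrite lt_neqAle ru1 andbT; apply: contra_notN nvu1 => /eqP e.
  by rewrite u1E -e.
pose u := Num.min (Num.min t1 b) (rad u1).
have vu : v < u by rewrite !lt_min vt1 vb vr1.
have [ut ur] : u <= Num.min t1 b /\ u <= rad u1 by split; rewrite /u ge_min lexx ?orbT.
exists u; first by rewrite vu/= (le_trans ut)// ge_min lexx orbT.
have [wu zu nzu alE] := upto u vu ut.
have uu1 : berk_le (pt w u) u1 by rewrite u1E; apply/pt_le_same.
have := ltW (hu1 _ zu nzu uu1); rewrite (ltr_slope _ iv zu nzu) => h4.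
have h1 := lf_ge k_complete D iv zu.
rewrite !eE ?(ltW vu)//; have u0 := lt_trans v0 vu.
have h5 : slack v <= slack u by apply: slack_mono => //; exact: ltW.
have h9 : ln u - ln v = ln (u / v) by rewrite ln_div.
have h10 : (mult (pt w v))%:R * (al (pt w v) - al (pt w u)) = ln (u / v).
  by rewrite alE mulrC divfK// pnatr_eq0 -lt0n.
have h11 : kappa * (g (pt w u) - g (pt w v)) <=
    (zeros D (pt w v))%:R * (al (pt w v) - al (pt w u)) + ln (u / v).
  rewrite -h10 -mulrDl -natrD.
  have := h4; rewrite -(ler_pM2l kappa0) => /le_trans; apply.
  by rewrite mulrA mulrCA divff ?gt_eqF// mulr1.
move: h1 h5 h9 h11; clear.
move: (lf (pt w u)) (lf (pt w v)) (g (pt w u)) (g (pt w v)) (slack u) (slack v)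
    (ln (u / v)) (ln u) (ln v) (_ * (_ - _)) => *; lra.
Qed.

(** [j] is where the path up from [y] joins the one from [x]. The bound is stated at every [u]
    between [x] and [j], because [x] itself need not be of type II or III. *)
Lemma path_bound y : inner y -> exists j, [/\ inner j, berk_le x j &
  forall u, inner u -> berk_le x u -> berk_le u j ->
    lf y - kappa * g y + ln (rad y) <= lf u - kappa * g u + eta].
Proof.
have arith (l1 l2 l3 n1 n2 g1 g2 g3 : R) : l2 - kappa * g2 <= l3 - kappa * g3 ->
    l1 - kappa * g1 + n1 <= l2 - kappa * g2 + n2 + eta -> n2 <= 0 ->
    l1 - kappa * g1 + n1 <= l3 - kappa * g3 + eta by lra.
have eta0 : 0 <= eta by case/andP: (slack_bound 0); exact: le_trans.
have below u j : inner u -> berk_le x u -> berk_le u j ->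
    lf j - kappa * g j <= lf u - kappa * g u.
  move=> [w [s [ws s0 uE]]] xu uj; rewrite uE in xu uj *.
  have [wj sj ->] := inner_above k_complete ws uj.
  exact: below_path.
move=> iy; have [xy|nxy] := pselect (berk_le x y).
  exists y; split=> // u iu xu uy; apply: lerD; first exact: below.
  by apply: le_trans eta0; rewrite ln_le0// rad_le1.
have [w [s [ws s0 yE]]] := iy.
have st : s < dst x w.
  by rewrite ltNge; apply/negP => h; apply: nxy; rewrite yE; apply/(le_pt k_complete).
have wt : nice w (dst x w).
  by apply: (nice_mono ws (ltW st)); apply: dst_le1; case: ws.
have xj : berk_le x (pt w (dst x w)) by apply/(le_pt k_complete).
have ij := inner_nice wt (lt_trans s0 st).
exists (pt w (dst x w)); split=> // u iu xu uj.
have h1 := below _ _ iu xu uj.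
have h2 := above_path ws wt s0 (ltW st) (lexx _).
have h3 : ln (dst x w) <= 0 by rewrite ln_le0// dst_le1//; case: ws.
rewrite yE rad_pt//; exact: arith h1 h2 h3.
Qed.

Variables (p : R) (phix : phi x = p%:E).

(** [u] is moved down to [x] in [path_bound]: phi is followed through [phi_above] and |F| by
    continuity of evaluation. *)
Lemma inner_bound y : inner y ->
  lf y - kappa * g y + ln (rad y) <= lf x - kappa * p + eta.
Proof.
have arith (l1 l2 l3 n g1 g2 e : R) : l1 - kappa * g1 + n <= l2 - kappa * g2 + eta ->
    l2 < l3 + e -> kappa * (p - e) < kappa * g2 ->
    l1 - kappa * g1 + n <= l3 - kappa * p + eta + (1 + kappa) * e by lra.
move=> iy; have [j [ij xj h]] := path_bound iy.
have [xE|nxj] := pselect (x = j).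
  have ix : inner x by rewrite xE.
  by have := h x ix (@berk_le_refl _ _ x) xj; rewrite phix.
have xG : x <> gauss_pt k.
  by move=> xG; apply: nxj; apply: berk_le_anti => //; rewrite xG; exact: le_gauss.
have fx0 := zpoly_gt0 k_complete D_gt0.
apply: (@ler_eps _ (1 + kappa)); first by rewrite addr_ge0// ltW.
move=> e e0 _.
have : \forall u \near x, poly_pt u (zpoly D) < expR (lf x + e).
  by apply: nbhs_eval_lt; rewrite -/(poly_pt x _) -{1}(lnK fx0) ltr_expR ltrDl.
move=> /(@nbhs_above R k C k_complete x _ xG)[s1 xs1 hs1].
have xm : rad x < Num.min s1 (rad j) by rewrite lt_min xs1 (rad_lt_strict C k_complete xj nxj).
have U : nbhs (phi x) [set b | `|p - fine b| < e].
  rewrite phix; change (nbhs p [set a : R | `|p - a| < e]); exact: nbhsx_ballx.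
have [w [t [wt xt tm xu Uu]]] := phi_above k_complete hphi xG xm U.
have := tm; rewrite lt_min => /andP[ts tj].
have t0 : 0 < t by apply: le_lt_trans xt; exact: rad_ge0.
have uj : berk_le (pt w t) j.
  by apply: (@chain_le _ _ C k_complete _ _ _ xu xj); rewrite rad_pt// ltW.
have hu := h _ (inner_nice wt t0) xu uj.
have h1 : lf (pt w t) < lf x + e.
  have u0 : 0 < poly_pt (pt w t) (zpoly D).
    by apply: zpoly_gt0 => // r _; apply: inner_dst_gt0 => //; exact: inner_nice.
  rewrite -ltr_expR (lnK u0); apply: hs1.
  by split=> //; rewrite rad_pt.
have h2 : p - e < g (pt w t).
  by move: Uu; rewrite /= ltr_norml => /andP[_]; rewrite ltrBlDr -ltrBlDl.
have h3 : kappa * (p - e) < kappa * g (pt w t) by rewrite ltr_pM2l.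
exact: arith hu h1 h3.
Qed.

(** Other points are replaced by a nearby disc above them, where |F| is at least as large, A_X at
    most as large and phi almost the same. *)
Lemma pointwise_bound y : phi y <> -oo%E ->
  ((poly_pt y (zpoly D))%:E * expeR (- (kappa%:E * phi y) - A_X C y) <=
   (poly_pt x (zpoly D) * expR (- (kappa * p) + eta))%:E)%E.
Proof.
have arith (l B n n' g1 g2 e : R) : l <= B + kappa * g2 - n' ->
    kappa * g2 < kappa * (g1 + e) -> n <= n' -> l <= B + kappa * g1 - n + kappa * e by lra.
move=> yfin; have fx0 := zpoly_gt0 k_complete D_gt0.
have phiy : phi y \is a fin_num.
  by case: hphi => /(_ y) + _ _ _; case: (phi y) yfin.
move: (phiy); rewrite fin_numE => _; have phiyE := fineK phiy.
(* Points of radius 0 contribute 0 to the norm, since A_X is infinite there. *)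
rewrite A_XE//; case: eqP => [_|/eqP ry].
  rewrite -phiyE -(EFinM kappa) -EFinN /= mule0 lee_fin mulr_ge0 ?expR_ge0 ?(ltW fx0)//.
have r0 : 0 < rad y by rewrite lt_def ry rad_ge0.
rewrite -phiyE -(EFinM kappa) -!EFinN -EFinD /= -EFinM lee_fin.
set B := lf x - kappa * p + eta.
have -> : poly_pt x (zpoly D) * expR (- (kappa * p) + eta) = expR B.
  by rewrite -{1}(lnK fx0) -expRD /B addrA.
suff h : poly_pt y (zpoly D) <= expR (B + kappa * g y - ln (rad y)).
  apply: le_trans (ler_wpM2r (expR_ge0 _) h) _.
  rewrite -expRD ler_expR le_eqVlt; apply/orP; left; apply/eqP; ring.
have inner_case z : inner z -> poly_pt z (zpoly D) <= expR (B + kappa * g z - ln (rad z)).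
  move=> iz; have z0 : 0 < poly_pt z (zpoly D).
    by apply: zpoly_gt0 => // r _; exact: inner_dst_gt0.
  rewrite -{1}(lnK z0) ler_expR; have := inner_bound iz; rewrite -/B.
  by move: (lf z) (g z) (ln (rad z)) => *; lra.
have [->|yG] := pselect (y = gauss_pt k); first exact/inner_case/inner_gauss.
have [y0|y0] := eqVneq (poly_pt y (zpoly D)) 0; first by rewrite y0 expR_ge0.
have {}y0 : 0 < poly_pt y (zpoly D) by rewrite lt_def y0 berk_ge0.
rewrite -{1}(lnK y0) ler_expR.
apply: (@ler_eps _ kappa); first exact: ltW.
move=> e e0 _.
have U : nbhs (phi y) [set b | `|g y - fine b| < e].
  rewrite -{1}phiyE; change (nbhs (g y) [set a : R | `|g y - a| < e]); exact: nbhsx_ballx.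
have ry1 : rad y < rad y + 1 by rewrite ltrDl.
have [w [t [wt yt _ yz Uz]]] := phi_above k_complete hphi yG ry1 U.
have t0 := lt_trans r0 yt; have iz := inner_nice wt t0.
have := le_trans (yz (ptate (zpoly D))) (inner_case _ iz).
rewrite -/(poly_pt y _) -{1}(lnK y0) ler_expR rad_pt// => h.
have h1 : g (pt w t) < g y + e.
  by move: Uz; rewrite /= ltr_norml => /andP[+ _]; rewrite ltrBrDl addrC -subr_gt0; move=> *; lra.
have h2 : kappa * g (pt w t) < kappa * (g y + e) by rewrite ltr_pM2l.
have h3 : ln (rad y) <= ln t by rewrite ler_ln ?posrE// ltW.
exact: arith h h2 h3.
Qed.

End Divisor.

Lemma optimal_zeros x p kappa eta : phi x = p%:E -> 0 < kappa -> 0 < eta ->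
  exists F : {poly k}, 0 < poly_pt x F /\ forall y, phi y <> -oo%E ->
  ((poly_pt y F)%:E * expeR (- (kappa%:E * phi y) - A_X C y) <=
   (poly_pt x F * expR (- (kappa * p) + eta))%:E)%E.
Proof.
move=> phix kappa0 eta0.
pose n := (quant C c phi kappa x (gauss_pt k)).+1.
have kc0 : 0 < kappa * c by rewrite mulr_gt0.
(* At most [n - 1] windows occur, each costing kappa c log q = eta / n. *)
pose q := expR (eta / (kappa * c * n%:R)).
have q1 : 1 < q by rewrite expR_gt1 divr_gt0// mulr_gt0.
have tame := tame_point (C := C) k_complete k_tame.
have [D [rs [rss rs0 Dx DZ Du]]] := greedy k_complete q1 tame
  (tame_limit k_complete tame)
  (quant_divisible c phi kappa (x := x)) (quant_superadditive k_complete hphi c0 kappa0 (x := x)).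
exists (zpoly D); split; first exact: zpoly_gt0.
apply: (@pointwise_bound kappa eta x D rs q) => //.
- move=> z iz nxz; have [h|h] := DZ z (conj iz nxz); [left|by right].
  apply: (@lt_le_trans _ _ (quant C c phi kappa x z + mult z)%:R).
    exact: quant_gt.
  by rewrite ler_nat leq_add2r.
- move=> u iu xu; apply: (@le_trans _ _ (quant C c phi kappa x u)%:R); last exact: quant_le.
  by rewrite ler_nat Du.
- have -> : kappa * c * ln q = eta / n%:R.
    have n0 : n%:R != 0 :> R by rewrite pnatr_eq0.
    rewrite /q expRK; move: (kappa * c) (n%:R) kc0 n0 => d N d0 N0.
    by field; rewrite N0 gt_eqF.
  rewrite mulrCA ger_pMr// ler_pdivrMr// mul1r ler_nat.
  exact: leq_trans rss _.
Qed.

End Optimal.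

Lemma lee_of_gt (R : realType) (X Y : \bar R) (d : R) : (X < +oo)%E ->
  (forall b : R, (X < b%:E)%E -> (Y <= (b + d)%:E)%E) -> (Y <= X + d%:E)%E.
Proof.
case: X => [a| |]//= _ h.
  apply/lee_addgt0Pr => e e0; have := h (a + e); rewrite lte_fin ltrDl => /(_ e0).
  by rewrite -!EFinD addrAC.
rewrite addNye leeNy_eq; apply/eqP; case: Y h => [y| |]// h.
  by exfalso; have := h (y - d - 1) (ltNyr _); rewrite lee_fin; lra.
by have := h 0 (ltNyr _).
Qed.

(** * Demailly approximation *)

Section Regularization.
Variables (R : realType) (k : valuedField R).
Implicit Types (h : berk k -> \bar R) (x : berk k).

Lemma usc_reg_ge h x : (h x <= usc_reg h x)%E.
Proof. by apply: le_ereal_inf_tmp => _ [h' [_ hh'] <-]; exact: hh'. Qed.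

(** The function equal to [B] on the open set [U] and to +oo elsewhere is an upper semicontinuous
    majorant. *)
Lemma usc_reg_le h x (U : set (berk k)) (B : \bar R) : U x ->
  (forall y, U y -> nbhs y U) -> (forall y, U y -> (h y <= B)%E) ->
  (usc_reg h x <= B)%E.
Proof.
move=> Ux oU hU; pose h0 y := if `[< U y >] then B else +oo%E.
have -> : B = h0 x by rewrite /h0; case: asboolP.
apply: ereal_inf_lbound; exists h0 => //; split.
  move=> y a; rewrite /h0; case: asboolP => // Uy aB.
  by exists U; [exact: oU|move=> y' Uy'; rewrite asboolT].
by move=> y; rewrite /h0; case: asboolP => [/hU//|_]; exact: leey.
Qed.

End Regularization.

(** * The norm with right limit and the logarithmic supremum *)

Section Norms.
Variables (R : realType) (k : valuedField R) (C : completedAlgClosure k).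
Hypothesis k_complete : vf_complete k.
Variable psi : berk k -> \bar R.
Hypothesis psi_le0 : forall x, (psi x <= 0)%E.
Implicit Types (x y z : berk k) (f : tate k) (e : R).

Let nrm e f := phi_norm C (fun x => ((1 + e)%:E * psi x)%E) f.

Let psi_fin x e : 0 < e -> ((1 + e)%:E * psi x)%E <> -oo%E ->
  exists2 b : R, psi x = b%:E & b <= 0.
Proof.
move=> e0; have := psi_le0 x; case: (psi x) => [b| |] //.
  by rewrite lee_fin => b0 _; exists b.
by rewrite gt0_muleNy ?lte_fin ?addr_gt0.
Qed.

(** As psi <= 0, the norm grows with [e]; hence its right limit at 0 is an infimum, and any single
    [e] gives an upper bound. *)
Lemma nrm_mono f : {in `]0, +oo[ &, {homo nrm ^~ f : e e' / e <= e' >-> (e <= e')%E}}.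
Proof.
move=> e e'; rewrite !in_itv /= !andbT => e0 e'0 ee'.
apply: ge_ereal_sup => _ [x /= xe <-]; have [b bE b0] := psi_fin e0 xe.
apply: (@le_trans _ _ ((x f)%:E * expeR (- ((1 + e')%:E * psi x) - A_X C x))%E).
  apply: lee_wpmul2l; first by rewrite lee_fin berk_ge0.
  rewrite lee_expeR leeB// bE -!EFinM leeN2 lee_fin.
  by rewrite ler_wnM2r// lerD2l.
by apply: ereal_sup_ubound; exists x => //=; rewrite bE.
Qed.

Let plusE f : phi_norm_plus C psi f = ereal_inf [set nrm e f | e in `]0, +oo[].
Proof.
apply: cvg_lim => //.
exact: (@nondecreasing_at_right_cvge R (nrm ^~ f) 0 (BInfty _ false) isT (@nrm_mono f)).
Qed.

Lemma norm_plus_le f e : 0 < e -> (phi_norm_plus C psi f <= nrm e f)%E.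
Proof.
by move=> e0; rewrite plusE; apply: ereal_inf_lbound; exists e => //=; rewrite in_itv /= e0.
Qed.

Lemma norm_plus_ge f z (a b : R) : psi z = b%:E -> A_X C z = a%:E ->
  ((z f * expR (- b - a))%:E <= phi_norm_plus C psi f)%E.
Proof.
move=> pz az; have := psi_le0 z; rewrite pz lee_fin => b0.
rewrite plusE; apply: le_ereal_inf_tmp => _ [e /= + <-]; rewrite in_itv /= andbT => e0.
apply: (@le_trans _ _ ((z f)%:E * expeR (- ((1 + e)%:E * psi z) - A_X C z))%E).
  rewrite pz az -(EFinM (1 + e)) -!EFinN -EFinD /= -EFinM lee_fin ler_wpM2l ?berk_ge0// ler_expR.
  rewrite lerD2r lerN2 mulrDl mul1r gerDl.
  by rewrite mulr_ge0_le0// ltW.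
by apply: ereal_sup_ubound; exists z => //=; rewrite pz.
Qed.

Hypothesis psiG : psi (gauss_pt k) != -oo%E.

Lemma gauss_norm_gt0 f : f <> 0 -> 0 < gauss_norm f.
Proof.
move=> f0; rewrite lt_def gauss_norm_ge0 andbT; apply/eqP => g0; apply: f0.
apply: tate_ext => i; apply/vabs_eq0; apply/eqP; rewrite eq_le vabs_ge0 andbT.
by rewrite -g0 gauss_norm_ub.
Qed.

Lemma norm_plus_gt0 f : f <> 0 -> (0 < phi_norm_plus C psi f)%E.
Proof.
move=> f0; have [b bE] : exists b : R, psi (gauss_pt k) = b%:E.
  by have := psi_le0 (gauss_pt k); case: (psi _) psiG => // b _ _; exists b.
have aG : A_X C (gauss_pt k) = 0%:E.
  by rewrite A_XE// rad_gauss// oner_eq0 ln1 oppr0.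
apply: lt_le_trans (norm_plus_ge f bE aG).
by rewrite lte_fin mulr_gt0 ?expR_gt0//; exact: gauss_norm_gt0.
Qed.

Definition log_sup y : \bar R := ereal_sup [set lne ((y f)%:E / phi_norm_plus C psi f)
               | f in [set f | multiplier_ideal C psi f /\ f <> 0%R]].

(** The norm tested at the single point [z] controls |f| at [z], and so at all points below [z]
    simultaneously. *)
Lemma log_sup_le y z (a b : R) : berk_le y z -> psi z = b%:E -> A_X C z = a%:E ->
  (log_sup y <= (b + a)%:E)%E.
Proof.
move=> yz pz az; apply: ge_ereal_sup => _ [f [fI f0] <-].
have := norm_plus_ge f pz az; have := norm_plus_gt0 f0; move: fI.
rewrite /multiplier_ideal /=; case: (phi_norm_plus C psi f) => [n| |]//= _.
rewrite lte_fin lee_fin => n0 zn; rewrite inver gt_eqF// -EFinM.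
have [yf|yf] := leP (y f / n) 0; first by rewrite le0_lneNy// leNye.
rewrite lne_EFin// lee_fin -[b + a]expRK ler_ln ?posrE ?expR_gt0//.
rewrite ler_pdivrMr//; apply: le_trans (yz f) _.
rewrite -ler_pdivrMl ?expR_gt0// -expRN mulrC opprD.
exact: zn.
Qed.

Lemma log_sup_ge x f (B : R) : 0 < x f -> (phi_norm_plus C psi f <= B%:E)%E ->
  ((ln (x f / B))%:E <= log_sup x)%E.
Proof.
move=> xf hB; have f0 : f <> 0 by move=> e; rewrite e berk0 ltxx in xf.
have := norm_plus_gt0 f0; case E : (phi_norm_plus C psi f) hB => [n| |]//.
rewrite lee_fin lte_fin => nB n0; have B0 := lt_le_trans n0 nB.
apply: (@le_trans _ _ (ln (x f / n))%:E).
  by rewrite lee_fin ler_ln ?posrE ?divr_gt0// ler_pM2l// lef_pV2.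
apply: ereal_sup_ubound; exists f; first by split=> //; rewrite /multiplier_ideal /= E ltry.
by rewrite E inver gt_eqF// -EFinM lne_EFin// divr_gt0.
Qed.

End Norms.

(** * The two inequalities *)

Section Demailly.
Variables (R : realType) (k : valuedField R) (C : completedAlgClosure k).
Hypothesis k_complete : vf_complete k.
Hypothesis k_tame : GRing.closed_field_axiom k \/
   (trivially_valued k /\ perfect_field k) \/
   (spherically_complete k /\ residue_char0 k).
Variables (c : R) (phi : berk k -> \bar R).
Hypotheses (hphi : subharmonic C c phi) (c0 : 0 < c).
Hypothesis phi_le0 : forall x, (phi x <= 0)%E.
Variable m : nat.
Hypothesis m1 : (1 <= m)%N.
Implicit Types (x y z : berk k).

Local Notation mphi := (fun y => m%:R%:E * phi y)%E.
Local Notation rad := (rad C).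

Let m0 : 0 < m%:R :> R. Proof. by rewrite ltr0n. Qed.

Let mphi_le0 x : (m%:R%:E * phi x <= 0)%E.
Proof. by rewrite mule_ge0_le0// lee_fin ltW. Qed.

Let mphiG : (m%:R%:E * phi (gauss_pt k))%E != -oo%E.
Proof. by rewrite (phiE k_complete hphi (inner_gauss C)). Qed.

Lemma demaillyE x : demailly C phi m x = ((m%:R^-1)%:E * usc_reg (log_sup C mphi) x)%E.
Proof. by []. Qed.

Lemma demailly_ge x : (phi x <= demailly C phi m x)%E.
Proof.
case phix : (phi x) => [p| |]; last exact: leNye.
  have p0 : p <= 0 by have := phi_le0 x; rewrite phix.
  (* With kappa = (1 + e) m and eta = e the bound is (kappa p - e) / m, that is p + e p - e / m,
     which is at least p - (1 - p) e since m >= 1. *)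
  have lower (e : R) : 0 < e -> ((p - (1 - p) * e)%:E <= demailly C phi m x)%E.
    move=> e0; have kap0 : 0 < (1 + e) * m%:R by rewrite mulr_gt0// addr_gt0.
    have [F [Fx hF]] := optimal_zeros k_complete k_tame hphi c0 phix kap0 e0.
    set B := _ * expR _ in hF.
    have hB : (phi_norm_plus C mphi (ptate F) <= B%:E)%E.
      apply: (le_trans (@norm_plus_le _ _ C mphi mphi_le0 (ptate F) e e0)).
      apply: ge_ereal_sup => _ [y /= hy <-]; rewrite muleA -EFinM.
      apply: hF => yNy; apply: hy; rewrite yNy muleA -EFinM gt0_muleNy// lte_fin//.
    have := log_sup_ge k_complete mphi_le0 mphiG Fx hB.
    move=> /le_trans/(_ (usc_reg_ge _ x)) h.
    have mi0 : (0 <= (m%:R^-1)%:E :> \bar R)%E by rewrite lee_fin invr_ge0 ltW.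
    rewrite demaillyE; apply: (le_trans _ (lee_wpmul2l mi0 h)); rewrite -EFinM lee_fin.
    rewrite /B invfM mulrA divff ?gt_eqF// mul1r lnV ?posrE ?expR_gt0// expRK.
    rewrite ler_pdivlMl// -subr_ge0.
    have m1' : 1 <= m%:R :> R by rewrite ler1n.
    have -> : - (- ((1 + e) * m%:R * p) + e) - m%:R * (p - (1 - p) * e) = e * (m%:R - 1) by ring.
    by rewrite mulr_ge0 ?(ltW e0)// subr_ge0.
  case: (demailly C phi m x) lower => [d lower| |lower]; last 2 first.
  - by rewrite leey.
  - by have := lower 1 ltr01.
  rewrite lee_fin; apply: (@ler_eps _ (1 - p)); first by rewrite subr_ge0 (le_trans p0).
  by move=> e e0 _; have := lower e e0; rewrite lee_fin lerBlDr.
by have := phi_le0 x; rewrite phix.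
Qed.

(** One point [z] above [x] bounds the supremum on a whole neighbourhood of [x], so the bound passes
    to the regularization; [z] is then let close to [x]. *)
Lemma demailly_le x : (demailly C phi m x <= (phi x + (m%:R^-1)%:E * A_X C x)%dE)%E.
Proof.
have arith (b a' g l : R) : g <= b -> l <= a' -> m%:R^-1 * (m%:R * g + l) <= b + a' / m%:R.
  move=> gb la; rewrite mulrDr mulKf ?(gt_eqF m0)// [a' / _]mulrC lerD//.
  by rewrite ler_wpM2l// invr_ge0 ltW.
have phi_lty : (phi x < +oo)%E by apply: le_lt_trans (phi_le0 x) (ltry _).
rewrite A_XE//; case: eqP => [_|/eqP r0].
  (* The dual addition gives +oo here, even where phi is -oo. *)
  rewrite gt0_muley ?lte_fin ?invr_gt0//.
  by have -> : (phi x + +oo)%dE = +oo%E; [case: (phi x)|exact: leey].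
have {}r0 : 0 < rad x by rewrite lt_def r0 rad_ge0.
set a := - ln (rad x).
have -> : (phi x + (m%:R^-1)%:E * a%:E)%dE = (phi x + (a / m%:R)%:E)%E.
  by rewrite -EFinM mulrC; case: (phi x) phi_lty.
have key z (b : R) (U : set (berk k)) : inner C z -> berk_le x z -> (phi z <= b%:E)%E ->
    U x -> (forall y, U y -> nbhs y U) -> (forall y, U y -> berk_le y z) ->
    (demailly C phi m x <= (b + a / m%:R)%:E)%E.
  move=> iz xz zb Ux oU Uz.
  have pz := phiE k_complete hphi iz.
  have az : A_X C z = (- ln (rad z))%:E by rewrite A_XE// gt_eqF// inner_rad.
  have mz : (m%:R%:E * phi z)%E = (m%:R * fine (phi z))%:E by rewrite {1}pz.
  have : (usc_reg (log_sup C mphi) x <= (m%:R * fine (phi z) + - ln (rad z))%:E)%E.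
    apply: usc_reg_le Ux oU _ => y Uy.
    exact: (log_sup_le k_complete mphi_le0 mphiG (Uz y Uy) mz az).
  move=> h; rewrite demaillyE.
  have mi0 : (0 <= (m%:R^-1)%:E :> \bar R)%E by rewrite lee_fin invr_ge0 ltW.
  apply: (le_trans (lee_wpmul2l mi0 h)); rewrite -EFinM lee_fin.
  have gb : fine (phi z) <= b by move: zb; rewrite pz.
  have la : - ln (rad z) <= a.
    by rewrite lerN2 ler_ln ?posrE ?(inner_rad k_complete iz)// rad_mono.
  exact: arith gb la.
apply: lee_of_gt => // b xb.
have [xG|xG] := pselect (x = gauss_pt k).
  apply: (key x b setT) => //.
  - by rewrite xG; exact: inner_gauss.
  - exact: ltW.
  - by move=> y _; exact: filterT.
  - by move=> y _; rewrite xG; exact: le_gauss.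
have xU : nbhs (phi x) [set t : \bar R | (t < b%:E)%E].
  exact: open_ereal_lt'.
have r1 : rad x < rad x + 1 by rewrite ltrDl.
have [w [t [wt xt _ xz zb]]] := phi_above k_complete hphi xG r1 xU.
have t0 := lt_trans r0 xt.
have nxz : x <> pt w t.
  by move=> e; have := rad_pt k_complete wt; rewrite -e => e'; rewrite e' ltxx in xt.
have iz : inner C (pt w t) by exists w, t.
have [v v1 [xv zE]] := above_nice C k_complete xz nxz.
have nv : nice v (rad (pt w t)) by split=> //; rewrite rad_ge0 rad_le1.
(* A strict sublevel set of the minimal polynomial of a centre [v] of the disc: it is open, contains
   [x], and its points are closer to [v] than the radius of the disc, hence below it. *)
apply: (key _ b [set y : berk k | y (ptate (mpoly v)) < Lam v (rad (pt w t))] iz xz) => //.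
- exact: ltW.
- by rewrite /= -/(poly_pt x _) mpoly_dst// Lam_lt// dst_ge0.
- by move=> y /=; exact: nbhs_eval_lt.
- move=> y /=; rewrite -/(poly_pt y _) mpoly_dst// => h.
  rewrite zE; apply/(le_pt k_complete) => //.
  rewrite -(@Lam_le _ _ _ v) ?dst_ge0 ?rad_ge0//; exact: ltW.
Qed.

End Demailly.

Theorem theorem2 (R : realType) (k : valuedField R)
    (C : completedAlgClosure k) (phi : berk k -> \bar R) :
  vf_complete k ->
  (GRing.closed_field_axiom k \/
   (trivially_valued k /\ perfect_field k) \/
   (spherically_complete k /\ residue_char0 k)) ->
  quasisubharmonic C phi -> (forall x, phi x <= 0)%E ->
  (forall (m : nat) (x : berk k), (1 <= m)%N ->
     (phi x <= demailly C phi m x)%E /\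
     (demailly C phi m x <= (phi x + (m%:R^-1)%:E * A_X C x)%dE)%E) /\
  (forall x : berk k, (A_X C x < +oo)%E ->
     demailly C phi m x @[m --> \oo] --> phi x).
Proof.
move=> k_complete k_tame [c [c0 hphi]] phi_le0.
have bounds m x : (1 <= m)%N -> (phi x <= demailly C phi m x)%E /\
    (demailly C phi m x <= (phi x + (m%:R^-1)%:E * A_X C x)%dE)%E.
  move=> m1; split; first exact: (demailly_ge k_complete k_tame hphi c0 phi_le0 m1).
  exact: (demailly_le k_complete hphi phi_le0 m1).
split=> // x; have := bounds ^~ x; rewrite A_XE//; case: eqP => // _ {}bounds _.
case phix : (phi x) => [p| |]; last 2 first.
- by have := phi_le0 x; rewrite phix.
(* With A_X finite and phi = -oo, the upper bound forces the value -oo for every m >= 1. *)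
- apply: (@cvg_trans _ ((fun=> -oo%E) @ \oo)); last exact: cvg_cst.
  apply: near_eq_cvg; exists 1%N => // m /= m1; apply/esym/eqP.
  by rewrite -leeNy_eq; have [_] := bounds m m1; rewrite phix.
apply: (@squeeze_cvge _ _ _ _ (fun=> p%:E) _ (fun m => (p + m%:R^-1 * - ln (rad C x))%:E)).
- exists 1%N => // m /= m1; have [h1 h2] := bounds m m1.
  by rewrite phix in h1 h2; rewrite h1.
- exact: cvg_cst.
apply: cvg_EFin; first exact: nearW.
rewrite -[X in _ --> X]addr0; apply: cvgD; first exact: cvg_cst.
rewrite -[X in _ --> X](mul0r (- ln (rad C x))); apply: cvgM; last exact: cvg_cst.
by rewrite -cvg_shiftS; exact: cvg_harmonic.
Qed.
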